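(* Let $\beta\in\mathbb{R}$, let $\psi\in\mathfrak{M}_0'=\mathfrak{M}_0'(\beta)$ and let $\omega$ be an arbitrary modulus of continuity. Then, as $n\to\infty$ ($n\in\mathbb{N}$), $$E_n(C^{\psi}_{\beta}H_\omega)=\frac{\theta_n(\omega)}{\pi}\Big|\sin\frac{\beta\pi}{2}\Big|\int_0^{1/n}\psi\Big(\frac1t\Big)\frac{\omega(t)}{t}\,dt+O(1)\,\psi(n)\,\omega(1/n),$$ where $\theta_n(\omega)\in[2/3,1]$ and $O(1)$ is a quantity uniformly bounded in $n$ and $\beta$. If $\omega$ is a convex upwards (i.e. concave) modulus of continuity, then $\theta_n(\omega)=1$.
   Context: $L$ is the space of $2\pi$-periodic functions summable over the period; $C$ is the space of continuous $2\pi$-periodic functions with norm $\|f\|_C=\max_t|f(t)|$. A modulus of continuity is a continuous nondecreasing function $\omega$ on $[0,\infty)$ with $\omega(0)=0$ and $\omega(s+t)\le\omega(s)+\omega(t)$. $(\psi,\beta)$-derivative: for $f\in L$ with Fourier series $\frac{a_0}{2}+\sum_{k\ge1}(a_k\cos kx+b_k\sin kx)$, a sequence $\psi(k)$ and $\beta\in\mathbb{R}$, if the series $$\sum_{k=1}^\infty\frac1{\psi(k)}\Big(a_k\cos\big(kx+\tfrac{\beta\pi}{2}\big)+b_k\sin\big(kx+\tfrac{\beta\pi}{2}\big)\Big)$$ is the Fourier series of some $\varphi\in L$, then $\varphi$ is called the $(\psi,\beta)$-derivative of $f$, denoted $f^\psi_\beta$. $H_\omega=\{\varphi\in C:\ |\varphi(t')-\varphi(t'')|\le\omega(|t'-t''|)\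 \forall t',t''\in\mathbb{R}\}$, and $C^\psi_\beta H_\omega$ is the set of continuous ($2\pi$-periodic) functions $f$ having a $(\psi,\beta)$-derivative with $f^\psi_\beta\in H_\omega$. $E_n(C^\psi_\beta H_\omega)=\sup_{f\in C^\psi_\beta H_\omega}\inf_{t_{n-1}}\|f-t_{n-1}\|_C$, the infimum being over trigonometric polynomials $t_{n-1}$ of order at most $n-1$. $\mathfrak{M}$ is the set of all continuous (positive) functions $\psi(t)$, $t\ge1$, that are convex downwards (convex in the usual sense) and satisfy $\lim_{t\to\infty}\psi(t)=0$. For $\psi\in\mathfrak{M}$ put $\eta(t)=\psi^{-1}(\psi(t)/2)$, with $\psi^{-1}$ the inverse function of $\psi$, and $\mu(t)=\mu(\psi;t)=\frac{t}{\eta(t)-t}$. Then $\mathfrak{M}_0=\{\psi\in\mathfrak{M}:\ 0<\mu(t)\le K<\infty\ \forall t\ge1\}$, where $K$ is a constant possibly depending on $\psi$. $\mathfrak{M}'=\mathfrak{M}'(\beta)$ is the set of $\psi\in\mathfrak{M}$ if $\sin\frac{\beta\pi}{2}=0$, and the set of $\psi\in\mathfrak{M}$ with $\int_1^\infty\frac{\psi(t)}{t}\,dt<\infty$ if $\sin\frac{\beta\pi}{2}\ne0$. Finally $\mathfrak{M}_0'=\mathfrak{M}'\cap\mathfrak{M}_0$. When $\sin\frac{\beta\pi}{2}=0$, the term containing the factor $|\sin\frac{\beta\pi}{2}|$ is understood to be $0$, even if the integral diverges. *)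

(* Defs.v *)
From HB Require Import structures.
From mathcomp Require Import all_boot all_order all_algebra.
From mathcomp Require Import all_classical all_reals all_analysis.
Import Order.TTheory GRing.Theory Num.Theory.
Import numFieldNormedType.Exports.

Set Implicit Arguments.
Unset Strict Implicit.
Unset Printing Implicit Defensive.

Local Open Scope classical_set_scope.
Local Open Scope ring_scope.

Section PsiBetaClasses.
Context {R : realType}.
Implicit Types (f g phi psi omega : R -> R) (beta t x : R) (k n m : nat).

Local Notation leb := (@lebesgue_measure R).

Definition space_L f : Prop :=
  periodic f (pi *+ 2) /\ leb.-integrable `[- pi, pi] (EFin \o f).

Definition space_C f : Prop := periodic f (pi *+ 2) /\ continuous f.

(* On space_C the supremum is attained and is max_t |f t|. *)
Definition normC f : R := sup (range (fun t => `|f t|)).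

Definition modulus_of_continuity omega : Prop :=
  [/\ {within `[0, +oo[, continuous omega},
      {in `[0, +oo[ &, {homo omega : s t / s <= t}},
      omega 0 = 0 &
      forall s t, 0 <= s -> 0 <= t -> omega (s + t) <= omega s + omega t].

Definition convex_upwards omega : Prop :=
  convex_function (E := R^o) `[0, +oo[%classic (fun t => - omega t).

Definition fourier_cos f k : R :=
  pi^-1 * \int[leb]_(t in `[- pi, pi]) (f t * cos (k%:R * t)).

Definition fourier_sin f k : R :=
  pi^-1 * \int[leb]_(t in `[- pi, pi]) (f t * sin (k%:R * t)).

(* Two formal trigonometric series are the same when their terms agree for
   every k as functions of x; the series defining the derivative has zero
   constant term. *)
Definition is_psi_beta_derivative psi beta f phi : Prop :=
  [/\ space_L f, space_L phi, fourier_cos phi 0 = 0 &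
      forall k x, (0 < k)%N ->
        fourier_cos phi k * cos (k%:R * x) + fourier_sin phi k * sin (k%:R * x)
        = (psi k%:R)^-1 *
          (fourier_cos f k * cos (k%:R * x + beta * pi / 2)
           + fourier_sin f k * sin (k%:R * x + beta * pi / 2))].

Definition class_H omega phi : Prop :=
  space_C phi /\ forall t' t'', `|phi t' - phi t''| <= omega `|t' - t''|.

(* The derivative is an element of L, determined only almost everywhere, so
   membership of the derivative in class_H means that one of its
   representatives is in class_H. *)
Definition class_CH psi beta omega f : Prop :=
  space_C f /\
  exists2 phi, is_psi_beta_derivative psi beta f phi & class_H omega phi.

Definition trig_polynomial m (T : R -> R) : Prop :=
  exists a b : nat -> R,
    T = (fun x => \sum_(k < m.+1)
                    (a k * cos (k%:R * x) + b k * sin (k%:R * x))).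

(* Meaningful for 0 < n, where n.-1 is n - 1. *)
Definition best_approx n f : \bar R :=
  ereal_inf [set (normC (f \- T))%:E | T in trig_polynomial n.-1].

Definition class_best_approx n (F : set (R -> R)) : \bar R :=
  ereal_sup [set best_approx n f | f in F].

Definition class_M psi : Prop :=
  [/\ {within `[1, +oo[, continuous psi},
      forall t, 1 <= t -> 0 < psi t,
      convex_function (E := R^o) `[1, +oo[%classic psi &
      psi t @[t --> +oo] --> 0].

(* Functions in class_M map [1, +oo[ bijectively onto ]0, psi 1]; the partial
   inverse below is their inverse on that range. *)
Definition psi_eta psi t : R := 'pinv_(fun=> 0) `[1, +oo[%classic psi (psi t / 2).

Definition psi_mu psi t : R := t / (psi_eta psi t - t).

Definition class_M0 psi : Prop :=
  class_M psi /\ exists K : R, forall t, 1 <= t -> 0 < psi_mu psi t <= K.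

Definition class_M' beta psi : Prop :=
  class_M psi /\
  (sin (beta * pi / 2) != 0 ->
   (\int[leb]_(t in `[1%R, +oo[) (psi t / t)%:E < +oo)%E).

Definition class_M0' beta psi : Prop := class_M' beta psi /\ class_M0 psi.

(* Real-valued Lebesgue integral: it is a real number by definition, so this
   vanishes when sin (beta * pi / 2) = 0 even if the integral diverges. *)
Definition main_term psi beta omega n : R :=
  pi^-1 * `|sin (beta * pi / 2)|
  * \int[leb]_(t in `]0, n%:R^-1]) (psi t^-1 * omega t / t).

End PsiBetaClasses.

(* Main.v *)
Require Import Defs.
From HB Require Import structures.
From mathcomp Require Import all_boot all_order all_algebra.
From mathcomp Require Import all_classical all_reals all_analysis.
From mathcomp Require Import ring lra.
From mathcomp Require Import measurable_realfun.
Import Order.TTheory GRing.Theory Num.Theory.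
Import numFieldNormedType.Exports.
Set Implicit Arguments.
Unset Strict Implicit.
Unset Printing Implicit Defensive.
Local Open Scope classical_set_scope.
Local Open Scope ring_scope.

(** One can take theta_n = 1 for every modulus of continuity: replacing
    omega(t) by omega(2t) or omega(t/2) in the integral only costs
    O(psi(n) omega(1/n)), so concavity plays no role.

    Write b = beta pi / 2. The k-th harmonic of f is psi(k) times the k-th
    harmonic, shifted by b, of its derivative phi. After truncation by the
    Fejer factor (1 - k/(N+1)) the weights psi(k) are still convex and
    decreasing, so two summations by parts turn the sum of the harmonics into
    a mixture, with nonnegative weights, of Fejer means of
    shifted harmonics of phi. Such a mean of order m is -sin b / pi times the
    integral of (phi(x+t) - phi(x-t)) / t over [1/m, 1/n], up to
    O(omega(1/n)), as soon as phi and a primitive of phi are bounded by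
    O(omega(1/n)) and O(omega(1/n)/n). The bound mu <= K gives
    n (psi(n) - psi(n+1)) = O(psi(n)), so that summing over m produces the sum
    over j >= n of psi(j) omega(1/j) / j, which is the principal integral up to
    O(psi(n) omega(1/n)).

    Upper bound: subtract from phi a polynomial P of order < n, the Jackson
    mean of a Steklov average of phi; then phi - P satisfies the two bounds,
    and P is so smooth that its own differences contribute O(omega(1/n)).

    Lower bound: let phi(t) = sgn(sin nt) omega(|sin nt| / n) / 2. It belongs to
    H_omega and is antiperiodic with antiperiod pi/n, hence so is its integral
    f. An alternating sum over the points x + j pi / n annihilates every
    polynomial of order < n, hence E_n(f) >= |f(0)|, and |f(0)| has
    the required size because sin(nt)/n >= t/2 on [0, 1/n]. *)

(** * Primitives and integrals of continuous functions *)

(** The kernel with Fourier series sum of psi(k) cos(kt + b) is never formed, so its integrability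
    does not arise. All identities are between finite sums, for the Fejer means of f, which converge
    to f(x) because f is continuous; the estimates are uniform in the truncation order N, which
    tends to infinity only at the end.

    On [1/n, pi] the bound on |phi - P| alone would cost omega(1/n) times a logarithm of n. The
    bound on a primitive, smaller by the factor 1/n, removes it by an integration by parts against
    1/t. So P has to be close to phi on two levels at once, which is achieved by averaging operators
    that commute with taking primitives. The Steklov average supplies the Lipschitz constant n
    omega(1/n), inherited by P.

    Uniformity in beta holds because beta enters only through cos b and sin b, while the slope
    constant C depends on psi alone. The factor |sin b| stays in front of every sum: when it
    vanishes, the sums of psi(j) omega(1/j) / j may be unbounded. *)

Section Calculus.
Context {R : realType}.
Implicit Types (f g h H G : R -> R) (a b c x t : R).
Local Notation leb := (@lebesgue_measure R).

Lemma ctsD f g : continuous f -> continuous g -> continuous (fun x => f x + g x).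
Proof. by move=> cf cg x; apply: continuousD; [exact: cf|exact: cg]. Qed.

Lemma ctsN f : continuous f -> continuous (fun x => - f x).
Proof. by move=> cf x; apply: continuousN; exact: cf. Qed.

Lemma ctsB f g : continuous f -> continuous g -> continuous (fun x => f x - g x).
Proof. by move=> cf cg; apply: ctsD => //; exact: ctsN. Qed.

Lemma ctsM f g : continuous f -> continuous g -> continuous (fun x => f x * g x).
Proof. by move=> cf cg x; apply: continuousM; [exact: cf|exact: cg]. Qed.

Lemma cts_comp f g : continuous f -> continuous g -> continuous (fun x => f (g x)).
Proof. by move=> cf cg x; apply: continuous_comp; [exact: cg|exact: cf]. Qed.

Lemma cts_cst c : continuous (fun _ : R => c).
Proof. by move=> x; exact: cst_continuous. Qed.

Lemma cts_id : continuous (fun x : R => x).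
Proof. by move=> x. Qed.

Lemma cts_cos f : continuous f -> continuous (fun x => cos (f x)).
Proof. by move=> cf; apply: cts_comp => //; exact: continuous_cos. Qed.

Lemma cts_sin f : continuous f -> continuous (fun x => sin (f x)).
Proof. by move=> cf; apply: cts_comp => //; exact: continuous_sin. Qed.

Lemma cts_norm f : continuous f -> continuous (fun x => `|f x|).
Proof. by move=> cf; apply: (@cts_comp (fun x => `|x|)) => //; exact: norm_continuous. Qed.

Lemma cts_eq f g : f =1 g -> continuous f -> continuous g.
Proof. by move=> /funext ->. Qed.

Lemma cts_sum (I : Type) (r : seq I) (P : pred I) (F : I -> R -> R) :
  (forall i, P i -> continuous (F i)) ->
  continuous (fun x => \sum_(i <- r | P i) F i x).
Proof.
move=> cF; elim: r => [|i r ih].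
  by apply: cts_eq (@cts_cst 0) => x; rewrite big_nil.
apply: (@cts_eq (fun x => (if P i then F i x else 0) + \sum_(i <- r | P i) F i x)).
  by move=> x; rewrite big_cons; case: ifP; rewrite ?add0r.
by apply: ctsD => //; case Pi: (P i); [exact: cF|exact: cts_cst].
Qed.

Definition antideriv H h : Prop := forall x, is_derive x (1 : R) H (h x).

Lemma antideriv_cts H h : antideriv H h -> continuous H.
Proof.
move=> Hh x; apply: differentiable_continuous.
by have dH := @ex_derive _ _ _ _ _ _ _ (Hh x); exact/derivable1_diffP.
Qed.

Lemma antideriv_MVT H h a b : a <= b -> antideriv H h ->
  exists2 c, a <= c <= b & H b - H a = h c * (b - a).
Proof.
move=> ab Hh; have [] := @MVT_segment R H h a b ab.
- by move=> x _; exact: Hh.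
- by apply: continuous_subspaceT; exact: antideriv_cts Hh.
- by move=> c; rewrite in_itv/= => cab E; exists c.
Qed.

Lemma antideriv_cst H : antideriv H (fun=> 0) -> forall a b, H a = H b.
Proof.
move=> H0; have W a b : a <= b -> H a = H b.
  by move=> ab; have [c _ /eqP] := antideriv_MVT ab H0; rewrite mul0r subr_eq0 => /eqP.
by move=> a b; have [/W //|/ltW/W//] := leP a b.
Qed.

Lemma antideriv_eq H h h' : h =1 h' -> antideriv H h -> antideriv H h'.
Proof. by move=> e Hh x; rewrite -e. Qed.

Lemma antideriv_eql H H' h : H =1 H' -> antideriv H h -> antideriv H' h.
Proof. by move=> /funext ->. Qed.

Lemma antiderivD H G h g : antideriv H h -> antideriv G g ->
  antideriv (fun x => H x + G x) (fun x => h x + g x).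
Proof. by move=> Hh Gg x; apply: is_deriveD. Qed.

Lemma antiderivN H h : antideriv H h -> antideriv (fun x => - H x) (fun x => - h x).
Proof. by move=> Hh x; apply: is_deriveN. Qed.

Lemma antiderivB H G h g : antideriv H h -> antideriv G g ->
  antideriv (fun x => H x - G x) (fun x => h x - g x).
Proof. by move=> Hh Gg; apply: antiderivD => //; exact: antiderivN. Qed.

Lemma antiderivZ c H h : antideriv H h ->
  antideriv (fun x => c * H x) (fun x => c * h x).
Proof. by move=> Hh x; apply: is_deriveZ. Qed.

Lemma antideriv_cst0 c : antideriv (fun=> c) (fun=> 0).
Proof. by move=> x; exact: is_derive_cst. Qed.

Lemma antideriv_id : antideriv (fun x => x) (fun=> 1).
Proof. by move=> x; exact: is_derive_id. Qed.

Lemma antideriv_comp H h G g : antideriv H h -> antideriv G g ->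
  antideriv (fun x => H (G x)) (fun x => g x * h (G x)).
Proof.
move=> Hh Gg x.
have := @is_derive1_comp R H G x (h (G x)) (g x).
by rewrite mulrC; apply.
Qed.

Lemma antideriv_affine H h c d : antideriv H h ->
  antideriv (fun x => H (c * x + d)) (fun x => c * h (c * x + d)).
Proof.
move=> Hh; have A : antideriv (fun x => c * x + d) (fun=> c).
  have := antiderivD (antiderivZ c antideriv_id) (antideriv_cst0 d).
  by apply: antideriv_eq => x; rewrite mulr1 addr0.
exact: antideriv_comp Hh A.
Qed.

Lemma antideriv_shift H h d : antideriv H h ->
  antideriv (fun x => H (x + d)) (fun x => h (x + d)).
Proof.
move=> /(@antideriv_affine _ _ 1 d)/(@antideriv_eql _ (fun x => H (x + d))) A.
by apply: antideriv_eq (A _) => x; rewrite !mul1r.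
Qed.

Lemma antideriv_sum (I : Type) (r : seq I) (P : pred I) (F f : I -> R -> R) :
  (forall i, P i -> antideriv (F i) (f i)) ->
  antideriv (fun x => \sum_(i <- r | P i) F i x) (fun x => \sum_(i <- r | P i) f i x).
Proof.
move=> cF; elim: r => [|i r ih].
  apply: (@antideriv_eql (fun=> 0)); first by move=> x; rewrite big_nil.
  by apply: antideriv_eq (antideriv_cst0 0) => x; rewrite big_nil.
apply: (@antideriv_eql (fun x => (if P i then F i x else 0) + \sum_(i <- r | P i) F i x)).
  by move=> x; rewrite big_cons; case: ifP; rewrite ?add0r.
apply: (@antideriv_eq _ (fun x => (if P i then f i x else 0) +
  \sum_(i <- r | P i) f i x)).
  by move=> x; rewrite big_cons; case: ifP; rewrite ?add0r.
by apply: antiderivD => //; case Pi: (P i); [exact: cF|exact: antideriv_cst0].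
Qed.

Lemma antideriv_cos : antideriv sin cos.
Proof. by move=> x; exact: is_derive_sin. Qed.

Lemma antideriv_sin : antideriv (fun x => - cos x) sin.
Proof. by move=> x; have := is_deriveN (is_derive_cos x); rewrite opprK. Qed.

Lemma cts_integrable h a b : continuous h -> leb.-integrable `[a, b] (EFin \o h).
Proof.
move=> ch; apply: continuous_compact_integrable; first exact: segment_compact.
exact: continuous_subspaceT.
Qed.

(** The primitive is the integral from 0, taken with a minus sign to the left of 0. From any base
    point c <= 0 it is the integral from c up to a constant; the base point - |x| - 1 lies strictly
    to the left of x, where the fundamental theorem gives the derivative. *)
Lemma antideriv_ex h : continuous h -> exists H, antideriv H h.
Proof.
move=> ch.
pose F c x := \int[leb]_(t in `[c, x]) h t.
have FB c a b : c <= a -> a <= b -> F c b - F c a = F a b.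
  move=> ca ab; rewrite /F (Rintegral_itvB (cts_integrable c b ch)) ?bnd_simp//.
  rewrite Rintegral_itv_obnd_cbnd//.
  by apply: integrableS (cts_integrable a b ch) => //; exact: subset_itv_oc_cc.
pose H x := if 0 <= x then F 0 x else - F x 0.
have HF c x : c <= 0 -> c <= x -> H x = F c x - F c 0.
  move=> c0 cx; rewrite /H; case: leP => x0; first by rewrite FB.
  by rewrite -(FB c x 0)// ?opprB// ltW.
exists H => x.
have dF : is_derive x 1 (F (- `|x| - 1)) (h x).
  have xl : - `|x| - 1 < x by have := ler_norm (- x); rewrite normrN; lra.
  have := @continuous_FTC1_closed R h (- `|x| - 1) x (x + 1).
  case => //; first by rewrite ltrDl.
  - exact: cts_integrable.
  - exact: ch.
  - by move=> dF <-; rewrite derive1E; exact/derivableP.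
have := is_deriveB dF (is_derive_cst (F (- `|x| - 1) 0 : R) x (1 : R)).
rewrite subr0; apply: near_eq_is_derive.
have xl : - `|x| - 1 < x by have := ler_norm (- x); rewrite normrN; lra.
near=> y; rewrite (HF (- `|x| - 1))//.
  by apply: ltW; near: y; exact: lt_nbhsr.
Unshelve. all: by end_near. Qed.

(** Integrals are handled as increments of a chosen primitive, so that linearity, additivity and
    affine substitution reduce to uniqueness of primitives up to a constant. [RintE] is the way back
    to the Lebesgue integral. *)
Definition prim h : R -> R := xget (fun=> 0) [set H | antideriv H h].

Lemma primP h : continuous h -> antideriv (prim h) h.
Proof. by move=> /antideriv_ex[H Hh]; rewrite /prim; case: xgetP => // /(_ H). Qed.

(* For continuous h, the oriented integral from a to b; [prim h], hence I h a b,
   is meaningful only when h has a primitive. *)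
Definition I h a b : R := prim h b - prim h a.

Lemma I_antideriv H h a b : continuous h -> antideriv H h -> I h a b = H b - H a.
Proof.
move=> ch Hh; have : antideriv (fun x => prim h x - H x) (fun=> 0).
  by apply: antideriv_eq (antiderivB (primP ch) Hh) => x; rewrite subrr.
move=> /antideriv_cst/(_ a b); rewrite /I; lra.
Qed.

Lemma RintE h a b : a <= b -> continuous h -> \int[leb]_(t in `[a, b]) h t = I h a b.
Proof.
move=> + ch; have Hh := primP ch; rewrite le_eqVlt => /predU1P[->|ab].
  by rewrite set_itv1 Rintegral_set1 /I subrr.
rewrite /Rintegral (@continuous_FTC2 R h (prim h))//.
- exact: continuous_subspaceT.
- split.
  + by move=> x _; case: (Hh x).
  + by apply: cvg_at_right_filter; exact: (antideriv_cts Hh).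
  + by apply: cvg_at_left_filter; exact: (antideriv_cts Hh).
- by move=> x _; rewrite derive1E; case: (Hh x).
Qed.

Lemma I_eq h g a b : h =1 g -> I h a b = I g a b.
Proof. by move=> /funext ->. Qed.

Lemma ID h g a b : continuous h -> continuous g ->
  I (fun x => h x + g x) a b = I h a b + I g a b.
Proof.
move=> ch cg; rewrite (I_antideriv _ _ _ (antiderivD (primP ch) (primP cg))).
  by rewrite /I; ring.
exact: ctsD.
Qed.

Lemma IZ c h a b : continuous h -> I (fun x => c * h x) a b = c * I h a b.
Proof.
move=> ch; rewrite (I_antideriv _ _ _ (antiderivZ c (primP ch))).
  by rewrite /I; ring.
by apply: ctsM => //; exact: cts_cst.
Qed.

Lemma IZr c h a b : continuous h -> I (fun x => h x * c) a b = I h a b * c.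
Proof. by move=> ch; under I_eq do rewrite mulrC; rewrite IZ// mulrC. Qed.

Lemma IN h a b : continuous h -> I (fun x => - h x) a b = - I h a b.
Proof.
by move=> ch; under I_eq do rewrite -mulN1r; rewrite IZ// mulN1r.
Qed.

Lemma IB h g a b : continuous h -> continuous g ->
  I (fun x => h x - g x) a b = I h a b - I g a b.
Proof. by move=> ch cg; rewrite ID// ?IN//; exact: ctsN. Qed.

Lemma Icst c a b : I (fun=> c) a b = c * (b - a).
Proof.
have A : antideriv (fun x => c * x) (fun=> c).
  by apply: antideriv_eq (antiderivZ c antideriv_id) => x; rewrite mulr1.
by rewrite (I_antideriv _ _ (@cts_cst c) A) mulrBr.
Qed.

Lemma Isum (J : Type) (r : seq J) (P : pred J) (F : J -> R -> R) a b :
  (forall i, P i -> continuous (F i)) ->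
  I (fun x => \sum_(i <- r | P i) F i x) a b = \sum_(i <- r | P i) I (F i) a b.
Proof.
move=> cF; rewrite (I_antideriv _ _ _ (antideriv_sum r (fun i Pi => primP (cF i Pi)))).
  by rewrite -sumrB.
exact: cts_sum.
Qed.

Lemma Ichasles h a b c : I h a b + I h b c = I h a c.
Proof. by rewrite /I; ring. Qed.

Lemma Iaffine c d h a b : continuous h ->
  I (fun x => c * h (c * x + d)) a b = I h (c * a + d) (c * b + d).
Proof.
move=> ch; rewrite (I_antideriv _ _ _ (antideriv_affine c d (primP ch)))//.
apply: ctsM; first exact: cts_cst.
apply: cts_comp => //; apply: ctsD; last exact: cts_cst.
by apply: ctsM; [exact: cts_cst|exact: cts_id].
Qed.

Lemma Ishift d h a b : continuous h -> I (fun x => h (x + d)) a b = I h (a + d) (b + d).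
Proof.
move=> /(@Iaffine 1 d h a b); rewrite !mul1r => <-.
by apply: I_eq => x; rewrite !mul1r.
Qed.

Lemma Iopp h a b : continuous h -> I (fun x => h (- x)) a b = I h (- b) (- a).
Proof.
move=> ch; have := @Iaffine (- 1) 0 h a b ch; rewrite !mulN1r !addr0.
under I_eq do rewrite mulN1r addr0 mulN1r.
rewrite IN; last by apply: cts_comp => //; exact: (ctsN cts_id).
by rewrite /I; lra.
Qed.

Lemma I_ge0 h a b : a <= b -> continuous h -> (forall x, a <= x <= b -> 0 <= h x) ->
  0 <= I h a b.
Proof.
move=> ab ch h0; have [c cab] := antideriv_MVT ab (primP ch).
by rewrite /I => ->; rewrite mulr_ge0 ?h0 ?subr_ge0.
Qed.

Lemma I_le h g a b : a <= b -> continuous h -> continuous g ->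
  (forall x, a <= x <= b -> h x <= g x) -> I h a b <= I g a b.
Proof.
move=> ab ch cg hg; rewrite -subr_ge0 -IB//; apply: I_ge0 => //; first exact: ctsB.
by move=> x /hg; rewrite subr_ge0.
Qed.

Lemma I_norm_le h g a b : a <= b -> continuous h -> continuous g ->
  (forall x, a <= x <= b -> `|h x| <= g x) -> `|I h a b| <= I g a b.
Proof.
move=> ab ch cg hg; rewrite ler_norml -IN//; apply/andP; split; apply: I_le => //.
- exact: ctsN.
- by move=> x /hg; rewrite ler_norml => /andP[].
- by move=> x /hg; rewrite ler_norml => /andP[].
Qed.

Lemma I_bound h c a b : a <= b -> continuous h ->
  (forall x, a <= x <= b -> `|h x| <= c) -> `|I h a b| <= c * (b - a).
Proof.
by move=> ab ch hc; rewrite -Icst; apply: I_norm_le => //; exact: cts_cst.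
Qed.

(* Comparison with a primitive that need only be differentiable on [a, b]. *)
Lemma I_le_prim h F f a b : a <= b -> continuous h ->
  (forall x, a <= x <= b -> is_derive x (1 : R) F (f x)) ->
  (forall x, a <= x <= b -> h x <= f x) -> I h a b <= F b - F a.
Proof.
move=> ab ch dF hf.
have Hh := primP ch.
have [] := @MVT_segment R (fun x => F x - prim h x) (fun x => f x - h x) a b ab.
- move=> x /subset_itv_oo_cc; rewrite in_itv/= => xab.
  by apply: is_deriveB; [exact: dF|exact: Hh].
- apply: derivable_within_continuous => x; rewrite in_itv/= => xab.
  by have := is_deriveB (dF x xab) (Hh x); case.
- move=> c; rewrite in_itv/= => cab E.
  have : 0 <= (f c - h c) * (b - a) by rewrite mulr_ge0// subr_ge0// hf.
  by rewrite -E /I; lra.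
Qed.

Lemma I_periodic h (T a : R) : continuous h -> periodic h T ->
  I h a (a + T) = I h 0 T.
Proof.
move=> ch pT; have : antideriv (fun x => prim h (x + T) - prim h x) (fun=> 0).
  apply: antideriv_eq (antiderivB (antideriv_shift T (primP ch)) (primP ch)) => x.
  by rewrite pT subrr.
by move=> /antideriv_cst/(_ a 0); rewrite add0r.
Qed.

Lemma I_shift_periodic h x : continuous h -> periodic h (pi *+ 2) ->
  I (fun t => h (x + t)) (- pi) pi = I h (- pi) pi.
Proof.
move=> ch ph; under I_eq do rewrite addrC.
rewrite Ishift//.
have -> : pi + x = (- pi + x) + pi *+ 2 :> R by rewrite mulr2n; ring.
rewrite I_periodic// -(I_periodic (- pi) ch ph); congr (I h _ _).
by rewrite mulr2n; ring.
Qed.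

Lemma I_sym h a : continuous h -> I h (- a) a = I (fun t => h t + h (- t)) 0 a.
Proof.
move=> ch; have cn : continuous (fun t => h (- t)).
  by apply: cts_comp => //; exact: (ctsN cts_id).
by rewrite ID// Iopp// oppr0 addrC Ichasles.
Qed.

End Calculus.

Ltac cts := repeat match goal with
  | |- forall x, continuous_at x (fun _ => ?c) => exact: cts_cst
  | |- forall x, continuous_at x (fun t => t) => exact: cts_id
  | H : forall x, continuous_at x ?g |- forall x, continuous_at x ?g => exact: H
  | |- forall x, continuous_at x (fun t => @?f t + @?g t)%R => apply: (@ctsD _ f g)
  | |- forall x, continuous_at x (+%R ?c) => apply: (@ctsD _ (fun=> c) (fun t => t))
  | |- forall x, continuous_at x ( *%R ?c) => apply: (@ctsM _ (fun=> c) (fun t => t))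
  | |- forall x, continuous_at x (-%R) => apply: (@ctsN _ (fun t => t))
  | |- forall x, continuous_at x (fun t => - (@?f t))%R => apply: (@ctsN _ f)
  | |- forall x, continuous_at x (fun t => @?f t * @?g t)%R => apply: (@ctsM _ f g)
  | |- forall x, continuous_at x (fun t => cos (@?f t)) => apply: (@cts_cos _ f)
  | |- forall x, continuous_at x (fun t => sin (@?f t)) => apply: (@cts_sin _ f)
  | |- forall x, continuous_at x (fun t => `|@?f t|%R) => apply: (@cts_norm _ f)
  | H : forall x, continuous_at x ?g |- forall x, continuous_at x (fun t => ?g (@?f t)) =>
      apply: (@cts_comp _ g f H)
  | |- forall x, continuous_at x (fun t => bigop _ _ (@?F t)) => apply: cts_sum => ? _
  end.

(** * Convex weights and double summation by parts *)

Section ConvexWeights.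
Context {R : realType}.
Implicit Types (psi : R -> R) (a p v q W : nat -> R).

Lemma convex_three_points psi (s t u : R) :
  convex_function (E := R^o) `[1, +oo[%classic psi ->
  1 <= s -> s <= t -> t <= u ->
  (u - s) * psi t <= (u - t) * psi s + (t - s) * psi u.
Proof.
move=> cv s1 st tu; have [su|us] := ltP s u; last first.
  have -> : s = t by lra.
  have -> : u = t by lra.
  by rewrite !subrr !mul0r addr0.
have us0 : 0 < u - s by rewrite subr_gt0.
have l0 : 0 <= (u - t) / (u - s) by apply: divr_ge0; lra.
have l1 : (u - t) / (u - s) <= 1 by rewrite ler_pdivrMr// mul1r; lra.
have : psi ((u - t) / (u - s) * s + (1 - (u - t) / (u - s)) * u)
    <= (u - t) / (u - s) * psi s + (1 - (u - t) / (u - s)) * psi u.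
  by apply: (cv (Itv01 l0 l1) s u); rewrite inE/= in_itv/= andbT//; lra.
have -> : (u - t) / (u - s) * s + (1 - (u - t) / (u - s)) * u = t.
  by field; rewrite gt_eqF.
move=> H; rewrite mulrC -ler_pdivlMr//.
rewrite (le_trans H)// le_eqVlt; apply/orP; left; apply/eqP.
by field; rewrite gt_eqF.
Qed.

(** If psi s < psi t with s < t, the chord through these points rises, and convexity keeps psi above
    psi t from t on, against the limit 0. *)
Lemma class_M_nonincreasing psi (s t : R) : class_M psi ->
  1 <= s -> s <= t -> psi t <= psi s.
Proof.
move=> [_ p0 cv lim0] s1 st; rewrite leNgt; apply/negP => pst.
have lt_st : s < t.
  by rewrite lt_neqAle st andbT; apply/eqP => e; move: pst; rewrite e ltxx.
have pt0 : 0 < psi t by apply: p0; lra.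
have : \forall u \near +oo, psi u < psi t.
  have /cvgrPdist_lt/(_ _ pt0) := lim0.
  apply: filterS => u; rewrite sub0r normrN; exact: le_lt_trans (ler_norm _).
move=> [M [_ MP]].
pose u := Num.max (M + 1) (t + 1).
have Mu : M < u by rewrite /u lt_max; apply/orP; left; lra.
have tu : t < u by rewrite /u lt_max; apply/orP; right; lra.
have := MP _ Mu; have := convex_three_points cv s1 st (ltW tu).
move=> H1 H2.
have : (u - t) * psi s < (u - t) * psi t by rewrite ltr_pM2l ?subr_gt0.
have : (t - s) * psi u < (t - s) * psi t by rewrite ltr_pM2l ?subr_gt0.
by move: H1; nra.
Qed.

(** The value psi t / 2 is attained, by the intermediate value theorem between t and a point where
    psi has dropped below it. On attained values the partial inverse is a right inverse with values
    in [1, +oo[. *)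
Lemma psi_etaK psi (t : R) : class_M psi -> 1 <= t ->
  1 <= psi_eta psi t /\ psi (psi_eta psi t) = psi t / 2.
Proof.
move=> cM t1; have [cp p0 cv lim0] := cM.
have pt0 : 0 < psi t by exact: p0.
have im : psi t / 2 \in psi @` `[1, +oo[.
  have : \forall u \near +oo, psi u < psi t / 2.
    have /cvgrPdist_lt/(_ (psi t / 2)) := lim0.
    rewrite divr_gt0// => /(_ isT).
    apply: filterS => u; rewrite sub0r normrN; exact: le_lt_trans (ler_norm _).
  move=> [M [_ MP]].
  pose u := Num.max (M + 1) (t + 1).
  have Mu : M < u by rewrite /u lt_max; apply/orP; left; lra.
  have tu : t < u by rewrite /u lt_max; apply/orP; right; lra.
  have pu := MP _ Mu.
  have [] := @IVT R psi t u (psi t / 2) (ltW tu).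
  - apply: continuous_subspaceW cp => x /=; rewrite !in_itv/= andbT => /andP[tx _].
    exact: le_trans tx.
  - rewrite ge_min le_max; apply/andP; split; apply/orP; [right|left]; lra.
  - move=> c; rewrite in_itv/= => /andP[tc _] <-.
    by rewrite inE; exists c => //=; rewrite in_itv/= andbT (le_trans t1).
split; last by rewrite /psi_eta pinvK.
have surj : set_surj `[1, +oo[ (psi @` `[1, +oo[) psi by [].
have /(_ (psi_eta psi t)) := surjpinv_image_sub (dflt := fun=> 0) surj.
rewrite /= in_itv/= andbT; apply; exists (psi t / 2) => //.
by rewrite inE in im.
Qed.

(** The bound mu <= K says eta(t) >= c t with c = 1 + 1/K. At t = n/c monotonicity turns this into
    psi(n/c) <= 2 psi(n). By convexity the slope after n is at most that of the chord over [n/c, n],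
    whose drop is at most psi(n); this gives the constant c / (c - 1) = K + 1. For n < c the point
    n/c leaves the domain, and the trivial bound c psi(n) is used. *)
Lemma class_M0_difference psi : class_M0 psi ->
  exists2 C : R, 1 <= C & forall n : nat, (0 < n)%N ->
    n%:R * (psi n%:R - psi n.+1%:R) <= C * psi n%:R.
Proof.
move=> [cM [K muK]]; have [cp p0 cv lim0] := cM.
have K0 : 0 < K.
  by have /andP[a b] := muK 1 (lexx _); exact: lt_le_trans b.
have eta_ge (t : R) : 1 <= t -> (1 + K^-1) * t <= psi_eta psi t.
  move=> t1; have := muK t t1; rewrite /psi_mu => /andP[m0 mK].
  have t0 : 0 < t by lra.
  have e0 : 0 < psi_eta psi t - t.
    by move: m0; rewrite pmulr_rgt0// invr_gt0.
  move: mK; rewrite ler_pdivrMr// -ler_pdivrMl// => mK.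
  by rewrite mulrDl mul1r; lra.
pose c := 1 + K^-1; have c1 : 1 < c by rewrite /c ltrDl invr_gt0.
have cE : c / (c - 1) = K + 1.
  by rewrite /c; field; rewrite gt_eqF//; lra.
exists (c / (c - 1) + c); first by rewrite cE; lra.
move=> n n0; have n1 : 1 <= n%:R :> R by rewrite ler1n.
have pn0 : 0 < psi n%:R by exact: p0.
have pS0 : 0 < psi n.+1%:R by apply: p0; rewrite ler1n.
have [nc|cn] := ltP n%:R c.
  have H1 : n%:R * (psi n%:R - psi n.+1%:R) <= n%:R * psi n%:R.
    by rewrite ler_pM2l; lra.
  have H2 : n%:R * psi n%:R <= c * psi n%:R by rewrite ler_pM2r// ltW.
  rewrite mulrDl; have : 0 <= c / (c - 1) * psi n%:R by rewrite cE; apply: mulr_ge0; lra.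
  lra.
have t1 : 1 <= n%:R / c by rewrite ler_pdivlMr ?mul1r//; lra.
have ct : c * (n%:R / c) = n%:R by field; rewrite gt_eqF//; lra.
have tn : n%:R / c < n%:R by rewrite ltr_pdivrMr ?ltr_pMr//; lra.
have [e1 eE] := psi_etaK cM t1.
have : psi (psi_eta psi (n%:R / c)) <= psi n%:R.
  by apply: class_M_nonincreasing => //; have := eta_ge _ t1; rewrite -/c ct.
rewrite eE => dbl.
have := convex_three_points cv t1 (ltW tn) (_ : n%:R <= n.+1%:R).
rewrite ler_nat leqnSn -natr1 => /(_ isT) slope.
have key : (n%:R - n%:R / c) * (psi n%:R - psi (n%:R + 1)) <= psi n%:R.
  by move: slope dbl; set A := psi _; set B := psi _; set D := psi (_ + _); lra.
have nE : n%:R = c / (c - 1) * (n%:R - n%:R / c) :> R.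
  by field; rewrite !gt_eqF//; lra.
have -> : n%:R * (psi n%:R - psi (n%:R + 1))
    = c / (c - 1) * ((n%:R - n%:R / c) * (psi n%:R - psi (n%:R + 1))).
  by rewrite mulrA -nE.
rewrite [leRHS]mulrDl.
apply: (@le_trans _ _ (c / (c - 1) * psi n%:R)).
  by rewrite ler_pM2l// cE; lra.
by rewrite lerDl; apply: mulr_ge0; lra.
Qed.

Definition diff2 a k : R := a k - 2 * a k.+1 + a k.+2.

(** For an eventually vanishing [a] this is the sum of (m + 1) [diff2 a m] over m >= j, by
    telescoping [tail_weightS]: the mass that the mixture of normalised Fejer means puts on orders
    at least j. *)
Definition tail_weight a j : R := a j + j%:R * (a j - a j.+1).

Lemma tail_weightS a j : tail_weight a j - tail_weight a j.+1 = j.+1%:R * diff2 a j.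
Proof. by rewrite /tail_weight /diff2 -natr1; ring. Qed.

(* Two summations by parts; the sums over k are multiples of Fejer means. *)
Lemma double_abel a v (M : nat) :
  \sum_(1 <= m < M.+1) diff2 a m * \sum_(1 <= k < m.+1) (m.+1%:R - k%:R) * v k
  = \sum_(1 <= k < M.+1)
      (a k - a M.+1 - (M.+1%:R - k%:R) * (a M.+1 - a M.+2)) * v k.
Proof.
elim: M => [|M ih]; first by rewrite !big_nil.
rewrite big_nat_recr//= ih [in RHS]big_nat_recr//= mulr_sumr.
rewrite [X in _ + X]big_nat_recr//= addrA -big_split/=; congr (_ + _).
  by apply: eq_bigr => k _; rewrite /diff2 -!natr1; ring.
by rewrite /diff2 -!natr1; ring.
Qed.

(** Exchange of summations: q j is met by every m > j, and over these the differences of W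
    telescope. *)
Lemma abel_tail W q n d :
  \sum_(n <= m < n + d) (W m - W m.+1) * \sum_(n <= j < m) q j
  = \sum_(n <= j < n + d) (W j.+1 - W (n + d)%N) * q j.
Proof.
elim: d => [|d ih]; first by rewrite addn0 !big_geq.
rewrite addnS big_nat_recr ?leq_addr//= ih [in RHS]big_nat_recr ?leq_addr//=.
rewrite subrr mul0r addr0 mulr_sumr -big_split/=.
by apply: eq_bigr => j _; ring.
Qed.

Definition truncate p N k : R :=
  if (k <= N)%N then p k * (1 - k%:R / N.+1%:R) else 0.

Section Truncation.
Variables (p : nat -> R) (C : R).
Hypothesis p_ge0 : forall k, (0 < k)%N -> 0 <= p k.
Hypothesis p_decr : forall k, (0 < k)%N -> p k.+1 <= p k.
Hypothesis p_convex : forall k, (0 < k)%N -> 0 <= diff2 p k.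
Hypothesis p_slope : forall k, (0 < k)%N -> k%:R * (p k - p k.+1) <= C * p k.

Lemma truncate_factor N k : truncate p N k = p k * Num.max 0 (1 - k%:R / N.+1%:R).
Proof.
rewrite /truncate; case: leqP => kN.
  by rewrite max_r// subr_ge0 ler_pdivrMr// mul1r ler_nat (leq_trans kN).
by rewrite max_l ?mulr0// subr_le0 ler_pdivlMr// mul1r ler_nat.
Qed.

Lemma truncate_ge0 N k : (0 < k)%N -> 0 <= truncate p N k.
Proof.
by move=> k0; rewrite truncate_factor mulr_ge0 ?p_ge0// le_max lexx.
Qed.

Lemma truncate_le N k : (0 < k)%N -> truncate p N k <= p k.
Proof.
by move=> k0; rewrite truncate_factor ler_piMr ?p_ge0// ge_max ler01 gerBl.
Qed.

Let lam N k : R := Num.max 0 (1 - k%:R / N.+1%:R).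

Let lam_step N k : 0 <= lam N k - lam N k.+1 <= N.+1%:R^-1.
Proof.
rewrite /lam -[k.+1%:R]natr1 mulrDl mul1r.
have N0 : 0 < N.+1%:R^-1 :> R by rewrite invr_gt0.
by move: (N.+1%:R^-1) N0 => e N0; rewrite /Num.max; apply/andP; split; do 2 (case: ltP => ?); lra.
Qed.

Let lam_convex N k : lam N k.+1 - lam N k.+2 <= lam N k - lam N k.+1.
Proof.
rewrite /lam -[k.+2%:R]natr1 -[k.+1%:R]natr1 !mulrDl mul1r.
have N0 : 0 < N.+1%:R^-1 :> R by rewrite invr_gt0.
by move: (N.+1%:R^-1) N0 => e N0; rewrite /Num.max; do 3 (case: ltP => ?); lra.
Qed.

Let lam_ge0 N k : 0 <= lam N k. Proof. by rewrite /lam le_max lexx. Qed.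

Let lam_le1 N k : lam N k <= 1.
Proof. by rewrite /lam ge_max ler01 gerBl divr_ge0. Qed.

Lemma truncate_decr N k : (0 < k)%N -> truncate p N k.+1 <= truncate p N k.
Proof.
move=> k0; rewrite !truncate_factor -!/(lam _ _).
have /andP[+ _] := lam_step N k; rewrite subr_ge0 => h.
by apply: ler_pM => //; [exact: p_ge0|exact: p_decr].
Qed.

(** A product of nonnegative, decreasing, convex sequences is convex: with l for [lam N], its second
    difference is l(k+1) times that of p, plus p(k) times that of l, plus (l(k+1) - l(k+2)) (p(k) -
    p(k+2)). *)
Lemma truncate_diff2_ge0 N k : (0 < k)%N -> 0 <= diff2 (truncate p N) k.
Proof.
move=> k0; rewrite /diff2 !truncate_factor -!/(lam _ _).
have h1 := p_convex k0; rewrite /diff2 in h1.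
have h2 := lam_convex N k; have /andP[h3 _] := lam_step N k.+1.
have h5 := lam_ge0 N k.+1.
have h4 : p k.+2 <= p k by rewrite (le_trans (p_decr _))// p_decr.
have h6 := p_ge0 k0.
have := mulr_ge0 h5 h1.
have : 0 <= (lam N k - lam N k.+1 - (lam N k.+1 - lam N k.+2)) * p k.
  by rewrite mulr_ge0// subr_ge0.
have : 0 <= (lam N k.+1 - lam N k.+2) * (p k - p k.+2) by rewrite mulr_ge0// subr_ge0.
lra.
Qed.

(** The point is uniformity in N. The decrement of the product has a part coming from p, controlled
    by [p_slope], and a part coming from the Fejer factor, whose step 1/(N+1) is compensated by k <=
    N. The three contributions are at most p k, C p k and p k. *)
Lemma truncate_tail_weight N k : (0 < k)%N ->
  tail_weight (truncate p N) k <= (C + 2) * p k.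
Proof.
move=> k0; rewrite /tail_weight.
have [kN|Nk] := leqP k N; last first.
  rewrite /truncate leqNgt Nk/= leqNgt (leq_trans Nk)//= subrr mulr0 addr0.
  have := p_slope k0; have := p_decr k0; have := p_ge0 k0 => h1 h2 h3.
  have : 0 <= k%:R * (p k - p k.+1) by rewrite mulr_ge0// subr_ge0.
  by lra.
have h1 := truncate_le N k0.
rewrite [X in _ + _ * (X - _)]truncate_factor [X in _ + _ * (_ - X)]truncate_factor -!/(lam _ _).
have /andP[h2 h3] := lam_step N k.
have h4 := p_slope k0; have h5 := p_decr k0; have h6 := p_ge0 k0.
have h7 : 0 <= k%:R * (p k - p k.+1) by rewrite mulr_ge0// subr_ge0.
have h8 : k%:R * (p k - p k.+1) * lam N k <= k%:R * (p k - p k.+1).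
  by rewrite ler_piMr.
have h9 : k%:R * (lam N k - lam N k.+1) <= 1.
  rewrite (@le_trans _ _ (k%:R / N.+1%:R))// ?ler_wpM2l//.
  by rewrite ler_pdivrMr// mul1r ler_nat (leq_trans kN).
have h10 : k%:R * (lam N k - lam N k.+1) * p k.+1 <= p k.+1.
  by rewrite ler_piMl// p_ge0.
lra.
Qed.

End Truncation.

End ConvexWeights.

(** * The Fejer kernel and its conjugate *)

Section Kernels.
Context {R : realType}.
Implicit Types (t x : R) (k m n : nat).

Lemma antiderivX n : antideriv (fun x : R => x ^+ n.+1 / n.+1%:R) (fun x => x ^+ n).
Proof.
apply: (@antideriv_eq _ _ (fun x => n.+1%:R^-1 * (n.+1%:R * x ^+ n))).
  by move=> y; rewrite mulKf.
apply: (@antideriv_eql _ (fun x => n.+1%:R^-1 * x ^+ n.+1)).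
  by move=> y; rewrite mulrC.
apply: antiderivZ => y.
have D := is_deriveX n.+1 (is_derive_id y (1 : R)).
rewrite (_ : (fun x : R => x ^+ n.+1) = (id : R -> R) ^+ n.+1).
  by apply: is_derive_eq; exact: mulr1.
by apply/funext => z; rewrite exprfctE.
Qed.

Lemma antideriv_ge0 (F f : R -> R) : antideriv F f -> F 0 = 0 ->
  (forall x, 0 <= x -> 0 <= f x) -> forall x, 0 <= x -> 0 <= F x.
Proof.
move=> Ff F0 f0 x x0; have [c /andP[c0 cx]] := antideriv_MVT x0 Ff.
by rewrite F0 !subr0 => ->; rewrite mulr_ge0// f0.
Qed.

Lemma sin_le t : 0 <= t -> sin t <= t.
Proof.
move=> t0; rewrite -subr_ge0.
apply: (antideriv_ge0 (antiderivB antideriv_id antideriv_cos)) t0 => [|x _].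
  by rewrite sin0 subr0.
by rewrite subr_ge0 cos_le1.
Qed.

Lemma cos_ge t : 0 <= t -> 1 - t ^+ 2 / 2 <= cos t.
Proof.
move=> t0; have : 0 <= (t ^+ 2 / 2 - (- cos t)) + (- 1); last by lra.
apply: (antideriv_ge0 (antiderivD (antiderivB (antiderivX 1) antideriv_sin)
   (antideriv_cst0 (- 1)))) t0 => [|x x0].
  by rewrite cos0 expr0n/=; lra.
by have := sin_le x0; rewrite expr1; lra.
Qed.

Lemma sin_ge t : 0 <= t -> t - t ^+ 3 / 6 <= sin t.
Proof.
move=> t0; have : 0 <= 2^-1 * (t ^+ 3 / 3) + (sin t - t); last by lra.
apply: (antideriv_ge0 (antiderivD (antiderivZ 2^-1 (antiderivX 2))
  (antiderivB antideriv_cos antideriv_id))) t0 => [|x x0].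
  by rewrite sin0 expr0n/=; lra.
by have := cos_ge x0; lra.
Qed.

Lemma cos_le t : 0 <= t -> cos t <= 1 - t ^+ 2 / 2 + t ^+ 4 / 24.
Proof.
move=> t0.
have : 0 <= ((6^-1 * (t ^+ 4 / 4)) - (t ^+ 2 / 2)) + ((- cos t) - (- 1)); last by lra.
apply: (antideriv_ge0 (antiderivD (antiderivB (antiderivZ 6^-1 (antiderivX 3)) (antiderivX 1))
  (antiderivB antideriv_sin (antideriv_cst0 (- 1))))) t0 => [|x x0].
  by rewrite cos0 !expr0n/=; lra.
by have := sin_ge x0; rewrite expr1; lra.
Qed.

Lemma pi_le4 : pi <= 4 :> R.
Proof. by have := @pihalf_lt2 R; lra. Qed.

(** For |t| <= 2 the Taylor bound gives even t^2 / 3. Beyond 2, cosine is at most cos 2 <= -1/3, so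
    that 1 - cos t >= 4/3 = 16/12, and t^2 <= 16 because pi <= 4: this is where 12 comes from. *)
Lemma onem_cos_ge t : `|t| <= pi -> t ^+ 2 / 12 <= 1 - cos t.
Proof.
move=> tpi; rewrite -cos_norm -(real_normK (num_real t)).
move: tpi (normr_ge0 t); move: `|t| => s spi s0.
have s4 : s <= 4 by have := pi_le4; lra.
have [s2|s2] := leP s 2.
  have := cos_le s0; have : s ^+ 4 <= 4 * s ^+ 2.
    rewrite (_ : 4 = 2 + 2)%N// exprD ler_wpM2r ?sqr_ge0//.
    by rewrite expr2; nra.
  by have := sqr_ge0 s; lra.
have : cos s <= cos 2.
  have := @ltr_cos R 2 s; rewrite !in_itv/= s0 spi ler0n pi_ge2/= => /(_ isT isT).
  by rewrite s2 => /ltW.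
have := @cos_le 2 (ler0n _ _); have : s ^+ 2 <= 16 by nra.
lra.
Qed.

Lemma onem_cos_le t : 1 - cos t <= t ^+ 2 / 2.
Proof. by rewrite -cos_norm -(real_normK (num_real t)); have := cos_ge (normr_ge0 t); lra. Qed.

(* (m + 1) times the Fejer kernel and (m + 1) times its conjugate. *)
Definition fejer m t : R :=
  m.+1%:R / 2 + \sum_(1 <= k < m.+1) (m.+1%:R - k%:R) * cos (k%:R * t).

Definition cfejer m t : R :=
  \sum_(1 <= k < m.+1) (m.+1%:R - k%:R) * sin (k%:R * t).

Lemma fejerS m t :
  fejer m.+1 t = fejer m t + (1 / 2 + \sum_(1 <= k < m.+2) cos (k%:R * t)).
Proof.
rewrite /fejer big_nat_recr//= [in RHS](big_nat_recr m.+1)//=.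
rewrite (eq_bigr (fun k => (m.+1%:R - k%:R) * cos (k%:R * t) + cos (k%:R * t))).
  rewrite big_split/=.
  by rewrite -[m.+2%:R]natr1; ring.
by move=> k _; rewrite -[m.+2%:R]natr1; ring.
Qed.

Lemma cfejerS m t :
  cfejer m.+1 t = cfejer m t + \sum_(1 <= k < m.+2) sin (k%:R * t).
Proof.
rewrite /cfejer big_nat_recr//= [in RHS](big_nat_recr m.+1)//=.
rewrite (eq_bigr (fun k => (m.+1%:R - k%:R) * sin (k%:R * t) + sin (k%:R * t))).
  rewrite big_split/=.
  by rewrite -[m.+2%:R]natr1; ring.
by move=> k _; rewrite -[m.+2%:R]natr1; ring.
Qed.

Lemma trig_step m t :
  2 * cos t * cos (m.+1%:R * t) = cos (m%:R * t) + cos (m.+2%:R * t) /\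
  2 * cos t * sin (m.+1%:R * t) = sin (m%:R * t) + sin (m.+2%:R * t).
Proof.
have -> : m%:R * t = m.+1%:R * t - t by rewrite -natr1; ring.
have -> : m.+2%:R * t = m.+1%:R * t + t by rewrite -[m.+2%:R]natr1; ring.
by rewrite cosB cosD sinB sinD; split; ring.
Qed.

(** The closed forms are multiplied out by 2 (1 - cos t) = 4 sin^2(t/2). This avoids half angles,
    stays valid at multiples of 2 pi, and makes each induction a use of [trig_step]. *)
Lemma dirichlet_closed m t : 2 * (1 - cos t) * (1 / 2 + \sum_(1 <= k < m.+1) cos (k%:R * t))
  = cos (m%:R * t) - cos (m.+1%:R * t).
Proof.
elim: m => [|m ih]; first by rewrite big_geq// mul0r (mul1r t) cos0; field.
rewrite big_nat_recr//= addrA mulrDr ih.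
by have [h _] := trig_step m t; lra.
Qed.

Lemma cdirichlet_closed m t : 2 * (1 - cos t) * (\sum_(1 <= k < m.+1) sin (k%:R * t))
  = sin t + sin (m%:R * t) - sin (m.+1%:R * t).
Proof.
elim: m => [|m ih]; first by rewrite big_geq// mul0r (mul1r t) sin0; ring.
rewrite big_nat_recr//= mulrDr ih.
by have [_ h] := trig_step m t; lra.
Qed.

Lemma fejer_closed m t : 2 * (1 - cos t) * fejer m t = 1 - cos (m.+1%:R * t).
Proof.
elim: m => [|m ih]; first by rewrite /fejer big_geq// (mul1r t); field.
by rewrite fejerS mulrDr ih dirichlet_closed; ring.
Qed.

Lemma cfejer_closed m t :
  2 * (1 - cos t) * cfejer m t = m.+1%:R * sin t - sin (m.+1%:R * t).
Proof.
elim: m => [|m ih]; first by rewrite /cfejer big_geq// (mul1r t) mul1r; ring.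
by rewrite cfejerS mulrDr ih cdirichlet_closed -[m.+2%:R]natr1; ring.
Qed.

Lemma cos_eq1_mul k t : cos t = 1 -> cos (k%:R * t) = 1.
Proof.
move=> c1; have s0 : sin t = 0.
  by apply: cos1sin0; rewrite c1 normr1.
elim: k => [|k ih]; first by rewrite mul0r cos0.
by rewrite -natr1 mulrDl mul1r cosD s0 mulr0 c1 ih mulr1 subr0.
Qed.

Lemma fejer_ge0 m t : 0 <= fejer m t.
Proof.
have [c1|c1] := eqVneq (cos t) 1.
  rewrite /fejer addr_ge0// big_nat_cond sumr_ge0// => k /andP[/andP[_ km] _].
  by rewrite (cos_eq1_mul k c1) mulr1 subr_ge0 ler_nat ltnW.
have c0 : 0 < 2 * (1 - cos t).
  by rewrite mulr_gt0// subr_gt0 lt_neqAle c1 cos_le1.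
by rewrite -(pmulr_rge0 _ c0) fejer_closed subr_ge0 cos_le1.
Qed.

Lemma cfejer_le m t : `|cfejer m t| <= m.+1%:R * m%:R.
Proof.
rewrite (le_trans (ler_norm_sum _ _ _))//.
apply: (@le_trans _ _ (\sum_(1 <= k < m.+1) m.+1%:R)).
  rewrite big_nat_cond [leRHS]big_nat_cond ler_sum// => k /andP[/andP[_ km] _].
  rewrite normrM ger0_norm ?subr_ge0 ?ler_nat 1?ltnW//.
  by rewrite -[leRHS]mulr1 ler_pM// ?subr_ge0 ?ler_nat 1?ltnW// ?gerBl// sin_max.
by rewrite sumr_const_nat subn1 mulr_natr.
Qed.

(** After multiplication by 2 (1 - cos t) the difference is sin t - 2 (1 - cos t) / t, of size at
    most t^2 by Taylor bounds, minus sin((m+1)t) / (m+1). Dividing by 2 (1 - cos t) >= t^2 / 6 gives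
    the two terms with factor 6. *)
Lemma cfejer_approx m t : 0 < t <= pi ->
  `|cfejer m t / m.+1%:R - t^-1| <= 6 + 6 / (m.+1%:R * t ^+ 2).
Proof.
move=> /andP[t0 tpi]; have tn : t != 0 by rewrite gt_eqF.
have m0 : 0 < m.+1%:R :> R by [].
have c1 : t ^+ 2 / 12 <= 1 - cos t by apply: onem_cos_ge; rewrite gtr0_norm.
have t2 : 0 < t ^+ 2 by rewrite exprn_gt0.
have c0 : 0 < 2 * (1 - cos t) by lra.
have E : 2 * (1 - cos t) * (cfejer m t / m.+1%:R - t^-1)
  = (sin t - 2 * (1 - cos t) / t) - sin (m.+1%:R * t) / m.+1%:R.
  rewrite mulrBr mulrA cfejer_closed.
  by move: (m.+1%:R) m0 => M m0; field; rewrite tn gt_eqF.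
have t4 : t <= 4 by have := pi_le4; lra.
have A : `|sin t - 2 * (1 - cos t) / t| <= t ^+ 2.
  have h1 := sin_le (ltW t0); have h2 := sin_ge (ltW t0).
  have h3 := cos_ge (ltW t0); have h4 := cos_le (ltW t0).
  have h5 : 2 * (1 - cos t) / t <= t.
    by rewrite ler_pdivrMr// -expr2; lra.
  have h6 : t - t ^+ 3 / 12 <= 2 * (1 - cos t) / t.
    rewrite ler_pdivlMr// mulrBl.
    have -> : t ^+ 3 / 12 * t = t ^+ 4 / 12 by ring.
    by rewrite -expr2; lra.
  have h7 : t ^+ 3 <= 4 * t ^+ 2 by rewrite exprS ler_pM2r.
  by rewrite ler_norml; apply/andP; split; lra.
have B : `|sin (m.+1%:R * t) / m.+1%:R| <= m.+1%:R^-1.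
  by rewrite normrM [`|_^-1|]gtr0_norm ?invr_gt0// ler_piMl ?invr_ge0// sin_max.
rewrite -(ler_pM2l c0) -{1}(gtr0_norm c0) -normrM E.
rewrite (le_trans (ler_normB _ _))// (le_trans (lerD A B))//.
have -> : 6 + 6 / (m.+1%:R * t ^+ 2) = 6 / t ^+ 2 * (t ^+ 2 + m.+1%:R^-1) :> R.
  by move: (m.+1%:R) m0 => M m0; field; rewrite tn gt_eqF.
rewrite mulrA ler_peMl//; first by rewrite addr_ge0// ?invr_ge0// ltW.
by rewrite mulrA ler_pdivlMr//; lra.
Qed.

Lemma cts_fejer m : continuous (fejer m).
Proof. by rewrite /fejer; cts. Qed.

Lemma cts_cfejer m : continuous (cfejer m).
Proof. by rewrite /cfejer; cts. Qed.

Lemma cfejer_odd m t : cfejer m (- t) = - cfejer m t.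
Proof.
by rewrite /cfejer -sumrN; apply: eq_bigr => k _; rewrite mulrN sinN mulrN.
Qed.

End Kernels.

(** * Integrals against the conjugate Fejer kernel *)

Section ConjugateEstimate.
Context {R : realType}.
Implicit Types (D E : R -> R) (a b c e t : R) (m n : nat).

Lemma is_derive_inv t : t != 0 -> is_derive t (1 : R) (fun s : R => s^-1) (- t ^- 2).
Proof.
move=> t0; have := @is_deriveV R (fun s => s) t 1 1 t0 (is_derive_id t 1).
by move=> H; apply: is_derive_eq; rewrite /GRing.scale/= mulr1.
Qed.

(** The reciprocal frozen below e > 0: it makes integrands continuous on the whole line, as the
    calculus of [I] requires, and equals 1/t on the ranges of integration. *)
Definition cut_inv e t : R := (Num.max t e)^-1.

Lemma cut_invE e t : e <= t -> cut_inv e t = t^-1.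
Proof. by move=> et; rewrite /cut_inv max_l. Qed.

Lemma cts_cut_inv e : 0 < e -> continuous (cut_inv e).
Proof.
move=> e0 t; rewrite /cut_inv; apply: cvgV.
  by rewrite gt_eqF// lt_max e0 orbT.
apply: (@cvg_comp _ _ _ (fun t => Num.max t e) id) => //.
exact: (@continuous_max _ _ (fun t : R => t) (fun=> e) t cvg_id (cvg_cst e)).
Qed.

(** An integration by parts without a remainder integral: (E - c) / t has derivative D / t + (c - E)
    / t^2, which dominates D / t since E <= c. *)
Lemma I_D_inv_le D E c e a b : 0 < e -> e <= a -> a <= b ->
  continuous D -> antideriv E D -> (forall t, `|E t| <= c) ->
  I (fun t => D t * cut_inv e t) a b <= 2 * c / a.
Proof.
move=> e0 ea ab cD ED Ec; have a0 : 0 < a by exact: lt_le_trans ea.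
have c0 : 0 <= c by rewrite (le_trans _ (Ec 0)).
pose F t := (E t - c) * t^-1.
pose f t := D t * t^-1 + (E t - c) * (- t ^- 2).
apply: (@le_trans _ _ (F b - F a)).
  apply: (@I_le_prim _ _ F f) => //.
  - by apply: ctsM => //; exact: cts_cut_inv.
  - move=> t /andP[at_ _]; have t0 : t != 0 by rewrite gt_eqF// (lt_le_trans a0).
    have dE : is_derive t (1 : R) (fun s => E s - c) (D t).
      by have := is_deriveB (ED t) (is_derive_cst c t (1 : R)); rewrite subr0.
    have := @is_deriveM _ _ (fun s => E s - c) (fun s => s^-1) t 1 _ _ dE (is_derive_inv t0).
    by move=> H; apply: is_derive_eq; rewrite /f /GRing.scale /= addrC;
      congr (_ + _); rewrite mulrC.
  - move=> t /andP[at_ _]; rewrite cut_invE ?(le_trans ea)// /f lerDl mulrN -mulNr.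
    apply: mulr_ge0; first by rewrite opprB subr_ge0; exact: le_trans (ler_norm _) (Ec t).
    by rewrite invr_ge0 exprn_ge0// (le_trans (ltW a0)).
have b0 : 0 < b by exact: lt_le_trans ab.
rewrite /F; have /= := Ec a; have := Ec b; rewrite !ler_norml => /andP[_ Eb] /andP[Ea _].
have : (E b - c) * b^-1 <= 0 by rewrite mulr_le0_ge0 ?invr_ge0 ?subr_le0// ltW.
have : (c - E a) * a^-1 <= 2 * c * a^-1.
  by rewrite ler_pM2r ?invr_gt0//; lra.
lra.
Qed.

Lemma I_D_inv_norm D E c e a b : 0 < e -> e <= a -> a <= b ->
  continuous D -> antideriv E D -> (forall t, `|E t| <= c) ->
  `|I (fun t => D t * cut_inv e t) a b| <= 2 * c / a.
Proof.
move=> e0 ea ab cD ED Ec; rewrite ler_norml (I_D_inv_le e0 ea ab cD ED Ec) andbT.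
have := @I_D_inv_le (fun t => - D t) (fun t => - E t) c e a b e0 ea ab (ctsN cD) (antiderivN ED).
have -> : I (fun t => - D t * cut_inv e t) a b = - I (fun t => D t * cut_inv e t) a b.
  under I_eq do rewrite mulNr.
  by rewrite IN//; apply: ctsM => //; exact: cts_cut_inv.
by move=> h; have := h (fun t => _ : `|- E t| <= c); rewrite lerNl; apply => t; rewrite normrN.
Qed.

(* Near 0 the conjugate Fejer kernel behaves like 1/t; beyond 1/n the
   oscillation of D, expressed by the size of its primitive E, absorbs 1/t. *)
Lemma conj_fejer_integral D E c m n : (0 < n)%N -> (n <= m)%N ->
  continuous D -> antideriv E D ->
  (forall t, `|D t| <= c) -> (forall t, `|E t| <= c / n%:R) ->
  `|I (fun t => D t * (cfejer m t / m.+1%:R)) 0 pi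
    - I (fun t => D t * cut_inv m%:R^-1 t) m%:R^-1 n%:R^-1| <= 33 * c.
Proof.
move=> n0 nm cD ED Dc Ec.
have m0 : (0 < m)%N by exact: leq_trans nm.
have mR : 0 < m%:R :> R by rewrite ltr0n.
have nR : 0 < n%:R :> R by rewrite ltr0n.
have c0 : 0 <= c by rewrite (le_trans _ (Dc 0)).
have im : 0 < m%:R^-1 :> R by rewrite invr_gt0.
have mn : m%:R^-1 <= n%:R^-1 :> R by rewrite lef_pV2 ?posrE// ler_nat.
have npi : n%:R^-1 <= pi :> R.
  rewrite (@le_trans _ _ 1) ?invf_le1 ?ler1n//.
  by have := @pi_ge2 R; lra.
have cF : continuous (fun t => cfejer m t / m.+1%:R : R).
  by apply: ctsM; [exact: cts_cfejer|exact: cts_cst].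
have cq : continuous (cut_inv m%:R^-1 : R -> R) by exact: cts_cut_inv.
have cDF := ctsM cD cF; have cDq := ctsM cD cq.
have Fm t : `|cfejer m t / m.+1%:R| <= m%:R.
  by rewrite normrM normfV (ger0_norm (ler0n _ m.+1)) ler_pdivrMr// mulrC cfejer_le.
have S1 : `|I (fun t => D t * (cfejer m t / m.+1%:R)) 0 m%:R^-1| <= c.
  have := @I_bound _ (fun t => D t * (cfejer m t / m.+1%:R)) (c * m%:R) 0 m%:R^-1 (ltW im) cDF.
  rewrite subr0 mulfK ?gt_eqF//; apply => t _.
  by rewrite normrM ler_pM.
have S2 : `|I (fun t => D t * (cfejer m t / m.+1%:R)) m%:R^-1 pi
           - I (fun t => D t * cut_inv m%:R^-1 t) m%:R^-1 pi| <= 30 * c.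
  rewrite -IB//.
  (* A primitive of c times the bound of [cfejer_approx]. Its increment over [1/m, pi] is at most (6
     pi + 6 m / (m+1)) c, and 30 = 24 + 6 because pi <= 4. *)
  pose F t : R := c * (6 * t - 6 / m.+1%:R * t^-1).
  pose f t : R := c * (6 + 6 / m.+1%:R * t ^- 2).
  have dF t : m%:R^-1 <= t <= pi -> is_derive t (1 : R) F (f t).
    move=> /andP[mt _]; have t0 : t != 0 by rewrite gt_eqF// (lt_le_trans im).
    have d1 := is_deriveZ 6 (is_derive_id t (1 : R)).
    have d2 := is_deriveZ (6 / m.+1%:R) (is_derive_inv t0).
    have := is_deriveZ c (is_deriveB d1 d2).
    by move=> H; apply: is_derive_eq; rewrite /f /GRing.scale/=; ring.
  have le t : m%:R^-1 <= t <= pi ->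
      `|D t * (cfejer m t / m.+1%:R) - D t * cut_inv m%:R^-1 t| <= f t.
    move=> /andP[mt tpi]; have t0 : 0 < t by rewrite (lt_le_trans im).
    rewrite -mulrBr normrM ler_pM// cut_invE//.
    have := @cfejer_approx _ m t; rewrite t0 tpi => /(_ isT).
    by rewrite invfM mulrA.
  have FF : F pi - F m%:R^-1 <= 30 * c.
    rewrite /F invrK -mulrBr mulrC ler_wpM2r//.
    have := @pi_le4 R; have : 6 / m.+1%:R * m%:R <= 6 :> R.
      by rewrite mulrAC ler_pdivrMr// ler_pM2l// ler_nat leqnSn.
    have : 0 <= 6 / m.+1%:R / pi :> R by rewrite !divr_ge0// pi_ge0.
    have : 0 <= m%:R^-1 :> R by rewrite invr_ge0.
    by move: (_ / pi) (_ * m%:R) (m%:R^-1) => X Y Z; lra.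
  have cB := ctsB cDF cDq.
  rewrite ler_norml; apply/andP; split.
    rewrite lerNl -IN//; apply: le_trans FF; apply: (I_le_prim (le_trans mn npi) _ dF).
      exact: ctsN.
    by move=> t /le; rewrite ler_norml lerNl => /andP[].
  apply: le_trans FF; apply: (I_le_prim (le_trans mn npi) _ dF) => //.
  by move=> t /le; rewrite ler_norml => /andP[].
have S3 : `|I (fun t => D t * cut_inv m%:R^-1 t) n%:R^-1 pi| <= 2 * c.
  have := I_D_inv_norm im mn npi cD ED Ec.
  by rewrite invrK -mulrA mulfVK// gt_eqF.
have := Ichasles (fun t => D t * (cfejer m t / m.+1%:R)) 0 m%:R^-1 pi.
have := Ichasles (fun t => D t * cut_inv m%:R^-1 t) m%:R^-1 n%:R^-1 pi.
move: S1 S2 S3; rewrite !ler_norml => /andP[? ?] /andP[? ?] /andP[? ?] ? ?.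
by apply/andP; split; lra.
Qed.

End ConjugateEstimate.

(** * Shifted harmonics and trigonometric polynomials *)

Section Harmonics.
Context {R : realType}.
Implicit Types (f g h phi T : R -> R) (b c d t x : R) (i j k m n : nat).

Lemma periodic_mul_nat_cos k d : periodic (fun t : R => cos (k%:R * t + d)) (pi *+ 2).
Proof.
move=> t; have -> : k%:R * (t + pi *+ 2) + d = (k%:R * t + d) + pi *+ 2 *+ k.
  by rewrite -[_ *+ k]mulr_natl; ring.
exact: (periodicn (@cosD2pi R)).
Qed.

Lemma periodicM f g c : periodic f c -> periodic g c -> periodic (fun t => f t * g t) c.
Proof. by move=> pf pg t; rewrite pf pg. Qed.

(** The k-th harmonic of g with phase kx replaced by kx - b, written as a convolution (see
    [harm_fourier]). The derivative shifts phases by + b, so recovering f from it shifts by - b. *)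
Definition harm b g k x : R :=
  pi^-1 * I (fun t => g (x + t) * cos (k%:R * t + b)) (- pi) pi.

Lemma cts_harm_integrand b g k x : continuous g ->
  continuous (fun t => g (x + t) * cos (k%:R * t + b)).
Proof. by move=> cg; cts. Qed.

Lemma fourier_cosE g k : continuous g ->
  fourier_cos g k = pi^-1 * I (fun t => g t * cos (k%:R * t)) (- pi) pi.
Proof.
move=> cg; rewrite /fourier_cos RintE//; last by cts.
by rewrite ge0_cp// pi_ge0.
Qed.

Lemma fourier_sinE g k : continuous g ->
  fourier_sin g k = pi^-1 * I (fun t => g t * sin (k%:R * t)) (- pi) pi.
Proof.
move=> cg; rewrite /fourier_sin RintE//; last by cts.
by rewrite ge0_cp// pi_ge0.
Qed.

Lemma harm_fourier b g k x : continuous g -> periodic g (pi *+ 2) ->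
  harm b g k x = fourier_cos g k * cos (k%:R * x - b) + fourier_sin g k * sin (k%:R * x - b).
Proof.
move=> cg pg; rewrite fourier_cosE// fourier_sinE// /harm.
pose h s := g s * cos (k%:R * s + (b - k%:R * x)).
have -> : I (fun t => g (x + t) * cos (k%:R * t + b)) (- pi) pi = I h (- pi) pi.
  rewrite -(@I_shift_periodic _ h x).
    by apply: I_eq => t; rewrite /h; congr (_ * cos _); ring.
    by rewrite /h; cts.
  by apply: periodicM => //; exact: periodic_mul_nat_cos.
rewrite -!mulrA -mulrDr; congr (_ * _).
have E s : h s = cos (k%:R * x - b) * (g s * cos (k%:R * s)) +
                 sin (k%:R * x - b) * (g s * sin (k%:R * s)).
  rewrite /h (_ : k%:R * s + (b - k%:R * x) = k%:R * s - (k%:R * x - b)); last by ring.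
  by rewrite cosB; ring.
rewrite (I_eq _ _ E) ID; [|by cts|by cts].
by rewrite !IZ; [ring|by cts|by cts].
Qed.

Lemma harmD b f g k x : continuous f -> continuous g ->
  harm b (fun t => f t + g t) k x = harm b f k x + harm b g k x.
Proof.
move=> cf cg; rewrite /harm -mulrDr -ID; [|exact: cts_harm_integrand|exact: cts_harm_integrand].
by congr (_ * _); apply: I_eq => t; rewrite mulrDl.
Qed.

Lemma harmZ b c g k x : continuous g -> harm b (fun t => c * g t) k x = c * harm b g k x.
Proof.
move=> cg; rewrite /harm mulrCA; congr (_ * _).
rewrite -IZ; last exact: cts_harm_integrand.
by apply: I_eq => t; rewrite mulrA.
Qed.

Lemma harmB b f g k x : continuous f -> continuous g ->
  harm b (fun t => f t - g t) k x = harm b f k x - harm b g k x.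
Proof.
move=> cf cg; rewrite harmD//; last exact: ctsN.
congr (_ + _); rewrite -mulN1r -harmZ//; congr (harm b _ k x).
by apply/funext => t; rewrite mulN1r.
Qed.

Lemma harm_sum b (J : Type) (r : seq J) (F : J -> R -> R) k x :
  (forall l, continuous (F l)) ->
  harm b (fun t => \sum_(l <- r) F l t) k x = \sum_(l <- r) harm b (F l) k x.
Proof.
move=> cF; rewrite /harm -mulr_sumr; congr (_ * _).
under I_eq do rewrite mulr_suml.
by rewrite Isum// => i _; exact: cts_harm_integrand.
Qed.

Lemma I_cos_full k d : (0 < k)%N -> I (fun t => cos (k%:R * t + d)) (- pi) pi = 0 :> R.
Proof.
move=> k0; have kn : k%:R != 0 :> R by rewrite pnatr_eq0 -lt0n.
have A : antideriv (fun t : R => k%:R^-1 * sin (k%:R * t + d)) (fun t => cos (k%:R * t + d)).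
  apply: antideriv_eq (antiderivZ k%:R^-1 (antideriv_affine k%:R d antideriv_cos)) => t.
  by rewrite mulKf.
rewrite (I_antideriv _ _ _ A); last by cts.
have -> : k%:R * pi + d = (k%:R * - pi + d) + pi *+ 2 *+ k :> R.
  by rewrite -[_ *+ k]mulr_natl; ring.
by rewrite (periodicn (@sinD2pi R)) subrr.
Qed.

Lemma I_cos_cos j k d e : (0 < k)%N ->
  I (fun t => cos (j%:R * t + d) * cos (k%:R * t + e)) (- pi) pi
  = if j == k then pi * cos (d - e) else 0 :> R.
Proof.
move=> k0.
have E s t : cos s * cos t = 2^-1 * cos (s + t) + 2^-1 * cos (s - t) :> R.
  by rewrite cosD cosB; field.
under I_eq do rewrite E.
have c1 : continuous (fun t : R => cos (j%:R * t + d + (k%:R * t + e))) by cts.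
have c2 : continuous (fun t : R => cos (j%:R * t + d - (k%:R * t + e))) by cts.
rewrite ID ?IZ//; [|by cts|by cts].
have -> : I (fun t => cos (j%:R * t + d + (k%:R * t + e))) (- pi) pi = 0 :> R.
  rewrite -(@I_cos_full (j + k) (d + e)) ?addn_gt0 ?k0 ?orbT//.
  by apply: I_eq => t; congr cos; rewrite natrD; ring.
case: (ltngtP j k) => jk.
- have -> : I (fun t => cos (j%:R * t + d - (k%:R * t + e))) (- pi) pi = 0 :> R.
    rewrite -(@I_cos_full (k - j) (e - d)) ?subn_gt0//.
    by apply: I_eq => t; rewrite -cosN; congr cos; rewrite natrB ?(ltnW jk)//; ring.
  by rewrite !mulr0 addr0.
- have -> : I (fun t => cos (j%:R * t + d - (k%:R * t + e))) (- pi) pi = 0 :> R.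
    rewrite -(@I_cos_full (j - k) (d - e)) ?subn_gt0//.
    by apply: I_eq => t; congr cos; rewrite natrB ?(ltnW jk)//; ring.
  by rewrite !mulr0 addr0.
- have -> : I (fun t => cos (j%:R * t + d - (k%:R * t + e))) (- pi) pi
     = I (fun=> cos (d - e)) (- pi) pi :> R.
    by apply: I_eq => t; rewrite jk; congr cos; ring.
  by rewrite Icst; field.
Qed.

Lemma harm_cos b j d k x : (0 < k)%N ->
  harm b (fun t => cos (j%:R * t + d)) k x = if j == k then cos (j%:R * x + d - b) else 0.
Proof.
move=> k0; rewrite /harm.
under I_eq do rewrite mulrDr -addrA addrCA.
rewrite I_cos_cos//; case: ifP => _; last by rewrite mulr0.
by rewrite mulKf// gt_eqF// pi_gt0.
Qed.

Lemma trig_polynomialP m T : trig_polynomial m T <-> exists c d : nat -> R,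
  T = fun x => \sum_(0 <= k < m.+1) (c k * cos (k%:R * x) + d k * sin (k%:R * x)).
Proof.
by split=> -[c [d ->]]; exists c, d; apply/funext => x; rewrite big_mkord.
Qed.

Lemma trig_polynomialD m T T' : trig_polynomial m T -> trig_polynomial m T' ->
  trig_polynomial m (fun x => T x + T' x).
Proof.
move=> [c [d ->]] [c' [d' ->]]; exists (fun k => c k + c' k), (fun k => d k + d' k).
apply/funext => x; rewrite -big_split/=; apply: eq_bigr => k _; ring.
Qed.

Lemma trig_polynomialZ m c T : trig_polynomial m T -> trig_polynomial m (fun x => c * T x).
Proof.
move=> [a [d ->]]; exists (fun k => c * a k), (fun k => c * d k).
apply/funext => x; rewrite mulr_sumr; apply: eq_bigr => k _; ring.
Qed.

Lemma trig_polynomial_harmonic m k c d : (k <= m)%N ->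
  trig_polynomial m (fun x : R => c * cos (k%:R * x) + d * sin (k%:R * x)).
Proof.
move=> km; apply/trig_polynomialP.
exists (fun i => if i == k then c else 0), (fun i => if i == k then d else 0).
have kin : k \in index_iota 0 m.+1 by rewrite mem_index_iota ltnS.
apply/funext => x; rewrite (bigD1_seq k kin (iota_uniq _ _))/= eqxx.
by rewrite big1 ?addr0// => i /negPf ->; rewrite !mul0r addr0.
Qed.

Lemma trig_polynomial_cst m c : trig_polynomial m (fun=> c : R).
Proof.
have := @trig_polynomial_harmonic m 0 c 0 (leq0n _).
by congr trig_polynomial; apply/funext => x; rewrite mul0r cos0; ring.
Qed.

Lemma trig_polynomial_sum m (J : eqType) (r : seq J) (F : J -> R -> R) :
  (forall l, l \in r -> trig_polynomial m (F l)) ->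
  trig_polynomial m (fun x => \sum_(l <- r) F l x).
Proof.
elim: r => [_|l r ih H].
  have := trig_polynomial_cst m 0; congr trig_polynomial.
  by apply/funext => x; rewrite big_nil.
have Hr : trig_polynomial m (fun x => \sum_(l <- r) F l x).
  by apply: ih => l' l'r; apply: H; rewrite inE l'r orbT.
have := trig_polynomialD (H l (mem_head _ _)) Hr.
by congr trig_polynomial; apply/funext => x; rewrite big_cons.
Qed.

Lemma trig_polynomial_harm m b g k : continuous g -> periodic g (pi *+ 2) ->
  (k <= m)%N -> trig_polynomial m (harm b g k).
Proof.
move=> cg pg km.
have := @trig_polynomial_harmonic m k
  (fourier_cos g k * cos b - fourier_sin g k * sin b)
  (fourier_cos g k * sin b + fourier_sin g k * cos b) km.
congr trig_polynomial; apply/funext => x.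
by rewrite harm_fourier// cosB sinB; ring.
Qed.

Lemma cts_trig_polynomial m T : trig_polynomial m T -> continuous T.
Proof. by move=> [c [d ->]]; cts. Qed.

Lemma periodic_trig_polynomial m T : trig_polynomial m T -> periodic T (pi *+ 2).
Proof.
move=> [c [d ->]] x; apply: eq_bigr => k _.
have := periodic_mul_nat_cos k 0 x; rewrite !addr0 => ->.
have := periodic_mul_nat_cos k (- (pi / 2)) x; rewrite !cosBpihalf => ->//.
Qed.

Lemma harm_trig_polynomial b m T k x : trig_polynomial m T -> (m < k)%N -> harm b T k x = 0.
Proof.
move=> [c [d ->]] mk; have k0 : (0 < k)%N by exact: leq_ltn_trans mk.
rewrite harm_sum; last by move=> i; cts.
rewrite big1// => i _; have ik : (i == k :> nat) = false.
  by apply/negbTE; rewrite neq_ltn (leq_trans (ltn_ord i)).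
rewrite harmD ?harmZ; [|by cts..].
have := harm_cos b i 0 x k0; have := harm_cos b i (- (pi / 2)) x k0.
rewrite ik; under eq_fun do rewrite cosBpihalf.
move=> ->; under eq_fun do rewrite addr0.
by move=> ->; rewrite !mulr0 addr0.
Qed.

(** Orthogonality of the harmonics. It serves to read off the Fourier coefficients of the function
    built for the lower bound. *)
Lemma harm_harm b c g k j x : continuous g -> periodic g (pi *+ 2) -> (0 < k)%N ->
  harm c (harm b g j) k x = if j == k then harm (b + c) g j x else 0.
Proof.
move=> cg pg k0.
have -> : harm b g j = fun x => fourier_cos g j * cos (j%:R * x + (- b))
   + fourier_sin g j * cos (j%:R * x + (- b - pi / 2)).
  by apply/funext => y; rewrite harm_fourier// addrA cosBpihalf.
rewrite harmD ?harmZ ?harm_cos//; [|by cts..].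
case: ifP => _; last by rewrite !mulr0 addr0.
rewrite harm_fourier//; congr (_ * cos _ + _ * _); first by ring.
by rewrite -cosBpihalf; congr cos; ring.
Qed.

End Harmonics.

(** * Fejer means of shifted harmonics *)

Section FejerMeans.
Context {R : realType}.
Implicit Types (f g G : R -> R) (b c t x : R) (k m n N : nat).

Lemma periodic_int f c : periodic f c -> forall (z : int) x, f (x + z%:~R * c) = f x.
Proof.
move=> pf; have pn k x : f (x + k%:R * c) = f x.
  by rewrite mulr_natl (periodicn pf).
case=> k x; first exact: pn.
by rewrite NegzE rmorphN/= mulNr -(pn k.+1) subrK.
Qed.

Lemma periodic_2pi_reduce f x : periodic f (pi *+ 2) ->
  exists2 y, - pi <= y <= pi & f y = f x.
Proof.
move=> pf; pose z := Num.floor ((x + pi) / (pi *+ 2)).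
have p0 : 0 < pi *+ 2 :> R by rewrite mulrn_wgt0// pi_gt0.
exists (x + (- z)%:~R * (pi *+ 2)); last exact: periodic_int.
have /andP[] := floor_itv ((x + pi) / (pi *+ 2)); rewrite -/z.
rewrite ler_pdivlMr// ltr_pdivrMr// rmorphN rmorphD/= mulrDl mulNr mulr2n.
by move=> h1 h2; apply/andP; split; lra.
Qed.

Lemma periodic_bounded f : continuous f -> periodic f (pi *+ 2) ->
  exists2 M, 0 <= M & forall x, `|f x| <= M.
Proof.
move=> cf pf; have pp : - pi <= pi :> R by rewrite ge0_cp// pi_ge0.
have cn : {within `[- pi, pi], continuous (fun x => `|f x|)}.
  by apply: continuous_subspaceT; cts.
have [c cI cM] := EVT_max pp cn.
exists `|f c| => // x; have [y yI <-] := periodic_2pi_reduce x pf.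
by apply: cM; rewrite in_itv.
Qed.

(** A shifted Fejer mean without constant term, multiplied by m + 1: the normalisation that
    [double_abel] produces. *)
Definition fmean b g m x : R :=
  \sum_(1 <= k < m.+1) (m.+1%:R - k%:R) * harm b g k x.

Lemma fmean_integral b g m x : continuous g ->
  fmean b g m x = pi^-1 * (cos b * I (fun t => g (x + t) * (fejer m t - m.+1%:R / 2)) (- pi) pi
    - sin b * I (fun t => g (x + t) * cfejer m t) (- pi) pi).
Proof.
move=> cg; have cf := @cts_fejer R m; have cc := @cts_cfejer R m.
rewrite /fmean /harm; under eq_bigr do rewrite mulrCA.
rewrite -mulr_sumr; congr (_ * _).
under eq_bigr do (rewrite -IZ; last by cts).
rewrite -Isum; last by move=> k _; cts.
rewrite -[X in _ = X - _]IZ; last by cts.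
rewrite -[X in _ = _ - X]IZ; last by cts.
rewrite -IB; [|by cts|by cts].
apply: I_eq => t; rewrite /fejer /cfejer [m.+1%:R / 2 + _]addrC addrK.
rewrite !mulr_sumr -sumrB; apply: eq_bigr => k _.
by rewrite cosD; ring.
Qed.

Lemma I_cfejer_odd g m x : continuous g ->
  I (fun t => g (x + t) * cfejer m t) (- pi) pi
  = I (fun t => (g (x + t) - g (x - t)) * cfejer m t) 0 pi.
Proof.
move=> cg; have cc := @cts_cfejer R m; rewrite I_sym; last by cts.
by apply: I_eq => t; rewrite cfejer_odd; ring.
Qed.

Lemma I_fejer m : I (@fejer R m) (- pi) pi = pi * m.+1%:R.
Proof.
rewrite /fejer ID; [|by cts..].
rewrite Icst Isum; last by move=> k _; cts.
rewrite big_nat_cond big1 ?addr0; first by field.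
move=> k /andP[/andP[k0 _] _]; rewrite IZ; last by cts.
have := @I_cos_full R k 0 k0.
by under I_eq do rewrite addr0; move=> ->; rewrite mulr0.
Qed.

Lemma I_fejer_cos m : I (fun t : R => fejer m t * cos t) (- pi) pi = pi * m%:R.
Proof.
have E (t : R) : fejer m t * cos t = m.+1%:R / 2 * cos (1%:R * t + 0)
   + \sum_(1 <= k < m.+1) (m.+1%:R - k%:R) * (cos (k%:R * t + 0) * cos (1%:R * t + 0)).
  rewrite !addr0 (mul1r t) /fejer mulrDl mulr_suml; congr (_ + _).
  by apply: eq_bigr => k _; rewrite addr0 mulrA.
rewrite (I_eq _ _ E) ID; [|by cts|by cts].
rewrite IZ; last by cts.
rewrite I_cos_full// mulr0 add0r Isum; last by move=> k _; cts.
under eq_bigr do (rewrite IZ; last by cts).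
under eq_bigr do rewrite I_cos_cos//.
case: m {E} => [|m]; first by rewrite big_geq// mulr0.
rewrite big_nat_recl//= subrr cos0 big_nat_cond big1 ?addr0; last first.
  by case=> [|k]; rewrite // ?mulr0.
by rewrite -[m.+2%:R]natr1; ring.
Qed.

(** Expanding cos(kt + b) separates the two kernels. The cos b part is at most 2c, because the Fejer
    kernel is nonnegative with known mass. The sin b part only sees the odd difference g(x+t) -
    g(x-t), which is bounded by 2c and has primitive G(x+t) + G(x-t); [conj_fejer_integral] gives
    66c, and division by pi >= 2 leaves 33c. *)
Lemma fmean_near_conjugate b g G c m n x : (0 < n)%N -> (n <= m)%N ->
  continuous g -> antideriv G g ->
  (forall t, `|g t| <= c) -> (forall t, `|G t| <= c / n%:R) ->
  `|fmean b g m x / m.+1%:R + sin b / pi *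
     I (fun t => (g (x + t) - g (x - t)) * cut_inv m%:R^-1 t) m%:R^-1 n%:R^-1|
  <= 35 * c.
Proof.
move=> n0 nm cg GG gc Gc; have cf := @cts_fejer R m; have cc := @cts_cfejer R m.
have p0 : 0 < pi :> R := @pi_gt0 R.
have pn : pi != 0 :> R by rewrite gt_eqF.
have M0 : 0 < m.+1%:R :> R by [].
have Mn : m.+1%:R != 0 :> R by rewrite pnatr_eq0.
have c0 : 0 <= c by rewrite (le_trans _ (gc 0)).
have pp : - pi <= pi :> R by rewrite ge0_cp// pi_ge0.
pose D t := g (x + t) - g (x - t).
have cD : continuous D by rewrite /D; cts.
have ED : antideriv (fun t => G (x + t) + G (x - t)) D.
  have A1 := antideriv_affine 1 x GG; have A2 := antideriv_affine (-1) x GG.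
  apply: antideriv_eq (antideriv_eql _ (antiderivD A1 A2)) => t /=.
    by rewrite mulN1r !mul1r mulN1r ![_ + x]addrC.
  by rewrite mul1r mulN1r ![_ + x]addrC.
have Dc t : `|D t| <= 2 * c.
  by rewrite (le_trans (ler_normB _ _))//; have := gc (x + t); have := gc (x - t); lra.
have Ec t : `|G (x + t) + G (x - t)| <= 2 * c / n%:R.
  rewrite (le_trans (ler_normD _ _))//; have := Gc (x + t); have := Gc (x - t).
  by rewrite -mulrA; lra.
have K := conj_fejer_integral n0 nm cD ED Dc Ec.
have S1 : `|pi^-1 * (I (fun t => g (x + t) * (fejer m t - m.+1%:R / 2)) (- pi) pi)
    / m.+1%:R| <= 2 * c.
  rewrite mulrAC normrM ger0_norm; last by rewrite divr_ge0// invr_ge0 ltW.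
  rewrite -ler_pdivlMl ?divr_gt0 ?invr_gt0// invf_div invrK.
  have -> : m.+1%:R * pi * (2 * c) = I (fun t => c * (fejer m t + m.+1%:R / 2)) (- pi) pi.
    rewrite IZ; last by cts.
    rewrite ID; [|by cts|by cts].
    by rewrite I_fejer Icst; move: (m.+1%:R) => M; field.
  apply: I_norm_le => //; [by cts|by cts|] => t _.
  have M2 : 0 <= m.+1%:R / 2 :> R by rewrite divr_ge0.
  rewrite normrM ler_pM// (le_trans (ler_normB _ _))//.
  by rewrite !ger0_norm// fejer_ge0.
have S2 : `|pi^-1 * (I (fun t => g (x + t) * cfejer m t) (- pi) pi / m.+1%:R -
   I (fun t => D t * cut_inv m%:R^-1 t) m%:R^-1 n%:R^-1)| <= 33 * c.
  rewrite I_cfejer_odd// -IZr; last by cts.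
  under I_eq do rewrite -mulrA.
  rewrite normrM gtr0_norm ?invr_gt0// ler_pdivrMl// (le_trans K)//.
  have : 2 * c <= pi * c by rewrite ler_wpM2r// pi_ge2.
  lra.
have -> : fmean b g m x / m.+1%:R
    + sin b / pi * I (fun t => D t * cut_inv m%:R^-1 t) m%:R^-1 n%:R^-1
  = cos b * (pi^-1 * (I (fun t => g (x + t) * (fejer m t - m.+1%:R / 2)) (- pi) pi) / m.+1%:R)
    - sin b * (pi^-1 * (I (fun t => g (x + t) * cfejer m t) (- pi) pi / m.+1%:R -
   I (fun t => D t * cut_inv m%:R^-1 t) m%:R^-1 n%:R^-1)).
  by rewrite fmean_integral//; move: (m.+1%:R) Mn (pi) pn => M Mn p pn; field; rewrite ?Mn ?pn.
rewrite (le_trans (ler_normB _ _))//; apply: (@le_trans _ _ (2 * c + 33 * c)); last by lra.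
by rewrite lerD// normrM; [apply: le_trans S1|apply: le_trans S2];
  rewrite ler_piMl// ?cos_max ?sin_max.
Qed.

Definition fejer_mean f N x : R :=
  pi^-1 * I (fun t => f (x + t) * fejer N t) (- pi) pi / N.+1%:R.

Lemma fejer_meanE f N x : continuous f -> periodic f (pi *+ 2) ->
  fejer_mean f N x = pi^-1 / 2 * I f (- pi) pi + fmean 0 f N x / N.+1%:R.
Proof.
move=> cf pf; have cj := @cts_fejer R N.
rewrite fmean_integral// cos0 sin0 mul0r subr0 mul1r /fejer_mean.
have -> : I (fun t => f (x + t) * (fejer N t - N.+1%:R / 2)) (- pi) pi
  = I (fun t => f (x + t) * fejer N t) (- pi) pi - I f (- pi) pi * (N.+1%:R / 2).
  rewrite -(@I_shift_periodic _ f x)// -IZr; last by cts.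
  by rewrite -IB; [apply: I_eq => t; ring|cts|cts].
by move: (N.+1%:R) (ltr0Sn R N) (pi) (@pi_gt0 R) => M M0 p p0; field; rewrite !gt_eqF.
Qed.

(** Korovkin's argument: |f(x+t) - f(x)| <= e/2 + L (1 - cos t) on the period, and the Fejer mean of
    1 - cos t at 0 is exactly 1/(N+1). With L = 24 M / d^2, [onem_cos_ge] makes L (1 - cos t) at
    least 2M once |t| >= d. *)
Lemma fejer_mean_cvg f x : continuous f -> periodic f (pi *+ 2) ->
  fejer_mean f N x @[N --> \oo] --> f x.
Proof.
move=> cf pf; have [M M0 fM] := periodic_bounded cf pf.
apply/cvgrPdist_le => e e0.
have e2 : 0 < e / 2 by rewrite divr_gt0.
have /cvgrPdist_le/(_ _ e2)[d /= d0 dP] := cf x.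
have d20 : 0 < d ^+ 2 by rewrite exprn_gt0.
pose L := 24 * M / d ^+ 2.
have L0 : 0 <= L by rewrite divr_ge0 ?mulr_ge0// ltW.
have key t : - pi <= t <= pi -> `|f (x + t) - f x| <= e / 2 + L * (1 - cos t).
  rewrite -ler_norml => tpi; have c1 := onem_cos_ge tpi.
  have c0 : 0 <= 1 - cos t by rewrite subr_ge0 cos_le1.
  have [td|dt] := ltP `|t| d.
    have : `|f x - f (x + t)| <= e / 2.
      by apply: dP; rewrite /ball_/= opprD addrA subrr sub0r normrN.
    by rewrite distrC; have := mulr_ge0 L0 c0; lra.
  have d2t : d ^+ 2 <= t ^+ 2.
    by rewrite -[t ^+ 2](real_normK (num_real t)) ler_pXn2r// ?nnegrE ltW.
  have : `|f (x + t) - f x| <= 2 * M.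
    by rewrite (le_trans (ler_normB _ _))//; have := fM (x + t); have := fM x; lra.
  have : 2 * M <= L * (1 - cos t).
    apply: (@le_trans _ _ (L * (d ^+ 2 / 12))).
      by rewrite /L le_eqVlt; apply/orP; left; apply/eqP; field; rewrite gt_eqF.
    by rewrite ler_wpM2l//; lra.
  lra.
have pp : - pi <= pi :> R by rewrite ge0_cp// pi_ge0.
have p0 : 0 < pi :> R := @pi_gt0 R.
have bound N : `|f x - fejer_mean f N x| <= e / 2 + L / N.+1%:R.
  have cj := @cts_fejer R N; have M1 : 0 < N.+1%:R :> R by [].
  have -> : f x - fejer_mean f N x
      = - (pi^-1 / N.+1%:R * I (fun t => (f (x + t) - f x) * fejer N t) (- pi) pi).
    have -> : I (fun t => (f (x + t) - f x) * fejer N t) (- pi) pi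
      = I (fun t => f (x + t) * fejer N t) (- pi) pi - f x * (pi * N.+1%:R).
      rewrite -I_fejer -IZ; last by cts.
      by rewrite -IB; [apply: I_eq => t; ring|cts|cts].
    rewrite /fejer_mean; move: (N.+1%:R) M1 (pi) p0 => K K0 p p0.
    by field; rewrite !gt_eqF.
  rewrite normrN normrM gtr0_norm ?divr_gt0 ?invr_gt0//.
  have c0 : 0 < pi * N.+1%:R :> R by rewrite mulr_gt0.
  rewrite -invfM mulrC ler_pdivrMr//.
  have -> : (e / 2 + L / N.+1%:R) * (pi * N.+1%:R)
     = I (fun t => (e / 2 + L) * fejer N t - L * (fejer N t * cos t)) (- pi) pi.
    rewrite IB; [|by cts|by cts].
    rewrite !IZ ?I_fejer ?I_fejer_cos; [|by cts|by cts].
    rewrite -[N.+1%:R]natr1; have : N%:R + 1 != 0 :> R by rewrite natr1 pnatr_eq0.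
    by move: (N%:R) => K K0; field.
  apply: I_norm_le => //; [by cts|by cts|] => t tI.
  rewrite normrM (ger0_norm (fejer_ge0 _ _)).
  have := ler_wpM2r (fejer_ge0 N t) (key t tI); lra.
near=> N; rewrite (le_trans (bound N))// [leRHS]splitr lerD2l.
rewrite ler_pdivrMr// mulrC -ler_pdivrMr// (@le_trans _ _ N%:R)// ?ler_nat//.
by near: N; exact: nbhs_infty_ger.
Unshelve. all: by end_near. Qed.

End FejerMeans.

(** * Integrals of the modulus against dt/t *)

Section HarmonicPartition.
Context {R : realType}.
Implicit Types (h : R -> R) (r : nat -> R) (e t : R) (j k n d : nat).

Lemma inv_nat_le j k : (0 < j)%N -> (j <= k)%N -> k%:R^-1 <= j%:R^-1 :> R.
Proof.
by move=> j0 jk; rewrite lef_pV2 ?posrE ?ltr0n ?ler_nat// (leq_trans j0).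
Qed.

Lemma inv_nat_sub j : (0 < j)%N -> j%:R^-1 - j.+1%:R^-1 = (j%:R * j.+1%:R)^-1 :> R.
Proof.
move=> j0; have : j%:R != 0 :> R by rewrite pnatr_eq0 -lt0n.
have : j.+1%:R != 0 :> R by rewrite pnatr_eq0.
by rewrite -natr1; move: (j%:R) => J J1 J0; field; rewrite J1 J0.
Qed.

(* The integral is cut at the points 1/j. *)
Lemma harmonic_partition h r e n d : (0 < n)%N -> continuous h ->
  (forall j t, (0 < j)%N -> e <= j.+1%:R^-1 -> j.+1%:R^-1 <= t <= j%:R^-1 ->
    j%:R * r j.+1 <= h t <= j.+1%:R * r j) ->
  e <= (n + d)%:R^-1 ->
  \sum_(n.+1 <= j < (n + d).+1) r j / j%:R <= I h (n + d)%:R^-1 n%:R^-1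
  <= \sum_(n <= j < n + d) r j / j%:R.
Proof.
move=> n0 ch hr; elim: d => [|d ih] ed.
  by rewrite addn0 !big_geq// /I subrr lexx.
have nd0 : (0 < n + d)%N by rewrite addn_gt0 n0.
have le1 := inv_nat_le nd0 (leqnSn _).
have edS : e <= (n + d)%:R^-1 by rewrite (le_trans ed)// addnS.
have {ih} /andP[ih1 ih2] := ih edS.
rewrite addnS in ed *; rewrite -(Ichasles h _ (n + d)%:R^-1).
have p0 : 0 < (n + d)%:R :> R by rewrite ltr0n.
have q0 : 0 < (n + d).+1%:R :> R by [].
have h1 : I h (n + d).+1%:R^-1 (n + d)%:R^-1 <= r (n + d)%N / (n + d)%:R.
  have -> : r (n + d)%N / (n + d)%:R
    = I (fun=> (n + d).+1%:R * r (n + d)%N) (n + d).+1%:R^-1 (n + d)%:R^-1.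
    rewrite Icst inv_nat_sub//.
    by move: ((n + d)%:R) ((n + d).+1%:R) p0 q0 => U V U0 V0; field; rewrite !gt_eqF.
  by apply: I_le => //; [exact: cts_cst|move=> t tI; have /andP[] := hr _ _ nd0 ed tI].
have h2 : r (n + d).+1 / (n + d).+1%:R <= I h (n + d).+1%:R^-1 (n + d)%:R^-1.
  have -> : r (n + d).+1 / (n + d).+1%:R
    = I (fun=> (n + d)%:R * r (n + d).+1) (n + d).+1%:R^-1 (n + d)%:R^-1.
    rewrite Icst inv_nat_sub//.
    by move: ((n + d)%:R) ((n + d).+1%:R) p0 q0 => U V U0 V0; field; rewrite !gt_eqF.
  by apply: I_le => //; [exact: cts_cst|move=> t tI; have /andP[] := hr _ _ nd0 ed tI].
apply/andP; split.
  by rewrite big_nat_recr/= ?ltnS ?leq_addr// addrC lerD.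
by rewrite big_nat_recr/= ?leq_addr// addrC lerD.
Qed.

End HarmonicPartition.

(** * Moduli of continuity and dilated arguments *)

Section Modulus.
Context {R : realType}.
Implicit Types (omega phi : R -> R) (a b e t s : R) (j k m n : nat).
Variable omega : R -> R.
Hypothesis homega : modulus_of_continuity omega.

Lemma omega_le s t : 0 <= s -> s <= t -> omega s <= omega t.
Proof.
have [_ h _ _] := homega; move=> s0 st; apply: h => //.
  by rewrite in_itv/= s0.
by rewrite in_itv/= (le_trans s0).
Qed.

Lemma omega_ge0 t : 0 <= t -> 0 <= omega t.
Proof. by move=> t0; have [_ _ <- _] := homega; exact: omega_le. Qed.

Lemma omega_add s t : 0 <= s -> 0 <= t -> omega (s + t) <= omega s + omega t.
Proof. by have [_ _ _] := homega; apply. Qed.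

Lemma omega_muln k t : 0 <= t -> omega (k%:R * t) <= k%:R * omega t.
Proof.
move=> t0; elim: k => [|k ih]; first by rewrite !mul0r; have [_ _ -> _] := homega.
rewrite -natr1 !mulrDl !mul1r (le_trans (omega_add _ _))// ?mulr_ge0//.
by rewrite lerD2r.
Qed.

Lemma omega_double t : 0 <= t -> omega (2 * t) <= 2 * omega t.
Proof. exact: omega_muln. Qed.

(** The interval [0, t] is covered by floor(nt) + 1 steps of length 1/n. *)
Lemma omega_linear n t : (0 < n)%N -> 0 <= t ->
  omega t <= (1 + n%:R * t) * omega n%:R^-1.
Proof.
move=> n0 t0; have nR : 0 < n%:R :> R by rewrite ltr0n.
have nt0 : 0 <= n%:R * t by rewrite mulr_ge0// ltW.
have /andP[h1 h2] := truncn_itv nt0; set k := Num.truncn _ in h1 h2.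
have tk : t <= k.+1%:R * n%:R^-1.
  by rewrite ler_pdivlMr// mulrC ltW.
have i0 : 0 <= n%:R^-1 :> R by rewrite invr_ge0 ltW.
apply: (le_trans (omega_le t0 tk)); apply: (le_trans (omega_muln _ i0)).
apply: ler_wpM2r; first exact: omega_ge0.
by rewrite -natr1 addrC lerD2l.
Qed.

(** The even extension is continuous on the whole line, as the calculus of [I] requires.
    Subadditivity bounds every increment by omega(|s - t|), so only the right limit at 0 matters. *)
Lemma cts_omega : continuous (fun t => omega `|t|).
Proof.
have [cw _ w0 _] := homega.
have H0 : omega t @[t --> 0^'+] --> (0 : R).
  by have [_ +] := (continuous_within_itvcyP 0 omega).1 cw; rewrite w0.
move=> x; apply/cvgrPdist_le => e e0.
have /cvgrPdist_le/(_ _ e0)[d /= d0 dP] := H0.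
have small t : 0 <= t -> t < d -> omega t <= e.
  move=> t0 td; have [->|tn] := eqVneq t 0; first by rewrite w0 ltW.
  have tpos : 0 < t by rewrite lt_neqAle eq_sym tn.
  have bt : `|0 - t| < d by rewrite sub0r normrN gtr0_norm.
  have := dP t bt tpos; rewrite sub0r normrN.
  by apply: le_trans; exact: ler_norm.
have sub s t : `|omega `|s| - omega `|t| | <= omega `|s - t|.
  wlog st : s t / `|s| <= `|t|.
    move=> W; have [/W//|/ltW/W] := leP `|s| `|t|.
    by rewrite distrC [`|s - t|]distrC.
  rewrite ler0_norm ?subr_le0 ?omega_le// opprB lerBlDl.
  apply: (@le_trans _ _ (omega (`|s| + `|s - t|))); last exact: omega_add.
  by apply: omega_le => //; rewrite -lerBlDl distrC lerB_dist.
exists d => //= y xy; rewrite (le_trans (sub _ _))// small//.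
Qed.

Lemma class_H_cts phi : class_H omega phi -> continuous phi.
Proof. by case=> -[]. Qed.

Lemma I_cut_eq (h : R -> R) e e' a b : continuous h -> 0 < e -> 0 < e' ->
  e <= a -> e' <= a -> a <= b ->
  I (fun t => h t * cut_inv e t) a b = I (fun t => h t * cut_inv e' t) a b.
Proof.
move=> ch e0 e0' ea ea' ab; have c1 := cts_cut_inv e0; have c2 := cts_cut_inv e0'.
by apply/eqP; rewrite eq_le; apply/andP; split; apply: I_le; [|by cts|by cts| |
  |by cts|by cts|] => // t /andP[at_ _]; rewrite !cut_invE// ?(le_trans ea)// ?(le_trans ea').
Qed.

Lemma cut_inv_ge0 e t : 0 < e -> 0 <= cut_inv e t.
Proof. by move=> e0; rewrite invr_ge0 le_max (ltW e0) orbT. Qed.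

(* On [a, b] the integral of omega t / t, cut off below a. *)
Let W e a b := I (fun t => omega `|t| * cut_inv e t) a b.

Let cw := cts_omega.

Let W_ge0 e a b : 0 < e -> a <= b -> 0 <= W e a b.
Proof.
move=> e0 ab; have c1 := cts_cut_inv e0; apply: I_ge0 => //; first by cts.
by move=> t _; rewrite mulr_ge0 ?omega_ge0 ?cut_inv_ge0.
Qed.

Let W_le e a b : 0 < e -> e <= a -> a <= b -> W e a b <= omega b / a * (b - a).
Proof.
move=> e0 ea ab; have c1 := cts_cut_inv e0; have a0 : 0 < a by exact: lt_le_trans ea.
rewrite -Icst; apply: I_le => //; [by cts|by cts|] => t /andP[at_ tb].
have t0 : 0 < t by exact: lt_le_trans at_.
rewrite cut_invE ?(le_trans ea)// gtr0_norm// ler_pM ?omega_ge0 ?invr_ge0 ?(ltW t0)//.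
  by rewrite omega_le// ltW.
by rewrite lef_pV2.
Qed.

Let W_sum n d e : (0 < n)%N -> 0 < e -> e <= (n + d)%:R^-1 ->
  \sum_(n.+1 <= j < (n + d).+1) omega j%:R^-1 / j%:R <= W e (n + d)%:R^-1 n%:R^-1
  <= \sum_(n <= j < n + d) omega j%:R^-1 / j%:R.
Proof.
move=> n0 e0; have c1 := cts_cut_inv e0.
apply: (@harmonic_partition _ _ (fun j => omega j%:R^-1)) => //; first by cts.
move=> j t j0 ej /andP[jt tj]; have jR : 0 < j%:R :> R by rewrite ltr0n.
have i0 : 0 < j.+1%:R^-1 :> R by rewrite invr_gt0.
have t0 : 0 < t by exact: lt_le_trans jt.
rewrite cut_invE ?(le_trans ej)// gtr0_norm//.
have v1 : t^-1 <= j.+1%:R by rewrite -[leRHS]invrK lef_pV2.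
have v2 : j%:R <= t^-1 by rewrite -[leLHS]invrK lef_pV2// posrE invr_gt0.
have w1 := omega_le (ltW i0) jt; have w2 := omega_le (ltW t0) tj.
apply/andP; split; [rewrite [leLHS]mulrC|rewrite [leRHS]mulrC]; apply: ler_pM => //.
- exact: omega_ge0 (ltW i0).
- exact: omega_ge0 (ltW t0).
- by rewrite invr_ge0 ltW.
Qed.

(** Substituting u = 2t moves the range to [2/m, 2/n] and keeps dt/t. The excess over [1/n, 2/n] is
    at most omega(2/n) <= 2 omega(1/n), so a factor 2 inside the modulus is harmless. *)
Lemma omega_integral_upper m n : (0 < n)%N -> (n <= m)%N ->
  I (fun t => omega `|2 * t| * cut_inv m%:R^-1 t) m%:R^-1 n%:R^-1
  <= \sum_(n <= j < m) omega j%:R^-1 / j%:R + 2 * omega n%:R^-1.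
Proof.
move=> n0 nm; have m0 : (0 < m)%N by exact: leq_trans nm.
have e0 : 0 < m%:R^-1 :> R by rewrite invr_gt0 ltr0n.
have e2 : 0 < 2 * m%:R^-1 :> R by rewrite mulr_gt0.
have i0 : 0 < n%:R^-1 :> R by rewrite invr_gt0 ltr0n.
have mn := @inv_nat_le R _ _ n0 nm.
have c1 := cts_cut_inv e0; have c2 := cts_cut_inv e2.
have -> : I (fun t => omega `|2 * t| * cut_inv m%:R^-1 t) m%:R^-1 n%:R^-1
  = W (2 * m%:R^-1) (2 * m%:R^-1) (2 * n%:R^-1).
  rewrite -[2 * m%:R^-1 in X in W _ X]addr0 -[2 * n%:R^-1]addr0 /W -Iaffine; last by cts.
  apply: I_eq => t; rewrite addr0 /cut_inv -maxr_pMr// invfM; field.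
  by rewrite gt_eqF// lt_max e0 orbT.
rewrite /W (@I_cut_eq _ _ m%:R^-1)//; [|by lra|by lra].
have em : m%:R^-1 <= 2 * m%:R^-1 :> R by lra.
have en : n%:R^-1 <= 2 * n%:R^-1 :> R by lra.
have h0 := W_ge0 e0 em; have := W_le e0 mn en.
have -> : 2 * n%:R^-1 - n%:R^-1 = n%:R^-1 :> R by ring.
rewrite divfK ?gt_eqF// => h1.
have h2 := omega_double (ltW i0).
have := @W_sum n (m - n) m%:R^-1 n0 e0; rewrite subnKC// => /(_ (lexx _))/andP[_ h3].
have := Ichasles (fun t => omega `|t| * cut_inv m%:R^-1 t) m%:R^-1 (2 * m%:R^-1) (2 * n%:R^-1).
have := Ichasles (fun t => omega `|t| * cut_inv m%:R^-1 t) m%:R^-1 n%:R^-1 (2 * n%:R^-1).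
rewrite /W in h0 h1 h3 *; lra.
Qed.

(** The same with u = t/2: the range becomes [1/(2m), 1/(2n)], and the missing piece [1/(2n), 1/n]
    carries at most omega(1/n). *)
Lemma omega_integral_lower m n : (0 < n)%N -> (n <= m)%N ->
  \sum_(n.+1 <= j < m.+1) omega j%:R^-1 / j%:R - omega n%:R^-1
  <= I (fun t => omega `|2^-1 * t| * cut_inv m%:R^-1 t) m%:R^-1 n%:R^-1.
Proof.
move=> n0 nm; have m0 : (0 < m)%N by exact: leq_trans nm.
have e0 : 0 < m%:R^-1 :> R by rewrite invr_gt0 ltr0n.
have e2 : 0 < 2^-1 * m%:R^-1 :> R by rewrite mulr_gt0.
have i0 : 0 < n%:R^-1 :> R by rewrite invr_gt0 ltr0n.
have mn := @inv_nat_le R _ _ n0 nm.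
have c1 := cts_cut_inv e0; have c2 := cts_cut_inv e2.
have -> : I (fun t => omega `|2^-1 * t| * cut_inv m%:R^-1 t) m%:R^-1 n%:R^-1
  = W (2^-1 * m%:R^-1) (2^-1 * m%:R^-1) (2^-1 * n%:R^-1).
  rewrite -[2^-1 * m%:R^-1 in X in W _ X]addr0 -[2^-1 * n%:R^-1]addr0 /W -Iaffine; last by cts.
  apply: I_eq => t; rewrite addr0 /cut_inv -maxr_pMr ?invr_ge0// invfM; field.
  by rewrite gt_eqF// lt_max e0 orbT.
have em : 2^-1 * m%:R^-1 <= m%:R^-1 :> R by lra.
have en : 2^-1 * n%:R^-1 <= n%:R^-1 :> R by lra.
have emn : 2^-1 * m%:R^-1 <= 2^-1 * n%:R^-1 :> R by lra.
have h0 := W_ge0 e2 em.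
have := W_le e2 emn en.
have -> : n%:R^-1 - 2^-1 * n%:R^-1 = 2^-1 * n%:R^-1 :> R by lra.
rewrite divfK ?gt_eqF ?mulr_gt0// => h1.
have := @W_sum n (m - n) (2^-1 * m%:R^-1) n0 e2; rewrite subnKC// => /(_ em)/andP[h3 _].
have := Ichasles (fun t => omega `|t| * cut_inv (2^-1 * m%:R^-1) t)
  (2^-1 * m%:R^-1) m%:R^-1 n%:R^-1.
have := Ichasles (fun t => omega `|t| * cut_inv (2^-1 * m%:R^-1) t)
  (2^-1 * m%:R^-1) (2^-1 * n%:R^-1) n%:R^-1.
rewrite /W in h0 h1 h3 *; lra.
Qed.

End Modulus.

(** * Jackson's kernel and smooth approximation *)

Section Jackson.
Context {R : realType}.
Implicit Types (f g h phi : R -> R) (b c t x : R) (i j k l m n : nat).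

Lemma is_derive_quadratic f x b c :
  (forall d, `|f (x + d) - f x - d * b| <= c * d ^+ 2) -> is_derive x (1 : R) f b.
Proof.
move=> H; have L : (fun d : R => d^-1 *: ((f \o shift x) (d *: (1 : R)) - f x)) @ 0^' --> b.
  apply/cvgrPdist_le => e e0.
  have c0 : 0 <= c by have := le_trans (normr_ge0 _) (H 1); rewrite expr1n mulr1.
  have d0 : 0 < e / (c + 1) by rewrite divr_gt0// ltr_pwDr.
  exists (e / (c + 1)) => // d; rewrite /= /ball_ /= distrC subr0 => de dn.
  have -> : b - d^-1 *: ((f \o shift x) (d *: (1 : R)) - f x)
     = - (d^-1 * (f (x + d) - f x - d * b)).
    by rewrite /GRing.scale/= mulr1 [d + x]addrC; move: (f _) (f x) => u v; field.
  rewrite normrN normrM normfV ler_pdivrMl ?normr_gt0// (le_trans (H d))//.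
  rewrite -[d ^+ 2](real_normK (num_real d)) expr2 mulrA mulrC.
  rewrite ler_wpM2l// (le_trans (ler_wpM2l c0 (ltW de)))//.
  by rewrite mulrA ler_pdivrMr ?ltr_pwDr// mulrC ler_wpM2l ?lerDl// ltW.
have D : derivable f x 1 by apply/cvg_ex; exists b.
by apply: DeriveDef => //; exact: cvg_lim L.
Qed.

Variable n : nat.
Hypothesis n_gt0 : (0 < n)%N.

(* These coefficients maximise the ratio of the first cosine coefficient of the
   kernel to its mass, which becomes cos (pi / (n + 1)) = 1 - O(1/n^2). *)
Definition jackson_angle : R := pi / n.+1%:R.
Definition jackson_coef k : R := sin (k.+1%:R * jackson_angle).

(** The Fejer-Korovkin kernel, as the squared modulus of the sum of a_k exp(ikt): nonnegative and of
    order n - 1. *)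
Definition jackson t : R :=
  (\sum_(k < n) jackson_coef k * cos (k%:R * t)) ^+ 2
  + (\sum_(k < n) jackson_coef k * sin (k%:R * t)) ^+ 2.

Lemma jackson_ge0 t : 0 <= jackson t.
Proof. by rewrite addr_ge0// sqr_ge0. Qed.

Lemma cts_jackson : continuous jackson.
Proof.
have cA : continuous (fun t => \sum_(k < n) jackson_coef k * cos (k%:R * t)) by cts.
have cB : continuous (fun t => \sum_(k < n) jackson_coef k * sin (k%:R * t)) by cts.
by apply: cts_eq (ctsD (ctsM cA cA) (ctsM cB cB)) => t; rewrite -!expr2.
Qed.

Lemma jackson_even t : jackson (- t) = jackson t.
Proof.
rewrite /jackson; congr (_ ^+ 2 + _).
  by apply: eq_bigr => k _; rewrite mulrN cosN.
rewrite -[RHS]sqrrN -sumrN; congr (_ ^+ 2).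
by apply: eq_bigr => k _; rewrite mulrN sinN mulrN.
Qed.

(** With truncated subtraction (k - l) + (l - k) is |k - l|, which keeps the frequency a natural
    number. *)
Lemma jacksonE t : jackson t =
  \sum_(k < n) \sum_(l < n) jackson_coef k * jackson_coef l * cos (((k - l) + (l - k))%N%:R * t).
Proof.
rewrite /jackson !expr2 !mulr_suml -big_split/=; apply: eq_bigr => k _.
rewrite !mulr_sumr -big_split/=; apply: eq_bigr => l _.
have -> : cos (((k - l) + (l - k))%N%:R * t) = cos (k%:R * t - l%:R * t).
  case: (leqP k l) => kl.
    by rewrite (eqP kl) add0n -cosN natrB//; congr cos; ring.
  by rewrite (eqP (ltnW kl)) addn0 natrB ?(ltnW kl)//; congr cos; ring.
by rewrite cosB; ring.
Qed.

Definition jackson_sumsq : R := \sum_(k < n) jackson_coef k ^+ 2.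

Let s2_gt0 : 0 < jackson_sumsq.
Proof.
have th0 : 0 < jackson_angle < pi.
  rewrite divr_gt0 ?pi_gt0//= ltr_pdivrMr// ltr_pMr ?pi_gt0//.
  by rewrite ltr1n ltnS.
rewrite /jackson_sumsq -(prednK n_gt0) big_ord_recl/= ltr_pwDl//.
  by rewrite exprn_gt0// /jackson_coef mul1r sin_gt0_pi.
by rewrite sumr_ge0// => k _; rewrite sqr_ge0.
Qed.

(** The coefficients satisfy a_(k-1) + a_(k+1) = 2 cos(theta) a_k with vanishing boundary values,
    since (n+1) theta = pi; they form an eigenvector of the quadratic form on the left. *)
Let a_prod : \sum_(k < n) jackson_coef k * jackson_coef k.+1 = cos jackson_angle * jackson_sumsq.
Proof.
have H m : 2 * \sum_(k < m) jackson_coef k * jackson_coef k.+1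
    = 2 * cos jackson_angle * (\sum_(k < m) jackson_coef k ^+ 2)
      + sin (m%:R * jackson_angle) * sin (m.+1%:R * jackson_angle).
  elim: m => [|m ih]; first by rewrite !big_ord0 mul0r sin0; ring.
  rewrite !big_ord_recr/= !mulrDr ih /jackson_coef.
  have [_ E] := trig_step m jackson_angle.
  have -> : sin (m.+2%:R * jackson_angle)
    = 2 * cos jackson_angle * sin (m.+1%:R * jackson_angle) - sin (m%:R * jackson_angle) by lra.
  by ring.
have := H n; have -> : n.+1%:R * jackson_angle = pi
  by rewrite /jackson_angle mulrC divfK ?pnatr_eq0.
by rewrite sinpi mulr0 addr0 -/jackson_sumsq; lra.
Qed.

Definition jackson_mass : R := 2 * pi * jackson_sumsq.

Lemma jackson_mass_gt0 : 0 < jackson_mass.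
Proof. by rewrite !mulr_gt0// pi_gt0. Qed.

Let jm0 := jackson_mass_gt0.

Let I_cos_nat j : I (fun t => cos (j%:R * t)) (- pi) pi = if j == 0%N then 2 * pi else 0 :> R.
Proof.
case: j => [|j].
  by rewrite (I_eq _ _ (_ : _ =1 fun=> 1)) ?Icst => [|t]; rewrite ?mul0r ?cos0//=; ring.
by have := @I_cos_full R j.+1 0 isT; under I_eq do rewrite addr0.
Qed.

Lemma I_jackson : I jackson (- pi) pi = jackson_mass.
Proof.
rewrite (I_eq _ _ jacksonE) Isum; last by move=> k _; cts.
rewrite /jackson_mass /jackson_sumsq mulr_sumr; apply: eq_bigr => k _.
rewrite Isum; last by move=> l _; cts.
rewrite (bigD1 k)//= IZ; last by cts.
rewrite I_cos_nat !subnn/= big1 ?addr0; first by rewrite expr2; ring.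
move=> l lk; rewrite IZ; last by cts.
rewrite I_cos_nat; case: eqP => [/eqP|]; rewrite ?mulr0//.
rewrite addn_eq0 !subn_eq0 -eqn_leq => /eqP kl.
by move: lk; rewrite -val_eqE/= kl eqxx.
Qed.

Lemma I_jackson_cos : I (fun t => jackson t * cos t) (- pi) pi = cos jackson_angle * jackson_mass.
Proof.
have E t : jackson t * cos t = \sum_(k < n) \sum_(l < n) 2^-1 * (jackson_coef k * jackson_coef l) *
    (cos ((k.+1 - l + (l - k.+1))%N%:R * t) + cos ((k - l.+1 + (l.+1 - k))%N%:R * t)).
  rewrite jacksonE mulr_suml; apply: eq_bigr => k _.
  rewrite mulr_suml; apply: eq_bigr => l _.
  have D (i j : nat) : cos ((i - j + (j - i))%N%:R * t) = cos (i%:R * t - j%:R * t).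
    case: (leqP i j) => ij.
      by rewrite (eqP ij) add0n -cosN natrB//; congr cos; ring.
    by rewrite (eqP (ltnW ij)) addn0 natrB ?(ltnW ij)//; congr cos; ring.
  rewrite !D -[k.+1%:R]natr1 -[l.+1%:R]natr1.
  have -> : (k%:R + 1) * t - l%:R * t = k%:R * t - l%:R * t + t by ring.
  have -> : k%:R * t - (l%:R + 1) * t = k%:R * t - l%:R * t - t by ring.
  by rewrite [cos (_ + t)]cosD [cos (_ - _ - t)]cosB; field.
rewrite (I_eq _ _ E) Isum; last by move=> k _; cts.
transitivity (\sum_(k < n) \sum_(l < n) 
    (pi * (if l == k.+1 :> nat then jackson_coef k * jackson_coef l else 0)
     + pi * (if k == l.+1 :> nat then jackson_coef k * jackson_coef l else 0))).
  apply: eq_bigr => k _; rewrite Isum; last by move=> l _; cts.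
  apply: eq_bigr => l _; rewrite IZ; last by cts.
  rewrite ID; [|by cts|by cts].
  rewrite !I_cos_nat !addn_eq0 !subn_eq0 -!eqn_leq [_ == l :> nat]eq_sym.
  by case: ifP => _; case: ifP => _; field.
have F (i : nat) : \sum_(l < n) (if l == i.+1 :> nat then jackson_coef i * jackson_coef l else 0) =
    if (i < n)%N then jackson_coef i * jackson_coef i.+1 else 0.
  case: (ltnP i n) => iN.
    have [iN1|] := ltnP i.+1 n.
      rewrite (bigD1 (Ordinal iN1))//= eqxx big1 ?addr0// => l.
      by rewrite -val_eqE/= => /negPf ->.
    move=> nle; have ni : n = i.+1 by apply/eqP; rewrite eqn_leq nle iN.
    have -> : jackson_coef i.+1 = 0.
      rewrite /jackson_coef -[in LHS]ni /jackson_angle mulrC divfK ?pnatr_eq0// sinpi//.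
    rewrite mulr0 big1// => l _; case: eqP => // li.
    by have := ltn_ord l; rewrite li ltnNge nle.
  by rewrite big1// => l _; case: eqP => // li; have := ltn_ord l;
    rewrite li ltnNge (leq_trans iN).
under eq_bigr do rewrite big_split/=.
rewrite big_split/= [X in _ + X]exchange_big/=.
have Fk : \sum_(k < n) \sum_(l < n)
    pi * (if l == k.+1 :> nat then jackson_coef k * jackson_coef l else 0)
    = pi * (cos jackson_angle * jackson_sumsq).
  rewrite -a_prod mulr_sumr; apply: eq_bigr => k _.
  by rewrite -mulr_sumr F ltn_ord.
rewrite Fk (eq_bigr (fun k : 'I_n => \sum_(l < n)
  pi * (if l == k.+1 :> nat then jackson_coef k * jackson_coef l else 0))).
  by rewrite Fk /jackson_mass; ring.
by move=> k _; apply: eq_bigr => l _; rewrite [jackson_coef l * jackson_coef k]mulrC.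
Qed.

Definition jack f x : R := jackson_mass^-1 * I (fun t => jackson t * f (x + t)) (- pi) pi.

Let cJ := cts_jackson.
Let pp : - pi <= pi :> R. Proof. by rewrite ge0_cp// pi_ge0. Qed.

(** Here 9 = 1 + 4^2 / 2: the kernel average of 1 - cos t is 1 - cos theta <= theta^2 / 2, and n
    theta <= pi <= 4. *)
Let jw : jackson_mass^-1 * I (fun t => jackson t * (1 + n%:R ^+ 2 * (1 - cos t))) (- pi) pi <= 9.
Proof.
have E t : jackson t * (1 + n%:R ^+ 2 * (1 - cos t))
  = (1 + n%:R ^+ 2) * jackson t - n%:R ^+ 2 * (jackson t * cos t) by ring.
rewrite (I_eq _ _ E) IB; [|by cts|by cts].
rewrite IZ; last by cts.
rewrite IZ; last by cts.
rewrite I_jackson I_jackson_cos.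
have -> : jackson_mass^-1 * ((1 + n%:R ^+ 2) * jackson_mass
    - n%:R ^+ 2 * (cos jackson_angle * jackson_mass))
  = 1 + n%:R ^+ 2 * (1 - cos jackson_angle).
  by move: (jackson_mass) jackson_mass_gt0 => z z0; field; rewrite gt_eqF.
have N0 : 0 < n.+1%:R :> R by [].
have nth4 : n%:R * jackson_angle <= 4.
  rewrite /jackson_angle mulrA ler_pdivrMr// mulrC ler_pM// ?pi_ge0 ?pi_le4//.
  by rewrite ler_nat.
have th0 : 0 <= jackson_angle by rewrite divr_ge0 ?pi_ge0.
have h := onem_cos_le jackson_angle.
have n2 : 0 <= n%:R ^+ 2 :> R by rewrite sqr_ge0.
have : (n%:R * jackson_angle) ^+ 2 <= 4 ^+ 2.
  by rewrite !expr2 ler_pM// mulr_ge0.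
rewrite exprMn => h2; have h3 := ler_wpM2l n2 h.
have h4 : n%:R ^+ 2 * (jackson_angle ^+ 2 / 2) = n%:R ^+ 2 * jackson_angle ^+ 2 / 2 by ring.
rewrite h4 in h3; move: h2 h3.
by move: (n%:R ^+ 2 * (1 - cos jackson_angle)) (n%:R ^+ 2 * jackson_angle ^+ 2) => X Y; lra.
Qed.

Lemma jack_bound h c : continuous h -> 0 <= c ->
  (forall t, - pi <= t <= pi -> `|h t| <= c * (1 + n%:R ^+ 2 * (1 - cos t))) ->
  `|jackson_mass^-1 * I (fun t => jackson t * h t) (- pi) pi| <= 9 * c.
Proof.
move=> ch c0 hc; rewrite normrM gtr0_norm ?invr_gt0//.
apply: (@le_trans _ _ (jackson_mass^-1
  * (c * I (fun t => jackson t * (1 + n%:R ^+ 2 * (1 - cos t))) (- pi) pi))).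
  rewrite ler_pM2l ?invr_gt0// -IZ; last by cts.
  apply: I_norm_le => //; [by cts|by cts|] => t /hc h1.
  rewrite normrM (ger0_norm (jackson_ge0 t)) mulrCA.
  by rewrite ler_wpM2l// jackson_ge0.
by rewrite mulrCA mulrC ler_wpM2r.
Qed.

Lemma jackB f g x y : continuous f -> continuous g ->
  jack f x - jack g y
  = jackson_mass^-1 * I (fun t => jackson t * (f (x + t) - g (y + t))) (- pi) pi.
Proof.
move=> cf cg; rewrite /jack -mulrBr -IB; [|by cts|by cts].
by congr (_ * _); apply: I_eq => t; rewrite mulrBr.
Qed.

Lemma jack_cst_sub f x : continuous f ->
  jack f x - f x = jackson_mass^-1 * I (fun t => jackson t * (f (x + t) - f x)) (- pi) pi.
Proof.
move=> cf; rewrite -(jackB x 0 cf (@cts_cst R (f x))); congr (_ - _).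
by rewrite /jack IZr// I_jackson mulKf// gt_eqF.
Qed.

Lemma I_jackson_odd : I (fun t => jackson t * t) (- pi) pi = 0.
Proof.
rewrite I_sym; last by cts.
rewrite (I_eq _ _ (_ : _ =1 fun=> 0)) ?Icst ?mul0r// => t.
by rewrite jackson_even; ring.
Qed.

(** A Lipschitz derivative makes the Taylor remainder of F quadratic, uniformly in the base point.
    Averaging it against a kernel of mass one keeps the bound, which replaces differentiation under
    the integral sign. *)
Lemma jack_derive F f c x : antideriv F f -> continuous f ->
  (forall s t, `|f s - f t| <= c * `|s - t|) -> is_derive x (1 : R) (jack F) (jack f x).
Proof.
move=> Ff cf fc; have cF := antideriv_cts Ff.
have c0 : 0 <= c by have := le_trans (normr_ge0 _) (fc 1 0); rewrite subr0 normr1 mulr1.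
apply: (@is_derive_quadratic _ _ _ c) => d.
have -> : jack F (x + d) - jack F x - d * jack f x = jackson_mass^-1 *
    I (fun t => jackson t * (F (x + d + t) - F (x + t) - d * f (x + t))) (- pi) pi.
  rewrite jackB// /jack mulrCA -mulrBr -IZ; last by cts.
  rewrite -IB; [|by cts|by cts].
  by congr (_ * _); apply: I_eq => t; ring.
rewrite normrM gtr0_norm ?invr_gt0// ler_pdivrMl// -I_jackson mulrC -IZ//.
apply: I_norm_le => //; [by cts|by cts|] => t _.
rewrite normrM (ger0_norm (jackson_ge0 t)) mulrC ler_wpM2r ?jackson_ge0//.
have Taylor u v : `|F u - F v - (u - v) * f v| <= c * (u - v) ^+ 2.
  have main p q : p <= q -> forall r, (r = p \/ r = q) ->
      `|F q - F p - (q - p) * f r| <= c * (q - p) ^+ 2.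
    move=> pq r rpq; have [s /andP[ps sq] ->] := antideriv_MVT pq Ff.
    rewrite mulrC -mulrBr normrM ger0_norm ?subr_ge0// expr2 mulrCA.
    rewrite ler_wpM2l ?subr_ge0// (le_trans (fc _ _))// ler_wpM2l//.
    by case: rpq => ->; rewrite ler_norml; apply/andP; split; lra.
  have [uv|/ltW vu] := leP u v.
    rewrite -normrN -(sqrrN (u - v)) opprB.
    by have := main u v uv v (or_intror erefl); congr (`|_| <= _); ring.
  exact: main vu v (or_introl erefl).
have := Taylor (x + d + t) (x + t).
by have -> : x + d + t - (x + t) = d by ring.
Qed.

(** By [jacksonE] the average is a combination of the harmonics of f of frequencies |k - l| <= n -
    1. *)
Lemma jack_trig_polynomial f : continuous f -> periodic f (pi *+ 2) ->
  trig_polynomial n.-1 (jack f).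
Proof.
move=> cf pf.
have -> : jack f = fun x => \sum_(k < n) \sum_(l < n)
    (jackson_mass^-1 * pi * (jackson_coef k * jackson_coef l)) *
    harm 0 f (k - l + (l - k))%N x.
  apply/funext => x; rewrite /jack.
  have E t : jackson t * f (x + t) = \sum_(k < n) \sum_(l < n)
      jackson_coef k * jackson_coef l * (f (x + t) * cos ((k - l + (l - k))%N%:R * t + 0)).
    rewrite jacksonE mulr_suml; apply: eq_bigr => k _; rewrite mulr_suml.
    by apply: eq_bigr => l _; rewrite addr0; ring.
  rewrite (I_eq _ _ E) Isum; last by move=> k _; cts.
  rewrite mulr_sumr; apply: eq_bigr => k _; rewrite Isum; last by move=> l _; cts.
  rewrite mulr_sumr; apply: eq_bigr => l _; rewrite IZ; last by cts.
  rewrite /harm; have := @pi_gt0 R.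
  move: (pi) (I _ _ _) (jackson_mass) jackson_mass_gt0 => p X z z0 p0.
  by field; rewrite !gt_eqF.
apply: trig_polynomial_sum => k _; apply: trig_polynomial_sum => l _.
apply: trig_polynomialZ; apply: trig_polynomial_harm => //.
have kk : (k <= n.-1)%N by rewrite -ltnS (prednK n_gt0).
have ll : (l <= n.-1)%N by rewrite -ltnS (prednK n_gt0).
case: (leqP k l) => kl.
  by rewrite (eqP kl) add0n (leq_trans (leq_subr _ _)).
by rewrite (eqP (ltnW kl)) addn0 (leq_trans (leq_subr _ _)).
Qed.

End Jackson.

(** * A polynomial close to phi together with its primitive *)

Section SmoothApproximation.
Context {R : realType}.
Variables (omega phi : R -> R) (n : nat).
Hypothesis homega : modulus_of_continuity omega.
Hypothesis n_gt0 : (0 < n)%N.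
Hypothesis phiH : class_H omega phi.
Hypothesis phi0 : I phi (- pi) pi = 0.
Implicit Types (f F g : R -> R) (s t x y : R).

Let h : R := n%:R^-1.
Let w : R := omega h.
Let nR : 0 < n%:R :> R. Proof. by rewrite ltr0n. Qed.
Let h0 : 0 < h. Proof. by rewrite invr_gt0. Qed.
Let w0 : 0 <= w. Proof. by rewrite omega_ge0// ltW. Qed.
Let cphi : continuous phi. Proof. exact: class_H_cts phiH. Qed.
Let pphi : periodic phi (pi *+ 2). Proof. by case: phiH => -[]. Qed.
Let phi_near s t : `|phi s - phi t| <= omega `|s - t|.
Proof. by case: phiH => _; apply. Qed.

Let phi_le s t c : `|s - t| <= c -> `|phi s - phi t| <= omega c.
Proof. by move=> st; apply: (le_trans (phi_near s t)); exact: omega_le. Qed.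

Let Phi := prim phi.
Let Phi' : antideriv Phi phi. Proof. exact: primP. Qed.
Let cPhi : continuous Phi. Proof. exact: antideriv_cts Phi'. Qed.
Let Phi2 := prim Phi.
Let Phi2' : antideriv Phi2 Phi. Proof. exact: primP. Qed.

Let pPhi : periodic Phi (pi *+ 2).
Proof.
have A : antideriv (fun x => Phi (x + pi *+ 2) - Phi x) (fun=> 0).
  apply: antideriv_eq (antiderivB (antideriv_shift (pi *+ 2) Phi') Phi') => x.
  by rewrite pphi subrr.
move=> x; have := antideriv_cst A x (- pi).
have -> : - pi + pi *+ 2 = pi :> R by rewrite mulr2n; ring.
by move: phi0; rewrite /I -/Phi; lra.
Qed.

(* Averages over [x - h, x + h], written through primitives. *)
Let sphi x := (2 * h)^-1 * (Phi (x + h) - Phi (x - h)).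
Let sPhi x := (2 * h)^-1 * (Phi2 (x + h) - Phi2 (x - h)).

Let average F f : antideriv F f ->
  antideriv (fun x => (2 * h)^-1 * (F (x + h) - F (x - h)))
            (fun x => (2 * h)^-1 * (f (x + h) - f (x - h))).
Proof.
by move=> Ff; apply: antiderivZ; apply: antiderivB; apply: antideriv_shift.
Qed.

Let average_MVT F f x : antideriv F f ->
  exists2 y, `|y - x| <= h & (2 * h)^-1 * (F (x + h) - F (x - h)) = f y.
Proof.
move=> Ff; have xh : x - h <= x + h by have := h0; lra.
have [y /andP[y1 y2] E] := antideriv_MVT xh Ff; exists y.
  by rewrite ler_norml; apply/andP; split; lra.
by rewrite E; field; rewrite gt_eqF.
Qed.

Let csphi : continuous sphi. Proof. by rewrite /sphi; cts. Qed.

Let psphi : periodic sphi (pi *+ 2).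
Proof.
by move=> x; rewrite /sphi addrAC pPhi [x + _ - h]addrAC pPhi.
Qed.

Let sphi_near x : `|phi x - sphi x| <= w.
Proof.
have [y yx E] := average_MVT x Phi'; rewrite /sphi E distrC; exact: phi_le.
Qed.

Let sphi_modulus x t : `|sphi (x + t) - sphi x| <= omega `|t|.
Proof.
have A : antideriv (fun x => Phi (x + t) - Phi x) (fun x => phi (x + t) - phi x).
  exact: antiderivB (antideriv_shift t Phi') Phi'.
have [y _ E] := average_MVT x A.
have -> : sphi (x + t) - sphi x = phi (y + t) - phi y.
  rewrite -E /sphi; have -> : x + h + t = x + t + h by ring.
  have -> : x - h + t = x + t - h by ring.
  ring.
by apply: phi_le; rewrite addrC addKr.
Qed.

Let sphi_lip s t : `|sphi s - sphi t| <= n%:R * w * `|s - t|.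
Proof.
wlog st : s t / s <= t.
  move=> W; have [/W//|/ltW/W] := leP s t.
  by rewrite distrC [`|t - s|]distrC.
have [y _ E] := antideriv_MVT st (average Phi').
rewrite distrC [`|s - t|]distrC /sphi E normrM ler_wpM2r// normrM.
rewrite gtr0_norm ?invr_gt0 ?mulr_gt0// ler_pdivrMl ?mulr_gt0//.
have -> : 2 * h * (n%:R * w) = 2 * w.
  by rewrite /h; field; rewrite gt_eqF.
apply: (@le_trans _ _ (omega (2 * h))); last by apply: omega_double => //; exact: ltW.
apply: phi_le; have -> : y + h - (y - h) = 2 * h by ring.
by rewrite ger0_norm// mulr_ge0// ltW.
Qed.

(** The average is symmetric, so its error is an averaged second difference of [Phi], that is, s
    times an increment of phi with s <= h. This gains the factor h over [sphi_near]. *)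
Let sPhi_near x : `|Phi x - sPhi x| <= h * w.
Proof.
pose K s := Phi2 (x + s) - Phi2 (x - s) - 2 * s * Phi x.
have KK : antideriv K (fun s => Phi (x + s) + Phi (x - s) - 2 * Phi x).
  have A1 := antideriv_affine 1 x Phi2'; have A2 := antideriv_affine (-1) x Phi2'.
  have A3 := antiderivZ (2 * Phi x) (@antideriv_id R).
  apply: antideriv_eq (antideriv_eql _ (antiderivB (antiderivB A1 A2) A3)) => s /=.
    by rewrite mulN1r !mul1r mulN1r ![_ + x]addrC; ring.
  by rewrite mul1r mulN1r ![_ + x]addrC /K; ring.
have [s /andP[s0 sh]] := antideriv_MVT (ltW h0) KK.
have -> : K 0 = 0 by rewrite /K addr0 subr0; ring.
rewrite !subr0 => E.
have -> : Phi x - sPhi x = - ((2 * h)^-1 * K h).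
  by rewrite /sPhi /K; field; rewrite gt_eqF.
have xs : x <= x + s by lra.
have sx : x - s <= x by lra.
have [y1 /andP[? ?] E1] := antideriv_MVT xs Phi'.
have [y2 /andP[? ?] E2] := antideriv_MVT sx Phi'.
have -> : K h = h * (s * (phi y1 - phi y2)).
  rewrite E mulrC; congr (_ * _).
  have -> : Phi (x + s) + Phi (x - s) - 2 * Phi x
    = (Phi (x + s) - Phi x) - (Phi x - Phi (x - s)) by ring.
  by rewrite E1 E2; ring.
have D : `|phi y1 - phi y2| <= 2 * w.
  apply: (@le_trans _ _ (omega (2 * h))); last by apply: omega_double => //; exact: ltW.
  by apply: phi_le; rewrite ler_norml; apply/andP; split; lra.
rewrite normrN normrM gtr0_norm ?invr_gt0 ?mulr_gt0// ler_pdivrMl ?mulr_gt0//.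
rewrite normrM (gtr0_norm h0) normrM (ger0_norm s0).
have -> : 2 * h * (h * w) = h * (h * (2 * w)) by ring.
by rewrite ler_wpM2l ?(ltW h0)// ler_pM.
Qed.

Let quad t : - pi <= t <= pi -> n%:R ^+ 2 * t ^+ 2 <= 12 * (n%:R ^+ 2 * (1 - cos t)).
Proof.
rewrite -ler_norml => /onem_cos_ge c1.
have : n%:R ^+ 2 * (t ^+ 2 / 12) <= n%:R ^+ 2 * (1 - cos t) by rewrite ler_wpM2l// sqr_ge0.
by rewrite mulrA; lra.
Qed.

Lemma smooth_approx : exists P G : R -> R,
  [/\ trig_polynomial n.-1 P, antideriv G (fun t => phi t - P t),
      forall t, `|phi t - P t| <= 163 * w,
      forall t, `|G t| <= 163 * w / n%:R &
      forall x t, 0 <= t -> `|P (x + t) - P (x - t)| <= 2 * t * n%:R * w].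
Proof.
have cJ := @cts_jackson R n.
have sP' : antideriv sPhi sphi by exact: average.
have csP := antideriv_cts sP'.
have Q' : antideriv (jack n sPhi) (jack n sphi).
  by move=> x; exact: (jack_derive n_gt0 _ sP' csphi sphi_lip).
have n2 : 0 <= n%:R ^+ 2 :> R by rewrite sqr_ge0.
have nt (t : R) : n%:R * `|t| <= (1 + n%:R ^+ 2 * t ^+ 2) / 2.
  rewrite -(real_normK (num_real t)) -exprMn.
  by move: (n%:R * `|t|) => z; have := sqr_ge0 (z - 1); rewrite sqrrB1 -mulr_natl; lra.
(* With X = n^2 (1 - cos t) one has n^2 t^2 <= 12 X and n|t| <= 1/2 + 6 X. The constant 18 = 6 + 12
   is dictated by n|t| + n^2 t^2, needed for the primitive below. *)
have weight t : - pi <= t <= pi -> 1 + n%:R * `|t| <= 18 * (1 + n%:R ^+ 2 * (1 - cos t)).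
  move=> tI; have h1 := nt t; have h2 := quad tI; have h3 := cos_le1 t.
  have : 0 <= n%:R ^+ 2 * (1 - cos t) by rewrite mulr_ge0// subr_ge0.
  move: h1 h2; rewrite -{1}/h.
  by move: (n%:R ^+ 2 * (1 - cos t)) (n%:R ^+ 2 * t ^+ 2) (n%:R * `|t|) => X Y V; lra.
have near1 x : `|sphi x - jack n sphi x| <= 162 * w.
  rewrite distrC jack_cst_sub//; have -> : 162 * w = 9 * (18 * w) by ring.
  apply: jack_bound => //; [by cts|by rewrite mulr_ge0|] => t tI.
  apply: (le_trans (sphi_modulus x t)).
  apply: (le_trans (omega_linear homega n_gt0 (normr_ge0 t))).
  by rewrite -/w mulrAC ler_wpM2r// weight.
have near2 x : `|sPhi x - jack n sPhi x| <= 162 * w / n%:R.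
  rewrite distrC jack_cst_sub//.
  (* The kernel is even, so the linear term can be subtracted for free; the remainder omega(|t|) |t|
     has the extra factor |t| that yields 1/n. *)
  have -> : (jackson_mass n)^-1 * I (fun t => jackson n t * (sPhi (x + t) - sPhi x)) (- pi) pi
    = (jackson_mass n)^-1
      * I (fun t => jackson n t * (sPhi (x + t) - sPhi x - sphi x * t)) (- pi) pi.
    congr (_ * _).
    have E t : jackson n t * (sPhi (x + t) - sPhi x - sphi x * t)
      = jackson n t * (sPhi (x + t) - sPhi x) - sphi x * (jackson n t * t) by ring.
    rewrite (I_eq _ _ E) IB; [|by cts|by cts].
    by rewrite IZ; [rewrite I_jackson_odd mulr0 subr0|cts].
  have -> : 162 * w / n%:R = 9 * (18 * w / n%:R) by ring.
  apply: jack_bound => //; [by cts|by rewrite divr_ge0 ?mulr_ge0// ltW|] => t tI.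
  have D : `|sPhi (x + t) - sPhi x - sphi x * t| <= omega `|t| * `|t|.
    have main p q r : p <= q -> (r = p \/ r = q) ->
        `|sPhi q - sPhi p - sphi r * (q - p)| <= omega `|q - p| * `|q - p|.
      move=> pq rpq; have [s /andP[ps sq] ->] := antideriv_MVT pq sP'.
      rewrite -mulrBl normrM ler_wpM2r//.
      have -> : s = r + (s - r) by ring.
      rewrite (le_trans (sphi_modulus _ _))// omega_le//.
      rewrite [leRHS]ger0_norm ?subr_ge0// ler_norml.
      by case: rpq => ->; apply/andP; split; lra.
    have [t0|/ltW t0] := leP 0 t.
      have xt : x <= x + t by lra.
      by have := main x (x + t) x xt (or_introl erefl); have -> : x + t - x = t by ring.
    have xt : x + t <= x by lra.
    have := main (x + t) x x xt (or_intror erefl).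
    have -> : x - (x + t) = - t by ring.
    rewrite normrN; congr (_ <= _).
    by rewrite -normrN; congr (`|_|); ring.
  apply: (le_trans D).
  apply: (@le_trans _ _ ((1 + n%:R * `|t|) * w * `|t|)).
    by rewrite ler_wpM2r// omega_linear.
  have -> : 18 * w / n%:R * (1 + n%:R ^+ 2 * (1 - cos t))
     = (18 * (1 + n%:R ^+ 2 * (1 - cos t))) * w / n%:R by ring.
  rewrite ler_pdivlMr//.
  have -> : (1 + n%:R * `|t|) * w * `|t| * n%:R = (n%:R * `|t| + (n%:R * `|t|) ^+ 2) * w by ring.
  rewrite ler_wpM2r// exprMn real_normK ?num_real//.
  have h1 := nt t; have h2 := quad tI; have h3 := cos_le1 t.
  have : 0 <= n%:R ^+ 2 * (1 - cos t) by rewrite mulr_ge0// subr_ge0.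
  move: h1 h2.
  by move: (n%:R ^+ 2 * (1 - cos t)) (n%:R ^+ 2 * t ^+ 2) (n%:R * `|t|) => X Y V; lra.
exists (jack n sphi), (fun t => Phi t - jack n sPhi t); split.
- exact: jack_trig_polynomial.
- exact: antiderivB.
- move=> x; have -> : phi x - jack n sphi x = (phi x - sphi x) + (sphi x - jack n sphi x) by ring.
  by rewrite (le_trans (ler_normD _ _))//; have := sphi_near x; have := near1 x; lra.
- move=> x; have -> : Phi x - jack n sPhi x = (Phi x - sPhi x) + (sPhi x - jack n sPhi x) by ring.
  rewrite (le_trans (ler_normD _ _))//; have := sPhi_near x; have := near2 x.
  by rewrite /h; lra.
- move=> x t t0; rewrite jackB// normrM gtr0_norm ?invr_gt0 ?jackson_mass_gt0//.
  rewrite ler_pdivrMl ?jackson_mass_gt0// -I_jackson// mulrC -IZ//.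
  apply: I_norm_le; [by rewrite ge0_cp// pi_ge0|by cts|by cts|] => s _.
  rewrite normrM (ger0_norm (jackson_ge0 _ _)) mulrC ler_wpM2r ?jackson_ge0//.
  apply: (le_trans (sphi_lip _ _)).
  have -> : x + t + s - (x - t + s) = 2 * t by ring.
  by rewrite ger0_norm ?mulr_ge0// mulrC mulrA.
Qed.

End SmoothApproximation.

(** * The upper bound *)

Section UpperBound.
Context {R : realType}.
Implicit Types (f g G phi psi omega T : R -> R) (b c s x : R) (p a : nat -> R) (k m n N : nat).

(** For each frequency k the phase shift in the definition of the derivative is undone by evaluating
    the identity at x - b/k. *)
Lemma psi_beta_derivative_harm psi beta f phi k x :
  is_psi_beta_derivative psi beta f phi -> continuous f -> continuous phi ->
  (0 < k)%N -> psi k%:R != 0 ->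
  harm 0 f k x = psi k%:R * harm (beta * pi / 2) phi k x.
Proof.
move=> [[pf _] [pphi _] _ H] cf cphi k0 pk; set b := beta * pi / 2.
have kn : k%:R != 0 :> R by rewrite pnatr_eq0 -lt0n.
rewrite !harm_fourier// subr0; have := H k (x - b / k%:R) k0.
have -> : k%:R * (x - b / k%:R) = k%:R * x - b by field.
have -> : k%:R * x - b + beta * pi / 2 = k%:R * x by rewrite -/b; ring.
by move=> ->; rewrite mulVKf.
Qed.

Lemma psi_beta_derivativeI psi beta f phi : space_C f -> space_C phi ->
  I phi (- pi) pi = 0 -> (forall k, (0 < k)%N -> psi k%:R != 0) ->
  (forall k x, (0 < k)%N -> harm 0 f k x = psi k%:R * harm (beta * pi / 2) phi k x) ->
  is_psi_beta_derivative psi beta f phi.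
Proof.
move=> [pf cf] [pphi cphi] phi0 pn H; split.
- by split=> //; exact: cts_integrable.
- by split=> //; exact: cts_integrable.
- rewrite fourier_cosE//; under I_eq do rewrite mul0r cos0 mulr1.
  by rewrite phi0 mulr0.
move=> k x k0; set b := beta * pi / 2.
have kn : k%:R != 0 :> R by rewrite pnatr_eq0 -lt0n.
have := H k (x + b / k%:R) k0; rewrite !harm_fourier// subr0 -/b.
have -> : k%:R * (x + b / k%:R) = k%:R * x + b by field.
by rewrite addrK => ->; rewrite mulKf// pn.
Qed.

Lemma truncate_0 p N k : (N < k)%N -> truncate p N k = 0.
Proof. by move=> Nk; rewrite /truncate leqNgt Nk. Qed.

Lemma tail_weight_truncate_end p N : tail_weight (truncate p N) N.+1 = 0.
Proof. by rewrite /tail_weight !truncate_0//; ring. Qed.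

(** The boundary terms of [double_abel] involve the weights at N + 1 and N + 2, which the truncation
    makes zero. *)
Lemma fmean_truncate p b g N x :
  \sum_(1 <= k < N.+1) truncate p N k * harm b g k x
  = \sum_(1 <= m < N.+1) diff2 (truncate p N) m * fmean b g m x.
Proof.
rewrite /fmean double_abel; apply: eq_bigr => k _.
by rewrite [truncate p N N.+1]truncate_0// [truncate p N N.+2]truncate_0//; ring.
Qed.

Lemma fejer_mean_derivative psi beta f phi N x :
  is_psi_beta_derivative psi beta f phi -> continuous f -> continuous phi ->
  (forall k, (0 < k)%N -> psi k%:R != 0) ->
  fejer_mean f N x = pi^-1 / 2 * I f (- pi) pi +
    \sum_(1 <= k < N.+1) truncate (fun k => psi k%:R) N k * harm (beta * pi / 2) phi k x.
Proof.
move=> H cf cphi pn; have [[pf _] _ _ _] := H.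
rewrite fejer_meanE//; congr (_ + _); rewrite /fmean mulr_suml.
rewrite big_nat_cond [RHS]big_nat_cond; apply: eq_bigr => k /andP[/andP[k0 kN] _].
rewrite (psi_beta_derivative_harm _ H)//; last exact: pn.
rewrite /truncate -ltnS kN.
have N0 : N.+1%:R != 0 :> R by rewrite pnatr_eq0.
by move: (N.+1%:R) N0 => M M0; field.
Qed.

(** * Summation of the estimates over the orders of the Fejer means *)

Section WeightedSum.
Variables (p q : nat -> R) (C w : R) (n d : nat).
Hypothesis n_gt0 : (0 < n)%N.
Hypothesis w_ge0 : 0 <= w.
Hypothesis p_ge0 : forall k, (0 < k)%N -> 0 <= p k.
Hypothesis p_decr : forall k, (0 < k)%N -> p k.+1 <= p k.
Hypothesis p_convex : forall k, (0 < k)%N -> 0 <= diff2 p k.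
Hypothesis p_slope : forall k, (0 < k)%N -> k%:R * (p k - p k.+1) <= C * p k.
Hypothesis q_ge0 : forall k, (n <= k)%N -> 0 <= q k.
Hypothesis q_le : forall k, (n <= k)%N -> k%:R * q k <= w.

Let a := truncate p (n + d).

Let a_decr k : (0 < k)%N -> a k.+1 <= a k.
Proof. exact: truncate_decr. Qed.

Let pos j : (n <= j)%N -> (0 < j)%N.
Proof. exact: leq_trans. Qed.

Let tail_weight_ge j : (0 < j)%N -> a j <= tail_weight a j.
Proof. by move=> j0; rewrite lerDl mulr_ge0// subr_ge0 a_decr. Qed.

Let total_weight : \sum_(n <= m < (n + d).+1) (tail_weight a m - tail_weight a m.+1)
  = tail_weight a n.
Proof.
rewrite (@telescope_sumr_eq _ _ _ (fun m => - tail_weight a m)) ?leqW ?leq_addr//.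
  by rewrite tail_weight_truncate_end oppr0 sub0r opprK.
by move=> k _; rewrite opprK addrC.
Qed.

Let weighted_L r : \sum_(n <= m < (n + d).+1)
    (tail_weight a m - tail_weight a m.+1) * \sum_(n <= j < m) r j
  = \sum_(n <= j < (n + d).+1) tail_weight a j.+1 * r j.
Proof.
rewrite -addnS abel_tail addnS tail_weight_truncate_end.
by apply: eq_bigr => j _; rewrite subr0.
Qed.

(** Since (m+1) [diff2 a m] is a difference of [tail_weight], exchanging the sums attaches
    [tail_weight a j.+1] to q j. Its first part is at most p j. In the second, (j+1) q j <= 2w and
    the decrements of [a] telescope to at most p n. The constant part c w receives the total mass,
    at most (C+2) p n. *)
Lemma weighted_sum_le s c : 0 <= s -> 0 <= c ->
  \sum_(n <= m < (n + d).+1) diff2 a m * (m.+1%:R * (s * (\sum_(n <= j < m) q j) + c * w))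
  <= s * (\sum_(n <= j < (n + d).+1) p j * q j + 2 * (p n * w)) + c * (C + 2) * (p n * w).
Proof.
move=> s0 c0.
have E m : diff2 a m * (m.+1%:R * (s * (\sum_(n <= j < m) q j) + c * w))
  = s * ((tail_weight a m - tail_weight a m.+1) * \sum_(n <= j < m) q j)
    + c * w * (tail_weight a m - tail_weight a m.+1).
  by rewrite tail_weightS; ring.
under eq_bigr do rewrite E.
rewrite big_split/= -!mulr_sumr weighted_L total_weight; apply: lerD; last first.
  have : c * w * tail_weight a n <= c * w * ((C + 2) * p n).
    by rewrite ler_wpM2l ?mulr_ge0// truncate_tail_weight.
  by lra.
apply: ler_wpM2l => //.
apply: (@le_trans _ _ (\sum_(n <= j < (n + d).+1) (p j * q j + 2 * w * (a j.+1 - a j.+2)))).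
  rewrite big_nat_cond [leRHS]big_nat_cond; apply: ler_sum => j /andP[/andP[nj _] _].
  have j0 := pos nj; have j1 : (1 : R) <= j%:R by rewrite ler1n.
  rewrite /tail_weight mulrDl; apply: lerD.
    rewrite ler_wpM2r ?q_ge0// (le_trans (a_decr j0))//.
    exact: (truncate_le p_ge0).
  have da : 0 <= a j.+1 - a j.+2 by rewrite subr_ge0 a_decr.
  have jq : (j%:R + 1) * q j <= 2 * w.
    by have h1 := q_le nj; have h2 := q_ge0 nj; have := mulr_ge0 (_ : 0 <= j%:R - 1) h2;
      rewrite subr_ge0 => /(_ j1); lra.
  by rewrite -natr1 mulrAC ler_wpM2r.
rewrite big_split/= lerD2l -mulr_sumr.
rewrite (@telescope_sumr_eq _ _ _ (fun m => - a m.+1)) ?leqW ?leq_addr//; last first.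
  by move=> k _; rewrite opprK addrC.
rewrite -[a _]/(truncate p (n + d) _) truncate_0// oppr0 sub0r opprK.
have : w * a n.+1 <= w * p n.
  rewrite ler_wpM2l// (le_trans (a_decr n_gt0))//; exact: (truncate_le p_ge0).
by lra.
Qed.

(** The inner sums run up to m inclusive, so the exchange attaches [tail_weight a j] to q j with the
    same j, and [tail_weight a j] is at least a j. *)
Lemma weighted_sum_ge s c : 0 <= s -> 0 <= c ->
  s * (\sum_(n.+1 <= j < (n + d).+1) a j * q j) - c * (C + 2) * (p n * w)
  <= \sum_(n <= m < (n + d).+1)
       diff2 a m * (m.+1%:R * (s * (\sum_(n.+1 <= j < m.+1) q j) - c * w)).
Proof.
move=> s0 c0.
have E m : diff2 a m * (m.+1%:R * (s * (\sum_(n.+1 <= j < m.+1) q j) - c * w))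
  = s * ((tail_weight a m - tail_weight a m.+1) * \sum_(n <= j < m) q j.+1)
    - c * w * (tail_weight a m - tail_weight a m.+1).
  by rewrite tail_weightS big_add1/=; ring.
under [leRHS]eq_bigr do rewrite E.
rewrite sumrB/= -!mulr_sumr weighted_L total_weight; apply: lerB; last first.
  have : c * w * tail_weight a n <= c * w * ((C + 2) * p n).
    by rewrite ler_wpM2l ?mulr_ge0// truncate_tail_weight.
  by lra.
apply: ler_wpM2l => //.
rewrite [leRHS]big_nat_recr ?leq_addr//= tail_weight_truncate_end mul0r addr0 big_add1/=.
rewrite big_nat_cond [leRHS]big_nat_cond; apply: ler_sum => j /andP[/andP[nj _] _].
by rewrite ler_wpM2r ?q_ge0 ?leqW// tail_weight_ge.
Qed.

End WeightedSum.

Lemma normC_le f c : (forall x, `|f x| <= c) -> normC f <= c.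
Proof.
move=> fc; apply: ge_sup; first by exists `|f 0|, 0.
by move=> _ [x _ <-].
Qed.

Lemma normC_ge f x : space_C f -> `|f x| <= normC f.
Proof.
move=> [pf cf]; have [M M0 fM] := periodic_bounded cf pf.
by apply: ub_le_sup; [exists M => _ [y _ <-]|exists x].
Qed.

Lemma sequence_limit_le (u v : nat -> R) (l l' B : R) n :
  u N @[N --> \oo] --> l -> v N @[N --> \oo] --> l' ->
  (forall N, (n <= N)%N -> `|u N - v N| <= B) -> `|l - l'| <= B.
Proof.
move=> ul vl H.
have L : `|u N - v N| @[N --> \oo] --> `|l - l'| by apply: cvg_norm; exact: cvgB.
apply: (ler_cvg_to L (cvg_cst B)); exists n => // N /= nN; exact: H.
Qed.

Lemma truncate_cvg p k : (0 < k)%N -> truncate p N k @[N --> \oo] --> p k.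
Proof.
move=> k0; have L : p k * (1 - k%:R * N.+1%:R^-1) @[N --> \oo] --> p k * (1 - k%:R * 0).
  apply: cvgM; first exact: cvg_cst.
  apply: cvgB; first exact: cvg_cst.
  apply: cvgM; first exact: cvg_cst.
  exact: (@cvg_harmonic R).
rewrite mulr0 subr0 mulr1 in L; apply: cvg_trans L; apply: near_eq_cvg.
by exists k => // N /= kN; rewrite /truncate kN.
Qed.

Lemma cvg_sum_seq (r : seq nat) (F : nat -> nat -> R) (l : nat -> R) :
  (forall k, k \in r -> F k N @[N --> \oo] --> l k) ->
  \sum_(k <- r) F k N @[N --> \oo] --> \sum_(k <- r) l k.
Proof.
elim: r => [_|k r ih H].
  by under eq_fun do rewrite big_nil; rewrite big_nil; exact: cvg_cst.
rewrite big_cons; under eq_fun do rewrite big_cons.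
apply: cvgD; first by apply: H; rewrite mem_head.
by apply: ih => j jr; apply: H; rewrite inE jr orbT.
Qed.

End UpperBound.

(** * Approximation of a function of the class *)

Section BestApproximationUpper.
Context {R : realType}.
Implicit Types (f g G phi psi omega T P : R -> R) (b c s x t : R) (k m n N j : nat).

Lemma class_M0_sequence psi : class_M0 psi -> exists C : R,
  [/\ 0 <= C, forall k, (0 < k)%N -> 0 < psi k%:R,
      forall k, (0 < k)%N -> psi k.+1%:R <= psi k%:R,
      forall k, (0 < k)%N -> 0 <= diff2 (fun k => psi k%:R) k &
      forall k, (0 < k)%N -> k%:R * (psi k%:R - psi k.+1%:R) <= C * psi k%:R].
Proof.
move=> M0; have [cM _] := M0; have [cp p0 cv lim0] := cM.
have [C C1 slope] := class_M0_difference M0.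
have k1 k : (0 < k)%N -> (1 : R) <= k%:R by rewrite ler1n.
exists C; split=> // [||k k0|k k0].
- by lra.
- by move=> k /k1; exact: p0.
- by apply: class_M_nonincreasing => //; [exact: k1|rewrite ler_nat].
have h1 : k%:R <= k.+1%:R :> R by rewrite ler_nat.
have h2 : k.+1%:R <= k.+2%:R :> R by rewrite ler_nat.
have := convex_three_points cv (k1 _ k0) h1 h2.
rewrite /diff2 -[k.+2%:R]natr1 -[k.+1%:R]natr1.
have -> : k%:R + 1 + 1 - k%:R = 2 :> R by ring.
have -> : k%:R + 1 + 1 - (k%:R + 1) = 1 :> R by ring.
have -> : k%:R + 1 - k%:R = 1 :> R by ring.
by lra.
Qed.

(** The increments of phi are at most omega(2t), covered by [omega_integral_upper]. Those of P are
    linear in t, so after division by t they integrate to at most 2 omega(1/n). *)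
Lemma difference_integral_le omega phi P n m x :
  modulus_of_continuity omega -> (0 < n)%N -> (n <= m)%N ->
  class_H omega phi -> continuous P ->
  (forall x t, 0 <= t -> `|P (x + t) - P (x - t)| <= 2 * t * n%:R * omega n%:R^-1) ->
  `|I (fun t => ((phi (x + t) - P (x + t)) - (phi (x - t) - P (x - t))) * cut_inv m%:R^-1 t)
      m%:R^-1 n%:R^-1|
  <= \sum_(n <= j < m) omega j%:R^-1 / j%:R + 4 * omega n%:R^-1.
Proof.
move=> homega n0 nm phiH cP PP; have cphi := class_H_cts phiH.
have nR : 0 < n%:R :> R by rewrite ltr0n.
have m0 : (0 < m)%N by exact: leq_trans nm.
have mR : 0 < m%:R :> R by rewrite ltr0n.
have e0 : 0 < m%:R^-1 :> R by rewrite invr_gt0.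
have mn : m%:R^-1 <= n%:R^-1 :> R by rewrite lef_pV2 ?posrE// ler_nat.
have w0 : 0 <= omega n%:R^-1 by rewrite omega_ge0// invr_ge0 ltW.
have cc := cts_cut_inv e0.
have cw : continuous (fun t => omega `|2 * t|).
  apply: (@cts_comp _ (fun t => omega `|t|) (fun t => 2 * t)); first exact: cts_omega.
  by cts.
apply: (@le_trans _ _ (I (fun t => omega `|2 * t| * cut_inv m%:R^-1 t + 2 * n%:R * omega n%:R^-1)
   m%:R^-1 n%:R^-1)).
  apply: I_norm_le => //; [by cts|by cts|] => t /andP[mt _].
  have t0 : 0 < t by exact: lt_le_trans mt.
  rewrite normrM [`|cut_inv _ _|]ger0_norm ?cut_inv_ge0// cut_invE// ler_pdivrMr// mulrDl.
  rewrite divfK ?gt_eqF//.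
  have -> : phi (x + t) - P (x + t) - (phi (x - t) - P (x - t))
    = (phi (x + t) - phi (x - t)) - (P (x + t) - P (x - t)) by ring.
  apply: (le_trans (ler_normB _ _)); apply: lerD.
    apply: (le_trans (phiH.2 _ _)).
    by have -> : x + t - (x - t) = 2 * t by ring.
  by apply: (le_trans (PP x t (ltW t0))); lra.
rewrite ID; [|by cts|by cts].
have := omega_integral_upper homega n0 nm.
have : I (fun=> 2 * n%:R * omega n%:R^-1) m%:R^-1 n%:R^-1 <= 2 * omega n%:R^-1.
  rewrite Icst; have : 2 * n%:R * omega n%:R^-1 * n%:R^-1 = 2 * omega n%:R^-1.
    by field; rewrite gt_eqF.
  have : 0 <= 2 * n%:R * omega n%:R^-1 * m%:R^-1.
    by rewrite mulr_ge0 ?(ltW e0)// !mulr_ge0// ltW.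
  by rewrite mulrBr; lra.
by lra.
Qed.

Lemma sin_pi_le1 b : `|sin b| / pi <= 1 :> R.
Proof.
have p0 : 0 < pi :> R := @pi_gt0 R.
rewrite ler_pdivrMr// mul1r (le_trans (sin_max b))//.
by have := @pi_ge2 R; lra.
Qed.

(** The constant is 5709 = 35 times 163, from [fmean_near_conjugate] applied to phi - P, plus 4 from
    [difference_integral_le]. *)
Lemma fmean_upper omega phi b n : modulus_of_continuity omega -> (0 < n)%N ->
  class_H omega phi -> I phi (- pi) pi = 0 ->
  exists2 P, trig_polynomial n.-1 P & forall m x, (n <= m)%N ->
    `|fmean b (fun t => phi t - P t) m x|
    <= m.+1%:R * (`|sin b| / pi * (\sum_(n <= j < m) omega j%:R^-1 / j%:R)
                  + 5709 * omega n%:R^-1).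
Proof.
move=> homega n0 phiH phi0; have cphi := class_H_cts phiH.
have [P [G [tP GG gA GA PP]]] := smooth_approx homega n0 phiH phi0.
have cP := cts_trig_polynomial tP.
exists P => // m x nm; pose g t := phi t - P t.
have cg : continuous g by rewrite /g; cts.
have p0 : 0 < pi :> R := @pi_gt0 R.
have nR : 0 < n%:R :> R by rewrite ltr0n.
have w0 : 0 <= omega n%:R^-1 by rewrite omega_ge0// invr_ge0 ltW.
have h1 := fmean_near_conjugate b x n0 nm cg GG gA GA.
have h2 := difference_integral_le x homega n0 nm phiH cP PP.
have s0 : 0 <= `|sin b| / pi :> R by rewrite divr_ge0// ltW.
have M0 : 0 < m.+1%:R :> R by [].
rewrite -ler_pdivrMl// mulrC -[X in _ * X](gtr0_norm (_ : 0 < m.+1%:R^-1)) ?invr_gt0// -normrM.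
move: h1 h2; rewrite -/g; set J := I _ _ _; set F := fmean b g m x / m.+1%:R => h1 h2.
have -> : F = (F + sin b / pi * J) - sin b / pi * J by ring.
apply: (le_trans (ler_normB _ _)).
have : `|sin b / pi * J|
  <= `|sin b| / pi * (\sum_(n <= j < m) omega j%:R^-1 / j%:R) + 4 * omega n%:R^-1.
  rewrite normrM normrM normfV (gtr0_norm p0).
  apply: (le_trans (ler_wpM2l s0 h2)); rewrite mulrDr lerD2l.
  by rewrite ler_piMl ?mulr_ge0// sin_pi_le1.
by lra.
Qed.

Lemma best_approx_upper psi omega beta f n C B :
  modulus_of_continuity omega -> (0 < n)%N -> class_CH psi beta omega f -> 0 <= C ->
  (forall k, (0 < k)%N -> 0 < psi k%:R) ->
  (forall k, (0 < k)%N -> psi k.+1%:R <= psi k%:R) ->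
  (forall k, (0 < k)%N -> 0 <= diff2 (fun k => psi k%:R) k) ->
  (forall k, (0 < k)%N -> k%:R * (psi k%:R - psi k.+1%:R) <= C * psi k%:R) ->
  (forall N, (n <= N)%N -> `|sin (beta * pi / 2)| / pi *
     (\sum_(n <= j < N) psi j%:R * (omega j%:R^-1 / j%:R)) <= B) ->
  (best_approx n f <= (B + (2 + 5709 * (C + 2)) * (psi n%:R * omega n%:R^-1))%:E)%E.
Proof.
move=> homega n0 [[pf cf] [phi D phiH]] C0 p0 pdecr pconv pslope HB.
have cphi := class_H_cts phiH; have [[pphi _] _] := phiH.
set b := beta * pi / 2 in HB *.
have pi0 : 0 < pi :> R := @pi_gt0 R.
have phi0 : I phi (- pi) pi = 0.
  have [_ _ + _] := D; rewrite fourier_cosE//; under I_eq do rewrite mul0r cos0 mulr1.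
  by move=> /eqP; rewrite mulf_eq0 invr_eq0 gt_eqF//= => /eqP.
have pn k : (0 < k)%N -> psi k%:R != 0 by move=> k0; rewrite gt_eqF// p0.
have p0' k : (0 < k)%N -> 0 <= psi k%:R by move=> /p0/ltW.
have [P tP Pm] := fmean_upper b homega n0 phiH phi0.
have cP := cts_trig_polynomial tP; have pP := periodic_trig_polynomial tP.
pose g t := phi t - P t.
have cg : continuous g by rewrite /g; cts.
have pg : periodic g (pi *+ 2) by move=> t; rewrite /g pphi pP.
pose p k := psi k%:R : R.
(* The approximating polynomial keeps everything of order below n: the harmonics of P, which vanish
   from order n on, and the Fejer means of g of order m < n. [TN] is the same expression with
   truncated weights; only the Fejer means with m >= n separate it from the Fejer mean of f. *)
pose T x := pi^-1 / 2 * I f (- pi) pi + (\sum_(1 <= k < n) p k * harm b P k x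
  + \sum_(1 <= m < n) diff2 p m * fmean b g m x).
pose TN N x := pi^-1 / 2 * I f (- pi) pi + (\sum_(1 <= k < n) truncate p N k * harm b P k x
  + \sum_(1 <= m < n) diff2 (truncate p N) m * fmean b g m x).
have tT : trig_polynomial n.-1 T.
  apply: trig_polynomialD; first exact: trig_polynomial_cst.
  apply: trig_polynomialD; apply: trig_polynomial_sum => k;
    rewrite mem_index_iota => /andP[k0 kn]; apply: trig_polynomialZ.
    by apply: trig_polynomial_harm => //; rewrite -ltnS prednK.
  apply: trig_polynomial_sum => j; rewrite mem_index_iota => /andP[j0 jk].
  apply: trig_polynomialZ; apply: trig_polynomial_harm => //.
  by rewrite -ltnS prednK// (leq_ltn_trans _ kn)// -ltnS.
have TT x : TN N x @[N --> \oo] --> T x.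
  apply: cvgD; first exact: cvg_cst.
  apply: cvgD; apply: cvg_sum_seq => k; rewrite mem_index_iota => /andP[k0 kn];
    apply: cvgM; try exact: cvg_cst; first exact: truncate_cvg.
  apply: cvgD; last exact: truncate_cvg.
  apply: cvgB; first exact: truncate_cvg.
  by apply: cvgM; [exact: cvg_cst|exact: truncate_cvg].
pose q j : R := omega j%:R^-1 / j%:R.
have w0 : 0 <= omega n%:R^-1 by rewrite omega_ge0// invr_ge0.
have q0 j : (n <= j)%N -> 0 <= q j.
  by move=> nj; rewrite divr_ge0// omega_ge0// invr_ge0.
have qw j : (n <= j)%N -> j%:R * q j <= omega n%:R^-1.
  move=> nj; have jR : 0 < j%:R :> R by rewrite ltr0n (leq_trans n0).
  rewrite /q mulrC divfK ?gt_eqF// omega_le// ?invr_ge0 ?(ltW jR)//.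
  by have nR : 0 < n%:R :> R; rewrite ?ltr0n// lef_pV2 ?posrE// ler_nat.
have s0 : 0 <= `|sin b| / pi :> R by rewrite divr_ge0// ltW.
have main N x : (n <= N)%N -> `|fejer_mean f N x - TN N x|
    <= B + (2 + 5709 * (C + 2)) * (psi n%:R * omega n%:R^-1).
  move=> nN; rewrite (fejer_mean_derivative _ _ D)// -/b -/p.
  have -> : \sum_(1 <= k < N.+1) truncate p N k * harm b phi k x
     = \sum_(1 <= k < N.+1) truncate p N k * harm b P k x
       + \sum_(1 <= k < N.+1) truncate p N k * harm b g k x.
    rewrite -big_split/=; apply: eq_bigr => k _; rewrite -mulrDr -harmD//.
    by congr (_ * harm b _ k x); apply/funext => t; rewrite /g addrC subrK.
  have -> : \sum_(1 <= k < N.+1) truncate p N k * harm b P k x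
     = \sum_(1 <= k < n) truncate p N k * harm b P k x.
    rewrite (big_cat_nat _ (n := n))//=; last exact: leqW.
    rewrite [X in _ + X]big_nat_cond [X in _ + X]big1 ?addr0//.
    move=> k /andP[/andP[nk _] _]; rewrite (harm_trig_polynomial _ _ tP) ?mulr0//.
    by rewrite prednK.
  rewrite fmean_truncate.
  have -> : \sum_(1 <= m < N.+1) diff2 (truncate p N) m * fmean b g m x
     = \sum_(1 <= m < n) diff2 (truncate p N) m * fmean b g m x
     + \sum_(n <= m < N.+1) diff2 (truncate p N) m * fmean b g m x.
    by rewrite (big_cat_nat _ (n := n))//=; exact: leqW.
  rewrite /TN !addrA.
  have E (c1 c2 c3 c4 : R) : c1 + c2 + c3 + c4 - (c1 + c2 + c3) = c4 by ring.
  rewrite E; apply: (le_trans (ler_norm_sum _ _ _)).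
  apply: (@le_trans _ _ (\sum_(n <= m < N.+1) diff2 (truncate p N) m * (m.+1%:R *
      (`|sin b| / pi * (\sum_(n <= j < m) q j) + 5709 * omega n%:R^-1)))).
    rewrite big_nat_cond [leRHS]big_nat_cond; apply: ler_sum => m /andP[/andP[nm _] _].
    have d0 : 0 <= diff2 (truncate p N) m.
      by apply: truncate_diff2_ge0 => //; exact: leq_trans nm.
    by rewrite normrM (ger0_norm d0) ler_wpM2l// Pm.
  have := @weighted_sum_le R p q C (omega n%:R^-1) n (N - n) n0 w0 p0' pdecr pslope q0 qw
    (`|sin b| / pi) 5709 s0.
  rewrite subnKC// => /(_ (ler0n _ _)); move/le_trans; apply.
  have hB := HB N.+1 (leqW nN).
  have d0 : 0 <= p n * omega n%:R^-1 by rewrite mulr_ge0// p0'.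
  have h2 : `|sin b| / pi * (2 * (p n * omega n%:R^-1)) <= 2 * (p n * omega n%:R^-1).
    by apply: ler_piMl; [exact: mulr_ge0|exact: sin_pi_le1].
  rewrite mulrDr; move: hB h2; rewrite -/(p n) /q /p; lra.
have fT x : `|f x - T x| <= B + (2 + 5709 * (C + 2)) * (psi n%:R * omega n%:R^-1).
  apply: (@sequence_limit_le R (fun N => fejer_mean f N x) (fun N => TN N x) _ _ _ n).
  - exact: fejer_mean_cvg.
  - exact: TT.
  - by move=> N nN; exact: main.
apply: (@le_trans _ _ (normC (f \- T))%:E).
  by apply: ereal_inf_lbound; exists T.
by rewrite lee_fin; apply: normC_le.
Qed.

End BestApproximationUpper.

(** * The extremal function and the lower bound *)

Section Extremal.
Context {R : realType}.
Variables (omega : R -> R) (n : nat).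
Hypothesis homega : modulus_of_continuity omega.
Hypothesis n_gt0 : (0 < n)%N.
Implicit Types (f g h : R -> R) (b s t x u v : R) (k m j : nat).

Let nR : 0 < n%:R :> R. Proof. by rewrite ltr0n. Qed.
Let nn : n%:R != 0 :> R. Proof. by rewrite gt_eqF. Qed.
Let w := omega n%:R^-1.
Let w0 : 0 <= w. Proof. by rewrite omega_ge0// invr_ge0 ltW. Qed.
Let omega0 : omega 0 = 0. Proof. by case: homega. Qed.
Let delta : R := pi / n%:R.

(** The factor 1/2 is needed across 0, where the two values add up: (omega(u) + omega(v)) / 2 <=
    omega(u + v) by monotonicity. *)
Definition odd_modulus s : R := if 0 <= s then omega s / 2 else - (omega (- s) / 2).

Lemma odd_modulus_ge0 s : 0 <= s -> odd_modulus s = omega s / 2.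
Proof. by rewrite /odd_modulus => ->. Qed.

Lemma odd_modulusN s : odd_modulus (- s) = - odd_modulus s.
Proof.
rewrite /odd_modulus oppr_ge0 opprK; case: (ltrgt0P s) => s0 //; first by rewrite opprK.
by rewrite s0 oppr0 omega0 mul0r oppr0.
Qed.

Lemma odd_modulus_dist s t : `|odd_modulus s - odd_modulus t| <= omega `|s - t|.
Proof.
have same u v : 0 <= u -> u <= v -> `|odd_modulus u - odd_modulus v| <= omega `|u - v|.
  move=> u0 uv; rewrite !odd_modulus_ge0 ?(le_trans u0)//.
  have h1 := omega_le homega u0 uv; have vu : 0 <= v - u by rewrite subr_ge0.
  have h2 := omega_add homega u0 vu; have h3 := omega_ge0 homega vu.
  rewrite distrC [`|u - v|]distrC [`|v - u|]ger0_norm//.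
  have E : u + (v - u) = v by ring.
  by rewrite E in h2; rewrite ger0_norm; lra.
have opposite u v : 0 <= u -> 0 <= v -> `|odd_modulus u + odd_modulus v| <= omega (u + v).
  move=> u0 v0; rewrite !odd_modulus_ge0//.
  have h1 := omega_ge0 homega u0; have h2 := omega_ge0 homega v0.
  have uv1 : u <= u + v by lra.
  have uv2 : v <= u + v by lra.
  have := omega_le homega u0 uv1; have := omega_le homega v0 uv2.
  by rewrite ger0_norm; lra.
wlog st : s t / s <= t.
  move=> W; have [/W//|/ltW/W] := leP s t.
  by rewrite distrC [`|t - s|]distrC.
have [s0|/ltW s0] := leP 0 s; first exact: same.
have sN : 0 <= - s by rewrite oppr_ge0.
have [t0|/ltW t0] := leP 0 t.
  have := opposite (- s) t sN t0; rewrite odd_modulusN distrC [`|s - t|]distrC.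
  have -> : `|t - s| = - s + t by rewrite ger0_norm ?subr_ge0// addrC.
  by rewrite addrC.
have tN : 0 <= - t by rewrite oppr_ge0.
have ts : - t <= - s by rewrite lerN2.
have := same (- t) (- s) tN ts; rewrite !odd_modulusN !opprK.
by rewrite addrC [- t + s]addrC.
Qed.

Definition extremal t : R := odd_modulus (sin (n%:R * t) / n%:R).

Lemma sin_lip u v : `|sin u - sin v| <= `|u - v| :> R.
Proof.
wlog uv : u v / u <= v.
  move=> W; have [/W//|/ltW/W] := leP u v.
  by rewrite distrC [`|v - u|]distrC.
have [c _ E] := antideriv_MVT uv (@antideriv_cos R).
by rewrite distrC E normrM [`|u - v|]distrC ler_piMl// cos_max.
Qed.

Lemma extremal_dist s t : `|extremal s - extremal t| <= omega `|s - t|.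
Proof.
apply: (le_trans (odd_modulus_dist _ _)); apply: omega_le => //.
rewrite -mulrBl normrM normfV (gtr0_norm nR) ler_pdivrMr//.
by apply: (le_trans (sin_lip _ _)); rewrite -mulrBr normrM gtr0_norm// mulrC.
Qed.

Lemma extremal_cts : continuous extremal.
Proof.
move=> x; apply/cvgrPdist_le => e e0.
have /cvgrPdist_le/(_ _ e0)[d /= d0 dP] := @cts_omega R omega homega 0.
exists d => //= y xy; apply: (le_trans (extremal_dist _ _)).
have := dP (x - y); rewrite /ball_/= sub0r normrN normr0 omega0 sub0r normrN => /(_ xy).
by rewrite ger0_norm// omega_ge0.
Qed.

Lemma extremalN t : extremal (- t) = - extremal t.
Proof. by rewrite /extremal mulrN sinN mulNr odd_modulusN. Qed.

Lemma extremal_alternating t : extremal (t + delta) = - extremal t.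
Proof.
rewrite /extremal; have -> : n%:R * (t + delta) = n%:R * t + pi by rewrite /delta; field.
by rewrite sinDpi mulNr odd_modulusN.
Qed.

Let delta_period : delta *+ n.*2 = pi *+ 2.
Proof.
rewrite -mul2n mulrnA [delta *+ 2]mulr2n -mulr_natr /delta [pi *+ 2]mulr2n.
by move: (n%:R) nn => N N0; field.
Qed.

Lemma alternating_periodic f : (forall t, f (t + delta) = - f t) -> periodic f (pi *+ 2).
Proof.
move=> fa x; rewrite -delta_period.
have : alternating f delta by [].
move=> /alternatingn/(_ n.*2 x) ->.
by rewrite -mul2n exprM sqrrN !expr1n mul1r.
Qed.

Lemma extremal_periodic : periodic extremal (pi *+ 2).
Proof. by apply: alternating_periodic; exact: extremal_alternating. Qed.

Lemma extremal_class_H : class_H omega extremal.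
Proof.
split; last exact: extremal_dist.
by split; [exact: extremal_periodic|exact: extremal_cts].
Qed.

Lemma extremal_le t : `|extremal t| <= w / 2.
Proof.
have s1 : `|sin (n%:R * t) / n%:R| <= n%:R^-1.
  by rewrite normrM normfV (gtr0_norm nR) ler_piMl ?invr_ge0 ?(ltW nR)// sin_max.
move: s1; rewrite /extremal; move: (_ / _) => s.
rewrite /odd_modulus; case: (leP 0 s) => s0.
  rewrite (ger0_norm s0) => s1; have := omega_le homega s0 s1; have := omega_ge0 homega s0.
  by rewrite -/w => h1 h2; rewrite ger0_norm; lra.
rewrite (ltr0_norm s0) normrN => s1; have sN : 0 <= - s by rewrite oppr_ge0 ltW.
have := omega_le homega sN s1; have := omega_ge0 homega sN.
by rewrite -/w => h1 h2; rewrite ger0_norm; lra.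
Qed.

Lemma extremal_mean0 : I extremal (- pi) pi = 0.
Proof.
rewrite I_sym; last exact: extremal_cts.
rewrite (I_eq _ _ (_ : _ =1 fun=> 0)) ?Icst ?mul0r// => t.
by rewrite extremalN subrr.
Qed.

(* The primitive made antiperiodic by an additive constant is at most half its
   increment over one antiperiod. *)
Lemma extremal_primitive : exists2 G, antideriv G extremal &
  forall t, `|G t| <= w / n%:R.
Proof.
have PP := primP extremal_cts; set F := prim extremal in PP.
have S : antideriv (fun t => F (t + delta) + F t) (fun=> 0).
  apply: antideriv_eq (antiderivD (antideriv_shift delta PP) PP) => t.
  by rewrite extremal_alternating addNr.
pose c := (F delta + F 0) / 2.
have FE t : F (t + delta) + F t = 2 * c.
  by have := antideriv_cst S t 0; rewrite add0r /c => ->; field.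
exists (fun t => F t - c).
  by apply: antideriv_eq (antiderivB PP (antideriv_cst0 c)) => t; rewrite subr0.
move=> t; have d0 : 0 < delta by rewrite divr_gt0 ?pi_gt0.
have td : t <= t + delta by lra.
have [s _ E] := antideriv_MVT td PP.
have -> : F t - c = - ((extremal s * delta) / 2).
  have -> : extremal s * delta = F (t + delta) - F t by rewrite E; ring.
  by have := FE t; lra.
rewrite normrN normrM [`|_ * delta|]normrM (gtr0_norm d0) [`|2^-1|]gtr0_norm//.
have : `|extremal s| * delta <= w / 2 * (4 / n%:R).
  apply: ler_pM => //; [exact: ltW|exact: extremal_le|].
  by rewrite /delta ler_pM2r ?invr_gt0// pi_le4.
have -> : w / 2 * (4 / n%:R) = 2 * (w / n%:R) by field.
by lra.
Qed.

(* Antiperiodicity turns the recurrence into (2 + 2 cos (k pi / n)) h = 0. *)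
Lemma alternating_harmonic k h x : (k < n)%N ->
  (forall y, h (y + delta) = - h y) ->
  (forall y, h (y + delta + delta) + h y = 2 * cos (k%:R * delta) * h (y + delta)) ->
  h x = 0.
Proof.
move=> kn ha hr; have := hr x; rewrite !ha opprK => E.
have d0 : 0 < delta by rewrite divr_gt0 ?pi_gt0.
have kd0 : 0 <= k%:R * delta by rewrite mulr_ge0// ltW.
have kdpi : k%:R * delta < pi.
  have -> : k%:R * delta = k%:R / n%:R * pi by rewrite /delta; ring.
  by rewrite gtr_pMl ?pi_gt0// ltr_pdivrMr// mul1r ltr_nat.
have k1 : - 1 < cos (k%:R * delta).
  by rewrite -cospi ltr_cos// in_itv/= ?kd0 ?pi_ge0 ?lexx//= ltW.
have : (1 + cos (k%:R * delta)) * h x = 0 by lra.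
by move/eqP; rewrite mulf_eq0 => /orP[/eqP c1|/eqP//]; lra.
Qed.

Lemma harm_step b g k y : continuous g -> periodic g (pi *+ 2) ->
  harm b g k (y + delta + delta) + harm b g k y
  = 2 * cos (k%:R * delta) * harm b g k (y + delta).
Proof.
move=> cg pg; rewrite !harm_fourier//.
set A := fourier_cos g k; set B := fourier_sin g k.
have -> : k%:R * (y + delta + delta) - b = (k%:R * (y + delta) - b) + k%:R * delta by ring.
have -> : k%:R * y - b = (k%:R * (y + delta) - b) - k%:R * delta by ring.
by move: (k%:R * (y + delta) - b) => u; rewrite cosD cosB sinD sinB; ring.
Qed.

Lemma harm_extremal_alternating b k x :
  harm b extremal k (x + delta) = - harm b extremal k x.
Proof.
have ce := extremal_cts.
rewrite /harm -mulrN -IN; last by cts.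
congr (_ * _); apply: I_eq => t.
have -> : x + delta + t = x + t + delta by ring.
by rewrite extremal_alternating mulNr.
Qed.

Lemma harm_extremal0 b k x : (k < n)%N -> harm b extremal k x = 0.
Proof.
move=> kn; apply: (@alternating_harmonic k (harm b extremal k)) => // y.
  exact: harm_extremal_alternating.
by apply: harm_step; [exact: extremal_cts|exact: extremal_periodic].
Qed.

Lemma fmean_extremal0 b m x : (m < n)%N -> fmean b extremal m x = 0.
Proof.
move=> mn; rewrite /fmean big_nat_cond big1// => k /andP[/andP[_ km] _].
by rewrite harm_extremal0 ?mulr0// (leq_trans km).
Qed.

Let sgn j : R := (- 1) ^+ j.

(** As a function of a translation x, the sum changes sign under x + pi/n: the index moves by one,
    and the last term wraps around because 2n steps make a full period with an even number of signs.
    Each cosine obeys the recurrence of [alternating_harmonic]. *)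
Lemma alternating_sum_cos k d : (k < n)%N ->
  \sum_(j < n.*2) (- 1) ^+ j * cos (k%:R * (delta *+ j) + d) = 0.
Proof.
move=> kn; pose h x := \sum_(j < n.*2) sgn j * cos (k%:R * (x + delta *+ j) + d).
have -> : \sum_(j < n.*2) (- 1) ^+ j * cos (k%:R * (delta *+ j) + d) = h 0.
  by apply: eq_bigr => j _; rewrite add0r.
apply: (@alternating_harmonic k h) => // y; last first.
  rewrite /h -big_split/= mulr_sumr; apply: eq_bigr => j _.
  have -> : k%:R * (y + delta + delta + delta *+ j) + d
    = (k%:R * (y + delta + delta *+ j) + d) + k%:R * delta by ring.
  have -> : k%:R * (y + delta *+ j) + d
    = (k%:R * (y + delta + delta *+ j) + d) - k%:R * delta by ring.
  by move: (_ + d) => u; rewrite cosD cosB; ring.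
have E : h (y + delta) = - \sum_(j < n.*2) sgn j.+1 * cos (k%:R * (y + delta *+ j.+1) + d).
  rewrite -sumrN; apply: eq_bigr => j _; rewrite /sgn exprS mulN1r mulNr opprK.
  by congr (_ * cos (_ * _ + _)); rewrite mulrS addrA.
rewrite E; congr (- _).
rewrite -(big_mkord xpredT (fun j => sgn j.+1 * cos (k%:R * (y + delta *+ j.+1) + d))).
rewrite /h -(big_mkord xpredT (fun j => sgn j * cos (k%:R * (y + delta *+ j) + d))).
have n2 : (0 < n.*2)%N by rewrite double_gt0.
rewrite -(prednK n2) [RHS]big_nat_recl// [LHS]big_nat_recr//= addrC; congr (_ + _).
rewrite (prednK n2) delta_period mulr0n addr0 /sgn expr0 mul1r.
rewrite -mul2n exprM sqrrN !expr1n mul1r.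
by have := @periodic_mul_nat_cos R k d y.
Qed.

Lemma alternating_sum_trig T : trig_polynomial n.-1 T ->
  \sum_(j < n.*2) (- 1) ^+ j * T (delta *+ j) = 0.
Proof.
move=> [c [e ->]]; under eq_bigr do rewrite mulr_sumr.
rewrite exchange_big/= big1// => k _.
have kn : (k < n)%N by rewrite (leq_trans (ltn_ord k))// prednK.
have -> : \sum_(j < n.*2) (- 1) ^+ j *
    (c k * cos (k%:R * (delta *+ j)) + e k * sin (k%:R * (delta *+ j)))
  = c k * (\sum_(j < n.*2) (- 1) ^+ j * cos (k%:R * (delta *+ j) + 0))
  + e k * (\sum_(j < n.*2) (- 1) ^+ j * cos (k%:R * (delta *+ j) + (- (pi / 2)))).
  rewrite !mulr_sumr -big_split/=; apply: eq_bigr => j _.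
  by rewrite addr0 cosBpihalf; ring.
by rewrite !alternating_sum_cos// !mulr0 addr0.
Qed.

Lemma best_approx_alternating f : continuous f -> (forall t, f (t + delta) = - f t) ->
  ((`|f 0|)%:E <= best_approx n f)%E.
Proof.
move=> cf fa; apply: le_ereal_inf_tmp => _ [T tT <-]; rewrite lee_fin.
have pf := alternating_periodic fa.
have cT := cts_trig_polynomial tT; have pT := periodic_trig_polynomial tT.
have sC : space_C (f \- T).
  by split; [move=> t /=; rewrite pf pT|exact: ctsB].
have n2 : 0 < n.*2%:R :> R by rewrite ltr0n double_gt0.
rewrite -(ler_pM2l n2).
have -> : n.*2%:R * `|f 0| = `|\sum_(j < n.*2) (- 1) ^+ j * (f \- T) (delta *+ j)|.
  have -> : \sum_(j < n.*2) (- 1) ^+ j * (f \- T) (delta *+ j)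
     = \sum_(j < n.*2) f 0 - \sum_(j < n.*2) (- 1) ^+ j * T (delta *+ j).
    rewrite -sumrB; apply: eq_bigr => j _ /=; rewrite mulrBr; congr (_ - _).
    have : alternating f delta by [].
    move=> /alternatingn/(_ j 0); rewrite add0r => ->.
    by rewrite mulrA -exprMn mulrNN mulr1 expr1n mul1r.
  rewrite alternating_sum_trig// subr0 sumr_const card_ord -[f 0 *+ _]mulr_natl normrM.
  by rewrite gtr0_norm.
apply: (le_trans (ler_norm_sum _ _ _)).
apply: (@le_trans _ _ (\sum_(j < n.*2) normC (f \- T))).
  apply: ler_sum => j _; have := normC_ge (delta *+ j) sC.
  by rewrite /= normrM normrX normrN normr1 expr1n mul1r.
by rewrite sumr_const card_ord mulr_natl.
Qed.

End Extremal.

(** * Uniformly convergent series *)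

Section UniformSeries.
Context {R : realType}.
Implicit Types (f : R -> R) (x y : R).

(** The uniform tail bound r is returned along with the sum: antiperiodicity and Fourier
    coefficients pass to the limit through it. *)
Lemma weierstrass_M_test (u : nat -> R -> R) (B : nat -> R) (c : R) :
  (forall m, continuous (u m)) -> (forall m x, `|u m x| <= B m) ->
  (forall M, \sum_(0 <= m < M) B m <= c) ->
  exists f r, [/\ continuous f, r M @[M --> \oo] --> (0 : R) &
    forall M x, `|f x - \sum_(0 <= m < M) u m x| <= r M].
Proof.
move=> cu uB Bc.
have B0 m : 0 <= B m by exact: le_trans (normr_ge0 _) (uB m 0).
have ndB : nondecreasing_seq (series B).
  by apply/nondecreasing_seqP => m; rewrite /series/= big_nat_recr//= lerDl.
have cvB : cvgn (series B).
  by apply: nondecreasing_is_cvgn => //; exists c => _ [M _ <-]; exact: Bc.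
have Ble M : series B M <= limn (series B) by exact: nondecreasing_cvgn_le.
have cvu x : cvgn (series (fun m => u m x)).
  apply: normed_cvg; apply: (series_le_cvg _ B0 (fun m => uB m x) cvB) => m.
  exact: normr_ge0.
pose f x := limn (series (fun m => u m x)).
pose r M := limn (series B) - series B M.
have tail M K x : (M <= K)%N ->
    `|series (fun m => u m x) K - series (fun m => u m x) M| <= r M.
  move=> MK; rewrite /series/= (big_cat_nat _ MK)//= addrAC subrr add0r.
  apply: (le_trans (ler_norm_sum _ _ _)).
  apply: (@le_trans _ _ (\sum_(M <= m < K) B m)); first exact: ler_sum.
  rewrite /r lerBrDl; have := Ble K; rewrite {1}/series/= (big_cat_nat _ MK)//=.
have fr M x : `|f x - series (fun m => u m x) M| <= r M.
  apply: (@sequence_limit_le R (series (fun m => u m x)) (fun=> series (fun m => u m x) M) _ _ _ M).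
  - exact: cvu.
  - exact: cvg_cst.
  - by move=> K MK; exact: tail.
have r0 : r M @[M --> \oo] --> (0 : R).
  by rewrite -(subrr (limn (series B))); apply: cvgB; [exact: cvg_cst|exact: cvB].
exists f, r; split => // x; apply/cvgrPdist_le => e e0.
have e3 : 0 < e / 3 by rewrite divr_gt0.
have /cvgrPdist_le/(_ _ e3)[M _ MP] := r0.
have rM : r M <= e / 3.
  have := MP M (leqnn _); rewrite /= sub0r normrN; exact: le_trans (ler_norm _).
have cS : continuous (fun y => series (fun m => u m y) M).
  by rewrite /series/=; apply: cts_sum => i _; exact: cu.
have /cvgrPdist_le/(_ _ e3) := cS x; apply: filterS => y xy.
have -> : f x - f y = (f x - series (fun m => u m x) M)
   + (series (fun m => u m x) M - series (fun m => u m y) M)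
   - (f y - series (fun m => u m y) M) by ring.
have h1 := fr M x; have h2 := fr M y.
apply: (le_trans (ler_normB _ _)); apply: (@le_trans _ _ (e / 3 + e / 3 + e / 3)); last by lra.
apply: lerD; last exact: le_trans h2 rM.
apply: (le_trans (ler_normD _ _)); apply: lerD => //; exact: le_trans h1 rM.
Qed.

Lemma eq0_le_cvg0 (a : R) (r : nat -> R) m : r M @[M --> \oo] --> (0 : R) ->
  (forall M, (m <= M)%N -> `|a| <= r M) -> a = 0.
Proof.
move=> r0 ar; apply/eqP; rewrite -normr_le0.
by apply: (ler_cvg_to (cvg_cst _) r0); exists m => // M /= mM; exact: ar.
Qed.

Lemma harm_norm_le b g c k x : continuous g -> (forall t, `|g t| <= c) ->
  `|harm b g k x| <= 2 * c.
Proof.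
move=> cg gc; have p0 : 0 < pi :> R := @pi_gt0 R.
rewrite /harm normrM gtr0_norm ?invr_gt0// ler_pdivrMl//.
have pp : - pi <= pi :> R by rewrite ge0_cp// pi_ge0.
have ci := @cts_harm_integrand R b g k x cg.
have -> : pi * (2 * c) = c * (pi - - pi) by ring.
apply: I_bound => // t _; rewrite normrM -[leRHS]mulr1.
by rewrite ler_pM// cos_max.
Qed.

End UniformSeries.

(** * The integral of the extremal function and its value at 0 *)

Section LowerBound.
Context {R : realType}.
Variables (psi omega : R -> R) (n : nat) (C beta c : R).
Hypothesis homega : modulus_of_continuity omega.
Hypothesis n_gt0 : (0 < n)%N.
Implicit Types (f g h : R -> R) (s t x u v : R) (k m j N M J : nat).

Let p k : R := psi k%:R.
Let q j : R := omega j%:R^-1 / j%:R.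
Let b := beta * pi / 2.
Let s : R := `|sin b| / pi.
Let w := omega n%:R^-1.
Let delta : R := pi / n%:R.
Let phi := extremal omega n.

Hypothesis C_ge0 : 0 <= C.
Hypothesis p_gt0 : forall k, (0 < k)%N -> 0 < p k.
Hypothesis p_decr : forall k, (0 < k)%N -> p k.+1 <= p k.
Hypothesis p_convex : forall k, (0 < k)%N -> 0 <= diff2 p k.
Hypothesis p_slope : forall k, (0 < k)%N -> k%:R * (p k - p k.+1) <= C * p k.
Hypothesis p_cvg0 : p k @[k --> \oo] --> (0 : R).
Hypothesis sum_bounded : forall N, (n <= N)%N -> s * \sum_(n <= j < N) p j * q j <= c.

Let p_ge0 k : (0 < k)%N -> 0 <= p k. Proof. by move=> /p_gt0/ltW. Qed.
Let pi0 : 0 < pi :> R. Proof. exact: pi_gt0. Qed.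
Let nR : 0 < n%:R :> R. Proof. by rewrite ltr0n. Qed.
Let w0 : 0 <= w. Proof. by rewrite omega_ge0// invr_ge0 ltW. Qed.
Let s0 : 0 <= s. Proof. by rewrite divr_ge0// ltW. Qed.
Let s1 : s <= 1. Proof. exact: sin_pi_le1. Qed.
Let cphi : continuous phi. Proof. exact: extremal_cts. Qed.
Let pphi : periodic phi (pi *+ 2). Proof. exact: extremal_periodic. Qed.
Let phiH : class_H omega phi. Proof. exact: extremal_class_H. Qed.

Let q_ge0 j : (n <= j)%N -> 0 <= q j.
Proof. by move=> nj; rewrite divr_ge0// omega_ge0// invr_ge0. Qed.

Let q_le j : (n <= j)%N -> j%:R * q j <= w.
Proof.
move=> nj; have jR : 0 < j%:R :> R by rewrite ltr0n (leq_trans n_gt0).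
rewrite /q mulrC divfK ?gt_eqF// omega_le// ?invr_ge0 ?(ltW jR)//.
by rewrite lef_pV2 ?posrE// ler_nat.
Qed.

Let phi_le t : `|phi t| <= w.
Proof. by apply: (le_trans (extremal_le homega n_gt0 t)); rewrite -/w; have := w0; lra. Qed.

Let near_conjugate m x : (n <= m)%N ->
  `|fmean b phi m x / m.+1%:R + sin b / pi *
     I (fun t => (phi (x + t) - phi (x - t)) * cut_inv m%:R^-1 t) m%:R^-1 n%:R^-1|
  <= 35 * w.
Proof.
move=> nm; have [G GG Gw] := extremal_primitive homega n_gt0.
exact: (fmean_near_conjugate b x n_gt0 nm cphi GG phi_le Gw).
Qed.

(** The estimate behind the upper bound, with P = 0: phi and its antiperiodic primitive are already
    small enough. Here 39 = 35 + 4. *)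
Let fmean_bound m x : (n <= m)%N ->
  `|fmean b phi m x| <= m.+1%:R * (s * (\sum_(n <= j < m) q j) + 39 * w).
Proof.
move=> nm; have h1 := near_conjugate x nm.
have PP (y t : R) : 0 <= t ->
    `|(fun=> (0 : R)) (y + t) - (fun=> (0 : R)) (y - t)| <= 2 * t * n%:R * w.
  by move=> t0; rewrite subrr normr0 !mulr_ge0// ltW.
have h2 := difference_integral_le x homega n_gt0 nm phiH (@cts_cst R 0) PP.
have E : I (fun t => (phi (x + t) - 0 - (phi (x - t) - 0)) * cut_inv m%:R^-1 t) m%:R^-1 n%:R^-1
  = I (fun t => (phi (x + t) - phi (x - t)) * cut_inv m%:R^-1 t) m%:R^-1 n%:R^-1.
  by apply: I_eq => t; rewrite !subr0.
rewrite E in h2; move: h1 h2; set J := I _ _ _ => h1 h2.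
have M0 : 0 < m.+1%:R :> R by [].
have im : 0 < m.+1%:R^-1 :> R by rewrite invr_gt0.
rewrite -ler_pdivrMl// mulrC -[X in _ * X](gtr0_norm im) -normrM.
set F := fmean b phi m x / m.+1%:R in h1 *.
have -> : F = (F + sin b / pi * J) - sin b / pi * J by ring.
apply: (le_trans (ler_normB _ _)).
have : `|sin b / pi * J| <= s * (\sum_(n <= j < m) q j) + 4 * w.
  rewrite normrM normrM normfV (gtr0_norm pi0).
  apply: (le_trans (ler_wpM2l s0 h2)); rewrite mulrDr lerD2l.
  by rewrite ler_piMl ?mulr_ge0.
by lra.
Qed.

Let Bseq m : R := if (m < n)%N then 0 else
  diff2 p m * (m.+1%:R * (s * (\sum_(n <= j < m) q j) + 39 * w)).

Let bracket_ge0 m : 0 <= m.+1%:R * (s * (\sum_(n <= j < m) q j) + 39 * w).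
Proof.
apply: mulr_ge0 => //; apply: addr_ge0; apply: mulr_ge0 => //.
by rewrite big_nat_cond sumr_ge0// => j /andP[/andP[nj _] _]; exact: q_ge0.
Qed.

(** The weights [diff2 p] have no finite support, so [weighted_sum_le] is applied to truncated
    weights. Its bound is independent of N, and N tends to infinity with M fixed. *)
Let Bseq_sum M : \sum_(0 <= m < M) Bseq m <= c + (2 + 39 * (C + 2)) * (p n * w).
Proof.
have [Mn|nM] := leqP M n.
  rewrite big_nat_cond big1.
    have := sum_bounded (leqnn n); rewrite big_geq// mulr0 => c0.
    apply: addr_ge0 => //; apply: mulr_ge0; first by have := C_ge0; lra.
    by apply: mulr_ge0 => //; exact: p_ge0.
  by move=> m /andP[/andP[_ mM] _]; rewrite /Bseq (leq_trans mM).
rewrite (big_cat_nat _ (n := n))//=; last exact: ltnW.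
rewrite big_nat_cond big1 ?add0r; last first.
  by move=> m /andP[/andP[_ mn] _]; rewrite /Bseq mn.
rewrite (eq_big_nat _ _ (F2 := fun m => diff2 p m *
   (m.+1%:R * (s * (\sum_(n <= j < m) q j) + 39 * w)))); last first.
  by move=> m /andP[nm _]; rewrite /Bseq ltnNge nm.
have L : \sum_(n <= m < M) diff2 (truncate p N) m *
   (m.+1%:R * (s * (\sum_(n <= j < m) q j) + 39 * w)) @[N --> \oo] -->
   \sum_(n <= m < M) diff2 p m * (m.+1%:R * (s * (\sum_(n <= j < m) q j) + 39 * w)).
  apply: cvg_sum_seq => m; rewrite mem_index_iota => /andP[nm _].
  have m0 : (0 < m)%N by exact: leq_trans nm.
  apply: cvgM; last exact: cvg_cst.
  apply: cvgD; last exact: truncate_cvg.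
  apply: cvgB; first exact: truncate_cvg.
  by apply: cvgM; [exact: cvg_cst|exact: truncate_cvg].
apply: (ler_cvg_to L (cvg_cst _)); exists M => // N /= MN.
have nN : (n <= N)%N by exact: leq_trans (ltnW nM) MN.
apply: (@le_trans _ _ (\sum_(n <= m < N.+1) diff2 (truncate p N) m *
   (m.+1%:R * (s * (\sum_(n <= j < m) q j) + 39 * w)))).
  rewrite [leRHS](big_cat_nat _ (n := M)) ?(ltnW nM) ?(leqW MN)//= lerDl.
  rewrite big_nat_cond sumr_ge0// => m /andP[/andP[Mm _] _].
  rewrite mulr_ge0//; apply: truncate_diff2_ge0 => //.
  by rewrite (leq_trans n_gt0)// (leq_trans (ltnW nM)).
have := @weighted_sum_le R p q C w n (N - n) n_gt0 w0 p_ge0 p_decr p_slope q_ge0 q_le s 39 s0.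
rewrite subnKC// => /(_ (ler0n _ _)); move/le_trans; apply.
have h1 := sum_bounded (leqW nN).
have : s * (2 * (p n * w)) <= 2 * (p n * w).
  by apply: ler_piMl => //; rewrite !mulr_ge0// p_ge0.
by rewrite mulrDr; lra.
Qed.

Let partial_sum M x : \sum_(0 <= m < M.+1) diff2 p m * fmean b phi m x
  = \sum_(1 <= k < M.+1)
      (p k - p M.+1 - (M.+1%:R - k%:R) * (p M.+1 - p M.+2)) * harm b phi k x.
Proof.
have f0 : fmean b phi 0 x = 0 by rewrite /fmean big_geq.
by rewrite big_ltn// f0 mulr0 add0r -double_abel.
Qed.

(** The boundary terms of the double summation by parts vanish in the limit: (M+1-k) (p(M+1) -
    p(M+2)) is at most C p(M+1) by [p_slope]. *)
Let coef_cvg k : (0 < k)%N ->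
  p k - p M.+1 - (M.+1%:R - k%:R) * (p M.+1 - p M.+2) @[M --> \oo] --> p k.
Proof.
move=> k0; have pS : p M.+1 @[M --> \oo] --> (0 : R).
  by rewrite (cvg_shiftS p).
have z : (M.+1%:R - k%:R) * (p M.+1 - p M.+2) @[M --> \oo] --> (0 : R).
  have H : \forall M \near \oo, 0 <= (M.+1%:R - k%:R) * (p M.+1 - p M.+2) <= C * p M.+1.
    exists k => // M /= kM; have h := p_slope (ltn0Sn M).
    have d0 : 0 <= p M.+1 - p M.+2 by rewrite subr_ge0 p_decr.
    have a0 : 0 <= M.+1%:R - k%:R :> R by rewrite subr_ge0 ler_nat leqW.
    apply/andP; split; first exact: mulr_ge0.
    by apply: (le_trans _ h); rewrite ler_wpM2r// gerBl.
  apply: (squeeze_cvgr H); first exact: cvg_cst.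
  by rewrite -(mulr0 C); apply: cvgM; [exact: cvg_cst|exact: pS].
rewrite -[X in _ --> X]subr0 -[X in X - _]subr0.
by apply: cvgB => //; apply: cvgB => //; exact: cvg_cst.
Qed.

(** f is defined as the sum of [diff2 p m] times the Fejer means of phi, which converges uniformly
    by [Bseq_sum]. By [partial_sum] and [harm_harm] the k-th harmonic of a partial sum is that of
    phi times a coefficient tending to p k. *)
Lemma extremal_integral_exists : exists f,
  [/\ continuous f, forall t, f (t + delta) = - f t & is_psi_beta_derivative psi beta f phi].
Proof.
pose u m x := diff2 p m * fmean b phi m x.
have charm k : continuous (harm b phi k).
  by apply: cts_trig_polynomial; exact: (@trig_polynomial_harm R k).
have cu m : continuous (u m) by rewrite /u /fmean; cts; exact: charm.
have uB m x : `|u m x| <= Bseq m.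
  rewrite /u /Bseq; have [mn|nm] := ltnP m n.
    by rewrite fmean_extremal0// mulr0 normr0.
  have d0 : 0 <= diff2 p m by apply: p_convex; exact: leq_trans nm.
  by rewrite normrM (ger0_norm d0) ler_wpM2l// fmean_bound.
have [f [r [cf r0 fr]]] := weierstrass_M_test cu uB Bseq_sum.
have fa t : f (t + delta) = - f t.
  have ua m y : u m (y + delta) = - u m y.
    rewrite /u /fmean !mulr_sumr -sumrN; apply: eq_bigr => k _.
    by rewrite harm_extremal_alternating// !mulrN.
  apply/eqP; rewrite -addr_eq0; apply/eqP.
  have r2 : 2 * r M @[M --> \oo] --> (0 : R).
    by rewrite -(mulr0 2); apply: cvgM => //; exact: cvg_cst.
  apply: (eq0_le_cvg0 (m := 0) r2) => M _.
  have h1 := fr M (t + delta); have h2 := fr M t.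
  have E : \sum_(0 <= m < M) u m (t + delta) = - \sum_(0 <= m < M) u m t.
    by rewrite -sumrN; apply: eq_bigr => m _; exact: ua.
  rewrite E in h1.
  have -> : f (t + delta) + f t = (f (t + delta) - - \sum_(0 <= m < M) u m t)
     + (f t - \sum_(0 <= m < M) u m t) by ring.
  by apply: (le_trans (ler_normD _ _)); lra.
have pf : periodic f (pi *+ 2) by exact: (@alternating_periodic R n n_gt0).
exists f; split => //; apply: psi_beta_derivativeI => //.
- exact: extremal_mean0.
- by move=> k k0; rewrite gt_eqF//; exact: p_gt0.
move=> k x k0; apply/eqP; rewrite -subr_eq0; apply/eqP.
set hk := harm (beta * pi / 2) phi k x.
pose e M : R := p k - p M.+1 - (M.+1%:R - k%:R) * (p M.+1 - p M.+2).
have r' : 2 * r M.+1 + `|e M - p k| * `|hk| @[M --> \oo] --> (0 : R).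
  have -> : 0 = 2 * 0 + `|p k - p k| * `|hk| :> R by rewrite subrr normr0 mul0r mulr0 addr0.
  apply: cvgD; first by apply: cvgM; [exact: cvg_cst|rewrite (cvg_shiftS r)].
  apply: cvgM; last exact: cvg_cst.
  by apply: cvg_norm; apply: cvgB; [exact: coef_cvg|exact: cvg_cst].
apply: (eq0_le_cvg0 (m := k) r') => M kM.
pose S x := \sum_(0 <= m < M.+1) u m x.
have cS : continuous S by rewrite /S; cts; exact: cu.
have hS : harm 0 S k x = e M * hk.
  have -> : S = fun x => \sum_(1 <= j < M.+1)
      (p j - p M.+1 - (M.+1%:R - j%:R) * (p M.+1 - p M.+2)) * harm b phi j x.
    by apply/funext => y; exact: partial_sum.
  rewrite harm_sum; last by move=> j; cts; exact: charm.
  rewrite (bigD1_seq k)/= ?iota_uniq ?mem_index_iota ?k0//.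
  rewrite harmZ// harm_harm// eqxx addr0 big1 ?addr0// => j /negPf jk.
  by rewrite harmZ// harm_harm// jk mulr0.
have -> : harm 0 f k x - psi k%:R * hk = harm 0 (fun t => f t - S t) k x + (e M - p k) * hk.
  by rewrite harmB// hS -/(p k); ring.
apply: (le_trans (ler_normD _ _)); apply: lerD; last by rewrite normrM.
by apply: harm_norm_le; [cts|move=> t; exact: fr].
Qed.

Let extremal_integral_ge m : (n <= m)%N ->
  \sum_(n.+1 <= j < m.+1) q j - w <=
  I (fun t => (phi (0 + t) - phi (0 - t)) * cut_inv m%:R^-1 t) m%:R^-1 n%:R^-1.
Proof.
move=> nm; have m0 : (0 < m)%N by exact: leq_trans nm.
have mR : 0 < m%:R :> R by rewrite ltr0n.
have e0 : 0 < m%:R^-1 :> R by rewrite invr_gt0.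
have mn : m%:R^-1 <= n%:R^-1 :> R by rewrite lef_pV2 ?posrE// ler_nat.
have cc := cts_cut_inv e0.
have cw : continuous (fun t => omega `|2^-1 * t|).
  apply: (@cts_comp _ (fun t => omega `|t|) (fun t => 2^-1 * t)); first exact: cts_omega.
  by cts.
apply: (le_trans (omega_integral_lower homega n_gt0 nm)).
apply: I_le => //; [by cts|by cts|] => t /andP[mt tn].
have t0 : 0 < t by exact: lt_le_trans mt.
rewrite ler_wpM2r ?cut_inv_ge0// add0r sub0r /phi extremalN// opprK.
have u0 : 0 <= n%:R * t by rewrite mulr_ge0// ltW.
have u1 : n%:R * t <= 1 by rewrite mulrC -ler_pdivlMr// mul1r.
have su : n%:R * t / 2 <= sin (n%:R * t).
  have := sin_ge u0; have : (n%:R * t) ^+ 3 <= n%:R * t.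
    rewrite exprS ler_piMr// expr2 mulr_ile1//.
  by move: (n%:R * t) (_ ^+ 3) u0 => U V; lra.
have h0 : 2^-1 * t <= sin (n%:R * t) / n%:R.
  by rewrite ler_pdivlMr//; lra.
have t20 : 0 <= 2^-1 * t by rewrite mulr_ge0// ltW.
rewrite /extremal odd_modulus_ge0 ?(le_trans t20)// ger0_norm//.
by have := omega_le homega t20 h0; lra.
Qed.

(** At 0 all the conjugate integrals have a common lower bound of the same form, so multiplying by
    minus the sign of sin b lets the contributions of all m >= n add up without cancellation. Here
    36 = 35 + 1. The finite bound J allows N to tend to infinity term by term. *)
Lemma extremal_value f J : continuous f -> (forall t, f (t + delta) = - f t) ->
  is_psi_beta_derivative psi beta f phi ->
  s * (\sum_(n.+1 <= j < J) p j * q j) - 36 * (C + 2) * (p n * w) <= `|f 0|.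
Proof.
move=> cf fa D; pose sg := Num.sg (sin b).
have sgb : sg * sin b = `|sin b| by rewrite normrEsg.
have sg1 : `|sg| <= 1 by rewrite /sg normr_sg; case: (_ != _).
have pf : periodic f (pi *+ 2) by exact: (@alternating_periodic R n n_gt0).
have If : I f (- pi) pi = 0.
  have := @I_shift_periodic R f delta cf pf.
  under I_eq do rewrite addrC fa.
  by rewrite IN//; lra.
have pn k : (0 < k)%N -> psi k%:R != 0 by move=> k0; rewrite gt_eqF//; exact: p_gt0.
have term m : (n <= m)%N ->
    m.+1%:R * (s * (\sum_(n.+1 <= j < m.+1) q j) - 36 * w) <= - sg * fmean b phi m 0.
  move=> nm; have h1 := near_conjugate 0 nm; have h2 := extremal_integral_ge nm.
  have M0 : 0 < m.+1%:R :> R by [].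
  rewrite -ler_pdivlMl// mulrCA [_^-1 * _]mulrC.
  move: h1 h2; set J' := I _ _ _; set F := fmean b phi m 0 / m.+1%:R => h1 h2.
  have -> : - sg * F = - (sg * (F + sin b / pi * J')) + s * J'.
    by rewrite /s -sgb; ring.
  have : `|sg * (F + sin b / pi * J')| <= 35 * w.
    rewrite normrM; apply: (le_trans _ h1); exact: ler_piMl.
  rewrite ler_norml => /andP[_ h3].
  have h4 := ler_wpM2l s0 h2.
  have : s * w <= w by rewrite ler_piMl.
  by move: h4; rewrite mulrBr; lra.
have main N : (n <= N)%N ->
  s * (\sum_(n.+1 <= j < N.+1) truncate p N j * q j) - 36 * (C + 2) * (p n * w)
    <= - sg * fejer_mean f N 0.
  move=> nN; rewrite (fejer_mean_derivative _ _ D)// If mulr0 add0r -/b -/p fmean_truncate.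
  have -> : \sum_(1 <= m < N.+1) diff2 (truncate p N) m * fmean b phi m 0
      = \sum_(n <= m < N.+1) diff2 (truncate p N) m * fmean b phi m 0.
    rewrite (big_cat_nat _ (n := n)) ?(leqW nN)//= big_nat_cond big1 ?add0r//.
    by move=> m /andP[/andP[_ mn] _]; rewrite fmean_extremal0// mulr0.
  have := @weighted_sum_ge R p q C w n (N - n) n_gt0 w0 p_ge0 p_decr p_slope q_ge0 s 36 s0.
  rewrite subnKC// => /(_ (ler0n _ _)) h; apply: (le_trans h).
  rewrite mulr_sumr big_nat_cond [leRHS]big_nat_cond; apply: ler_sum => m /andP[/andP[nm _] _].
  rewrite [leRHS]mulrCA; apply: ler_wpM2l; last exact: term.
  by apply: truncate_diff2_ge0 => //; exact: leq_trans nm.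
have L1 : - sg * fejer_mean f N 0 @[N --> \oo] --> - sg * f 0.
  by apply: cvgM; [exact: cvg_cst|exact: fejer_mean_cvg].
have L2 : s * (\sum_(n.+1 <= j < J) truncate p N j * q j) - 36 * (C + 2) * (p n * w)
    @[N --> \oo] --> s * (\sum_(n.+1 <= j < J) p j * q j) - 36 * (C + 2) * (p n * w).
  apply: cvgB; last exact: cvg_cst.
  apply: cvgM; first exact: cvg_cst.
  apply: cvg_sum_seq => j; rewrite mem_index_iota => /andP[nj _].
  by apply: cvgM; [apply: truncate_cvg; exact: leq_ltn_trans nj|exact: cvg_cst].
apply: (@le_trans _ _ (- sg * f 0)); last first.
  apply: (le_trans (ler_norm _)); rewrite normrM normrN; exact: ler_piMl.
apply: (ler_cvg_to L2 L1); exists (maxn n J) => // N /=; rewrite geq_max => /andP[nN JN].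
apply: (le_trans _ (main N nN)); rewrite lerD2r ler_wpM2l//.
have [Jn|nJ] := leqP J n.+1.
  rewrite big_geq// big_nat_cond sumr_ge0// => j /andP[/andP[nj _] _].
  by rewrite mulr_ge0 ?q_ge0 ?(ltnW nj)// truncate_ge0// (leq_ltn_trans _ nj).
rewrite [leRHS](big_cat_nat _ (n := J)) ?(ltnW nJ) ?(leqW JN)//= lerDl.
rewrite big_nat_cond sumr_ge0// => j /andP[/andP[Jj _] _].
have nj : (n < j)%N by exact: leq_trans (ltnW nJ) Jj.
by rewrite mulr_ge0 ?q_ge0 ?(ltnW nj)// truncate_ge0// (leq_ltn_trans _ nj).
Qed.

End LowerBound.

(** * The principal term *)

Section MainIntegral.
Context {R : realType}.
Variables (psi omega : R -> R).
Hypothesis homega : modulus_of_continuity omega.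
Hypothesis psiM : class_M psi.
Implicit Types (e t x : R) (j k n N J : nat).
Local Notation leb := (@lebesgue_measure R).

Let s j : R := psi j%:R * (omega j%:R^-1 / j%:R).

(** Freezing psi at psi 1 to the left of 1 gives a function continuous on the whole line. *)
Lemma cts_psi_max : continuous (fun x => psi (Num.max x 1)).
Proof.
have [cp _ _ _] := psiM; move=> x; apply/cvgrPdist_le => e e0.
have A1 : `[1, +oo[%classic (Num.max x 1) by rewrite /= in_itv/= andbT le_max lexx orbT.
have /cvgrPdist_le/(_ _ e0)[d /= d0 dP] := (subspace_continuousP _ _).1 cp _ A1.
exists d => //= y xy; apply: dP; last by rewrite /= in_itv/= andbT le_max lexx orbT.
rewrite /ball_/=; apply: le_lt_trans xy.
rewrite ler_norml; have := ler_norm (x - y); have := ler_norm (y - x); rewrite distrC.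
by rewrite /Num.max; do 2 (case: ltP => ?); move=> ? ?; apply/andP; split; lra.
Qed.

Lemma I_EFin (h : R -> R) a b : a <= b -> continuous h ->
  (\int[leb]_(t in `[a, b]) (h t)%:E)%E = (I h a b)%:E.
Proof.
move=> ab ch; rewrite -RintE// /Rintegral fineK//.
exact: integrable_fin_num (cts_integrable a b ch).
Qed.

(** A globally continuous stand-in for the integrand of the main term, equal to it on [e, 1] when e
    > 0. *)
Let H e t := psi (Num.max (cut_inv e t) 1) * omega `|t| * cut_inv e t.

Let cts_H e : 0 < e -> continuous (H e).
Proof.
move=> e0; have cc := cts_cut_inv e0; have co := cts_omega homega.
apply: ctsM => //; apply: ctsM => //.
exact: (@cts_comp _ (fun x => psi (Num.max x 1)) (cut_inv e) cts_psi_max cc).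
Qed.

Let HE e t : e <= t -> 0 < t <= 1 -> H e t = psi t^-1 * omega t / t.
Proof.
move=> et /andP[t0 t1]; rewrite /H cut_invE// gtr0_norm// max_l//.
by rewrite invf_ge1.
Qed.

Let H_sum n d e : (0 < n)%N -> 0 < e -> e <= (n + d)%:R^-1 ->
  \sum_(n.+1 <= j < (n + d).+1) s j <= I (H e) (n + d)%:R^-1 n%:R^-1
  <= \sum_(n <= j < n + d) s j.
Proof.
move=> n0 e0 ed.
have S (k l : nat) : \sum_(k <= j < l) s j = \sum_(k <= j < l) psi j%:R * omega j%:R^-1 / j%:R.
  by apply: eq_bigr => j _; rewrite /s mulrA.
rewrite !S.
apply: (@harmonic_partition _ _ (fun j => psi j%:R * omega j%:R^-1)) ed => //; first exact: cts_H.
move=> j t j0 ej /andP[jt tj]; have jR : 0 < j%:R :> R by rewrite ltr0n.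
have i0 : 0 < j.+1%:R^-1 :> R by rewrite invr_gt0.
have t0 : 0 < t by exact: lt_le_trans jt.
have j1 : (1 : R) <= j%:R by rewrite ler1n.
have t1 : t <= 1 by rewrite (le_trans tj)// invf_le1.
rewrite HE ?t0 ?(le_trans ej)//.
have v1 : t^-1 <= j.+1%:R by rewrite -[leRHS]invrK lef_pV2.
have v2 : j%:R <= t^-1 by rewrite -[leLHS]invrK lef_pV2// posrE invr_gt0.
have v3 : 1 <= t^-1 by exact: le_trans v2.
have p1 := class_M_nonincreasing psiM j1 v2; have p2 := class_M_nonincreasing psiM v3 v1.
have w1 := omega_le homega (ltW i0) jt; have w2 := omega_le homega (ltW t0) tj.
have [_ p0 _ _] := psiM.
have o0 := omega_ge0 homega (ltW i0); have o1 := omega_ge0 homega (ltW t0).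
have q1 : 0 < psi t^-1 by exact: p0.
have q2 : 0 < psi j.+1%:R by apply: p0; rewrite ler1n.
apply/andP; split; [rewrite [leLHS]mulrC|rewrite [leRHS]mulrC]; apply: ler_pM => //.
- by rewrite mulr_ge0// ltW.
- by apply: ler_pM => //; exact: ltW.
- by rewrite mulr_ge0// ltW.
- by rewrite invr_ge0 ltW.
- by apply: ler_pM => //; exact: ltW.
Qed.

Let integrand t : \bar R := (psi t^-1 * omega t / t)%:E.

Section Exhaustion.
Variable n : nat.
Hypothesis n_gt0 : (0 < n)%N.
Let D : set R := `]0, n%:R^-1]%classic.
Let F i : set R := `[(n + i)%:R^-1, n%:R^-1]%classic.

Let ni0 i : 0 < (n + i)%:R^-1 :> R.
Proof. by rewrite invr_gt0 ltr0n addn_gt0 n_gt0. Qed.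

Let n1 : n%:R^-1 <= 1 :> R.
Proof. by rewrite invf_le1 ?ler1n// ltr0n. Qed.

Let integrandE i t : F i t -> integrand t = (H (n + i)%:R^-1 t)%:E.
Proof.
rewrite /F /= in_itv/= => /andP[it tn]; rewrite HE//.
by rewrite (lt_le_trans (ni0 i) it)/= (le_trans tn).
Qed.

Let mintegrand i : measurable_fun (F i) integrand.
Proof.
apply: (eq_measurable_fun (fun t => (H (n + i)%:R^-1 t)%:E)).
  by move=> t; rewrite inE => /integrandE ->.
apply/measurable_EFinP; apply: measurable_funTS.
by apply: continuous_measurable_fun; exact: cts_H.
Qed.

Let integrand_ge0 i t : F i t -> (0 <= integrand t)%E.
Proof.
rewrite /F /= in_itv/= => /andP[it tn]; rewrite lee_fin.
have t0 : 0 < t by exact: lt_le_trans (ni0 i) it.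
have [_ p0 _ _] := psiM.
apply: divr_ge0; last exact: ltW.
apply: mulr_ge0; last by apply: omega_ge0 => //; exact: ltW.
by apply/ltW/p0; rewrite invf_ge1// (le_trans tn).
Qed.

Let F_integral i :
  (\int[leb]_(t in F i) integrand t)%E = (I (H (n + i)%:R^-1) (n + i)%:R^-1 n%:R^-1)%:E.
Proof.
rewrite -I_EFin; [|by apply: inv_nat_le => //; exact: leq_addr|exact: cts_H].
by apply: eq_integral => t; rewrite inE => /integrandE.
Qed.

Let F_bigcup : \bigcup_i F i = D.
Proof.
rewrite /D; apply/seteqP; split => t /=.
  move=> [i _]; rewrite /F /= !in_itv/= => /andP[it ->]; rewrite andbT.
  exact: lt_le_trans (ni0 i) it.
rewrite in_itv/= => /andP[t0 tn].
have tV : 0 <= t^-1 by rewrite invr_ge0 ltW.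
have /andP[_ h] := truncn_itv tV.
exists (Num.truncn t^-1).+1 => //; rewrite /F /= in_itv/= tn andbT.
rewrite -[leRHS]invrK lef_pV2 ?posrE ?invr_gt0 ?ltr0n ?addn_gt0 ?n_gt0//.
by rewrite (le_trans (ltW h))// ler_nat leq_addl.
Qed.

(** The integrand may be singular at 0. Being nonnegative, it allows monotone convergence along the
    intervals [1/(n+i), 1/n], with an extended real limit. *)
Let F_cvg : (\int[leb]_(t in F i) integrand t)%E @[i --> \oo]
  --> (\int[leb]_(t in D) integrand t)%E.
Proof.
rewrite -F_bigcup; apply: ge0_nondecreasing_set_cvg_integral => //.
- apply/nondecreasing_seqP => i; rewrite subsetEset /F => t /=; rewrite !in_itv/= => /andP[it ->].
  rewrite andbT (le_trans _ it)//; apply: inv_nat_le; rewrite ?addn_gt0 ?n_gt0//.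
  by rewrite leq_add2l.
- by move=> i; exact: measurable_itv.
Qed.

Let integral_le c : (forall N, \sum_(n <= j < N) s j <= c) ->
  (\int[leb]_(t in D) integrand t <= c%:E)%E.
Proof.
move=> Hc; apply: (cvge_le _ F_cvg); apply: nearW => i; rewrite F_integral lee_fin.
have /andP[_ h] := H_sum n_gt0 (ni0 i) (lexx _).
exact: le_trans h (Hc _).
Qed.

Lemma main_integral_le c : (forall N, \sum_(n <= j < N) s j <= c) ->
  \int[leb]_(t in `]0, n%:R^-1]) (psi t^-1 * omega t / t) <= c.
Proof.
move=> Hc; have L := integral_le Hc.
have G : (0 <= \int[leb]_(t in D) integrand t)%E.
  apply: integral_ge0 => t; rewrite -F_bigcup => -[i _]; exact: integrand_ge0.
rewrite /Rintegral; move: L G; rewrite /integrand /D.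
by case: (\int[leb]_(t in _) _)%E => //= r; rewrite lee_fin.
Qed.

(** The bound c on the sums makes the extended integral finite; an infinite one would be read as 0
    by the real-valued integral. *)
Lemma main_integral_ge c N : (forall N, \sum_(n <= j < N) s j <= c) ->
  \sum_(n.+1 <= j < N) s j <= \int[leb]_(t in `]0, n%:R^-1]) (psi t^-1 * omega t / t).
Proof.
move=> Hc; have L := integral_le Hc.
have s0 j : (0 < j)%N -> 0 <= s j.
  move=> j0; have [_ p0 _ _] := psiM; rewrite mulr_ge0//.
    by rewrite ltW// p0// ler1n.
  by rewrite divr_ge0// omega_ge0// invr_ge0.
have G : ((\sum_(n.+1 <= j < N) s j)%:E <= \int[leb]_(t in D) integrand t)%E.
  have h : ((\sum_(n.+1 <= j < (n + N).+1) s j)%:E <= \int[leb]_(t in F N) integrand t)%E.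
    by rewrite F_integral lee_fin; have /andP[] := H_sum n_gt0 (ni0 N) (lexx _).
  apply: (@le_trans _ _ (\sum_(n.+1 <= j < (n + N).+1) s j)%:E).
    rewrite lee_fin; have [Nn|nN] := leqP N n.+1.
      rewrite big_geq// big_nat_cond sumr_ge0// => j /andP[/andP[nj _] _].
      by apply: s0; exact: leq_trans nj.
    rewrite [leRHS](big_cat_nat _ (n := N)) ?(ltnW nN) ?leqW ?leq_addl//= lerDl.
    rewrite big_nat_cond sumr_ge0// => j /andP[/andP[Nj _] _].
    by apply: s0; rewrite (leq_trans _ Nj)// (leq_trans _ nN).
  apply: (le_trans h); apply: ge0_subset_integral => //=.
  - exact: measurable_itv.
  - exact: measurable_itv.
  - by rewrite -F_bigcup; apply/measurable_fun_bigcup => // i; exact: measurable_itv.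
  - by move=> t; rewrite -F_bigcup => -[i _]; exact: integrand_ge0.
  - by rewrite -F_bigcup; exact: bigcup_sup.
rewrite /Rintegral; move: L G; rewrite /integrand /D.
by case: (\int[leb]_(t in _) _)%E => //= r; rewrite !lee_fin.
Qed.

End Exhaustion.

(** Here omega(1/j) <= omega(1), and the sum of psi(j) / j is compared with the integral of psi(t) /
    t over [1, +oo[, the term j = 1 apart. *)
Lemma psi_sum_bounded : (\int[leb]_(t in `[1%R, +oo[) (psi t / t)%:E < +oo)%E ->
  exists c, forall n N, (0 < n)%N -> \sum_(n <= j < N) s j <= c.
Proof.
move=> fin; have [cp p0 _ _] := psiM.
pose h t : R := psi (Num.max t 1) * cut_inv 1 t.
have ch : continuous h by apply: ctsM; [exact: cts_psi_max|exact: cts_cut_inv].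
have hE t : 1 <= t -> h t = psi t / t by move=> t1; rewrite /h cut_invE// max_l.
have h0 t : 1 <= t -> 0 <= psi t / t.
  by move=> t1; apply: divr_ge0; [apply/ltW/p0|exact: le_trans t1].
pose E1 : set R := `[1, +oo[%classic.
have mh : measurable_fun E1 (fun t => (psi t / t)%:E).
  apply: (eq_measurable_fun (fun t => (h t)%:E)).
    by move=> t; rewrite inE/E1/= in_itv/= andbT => /hE ->.
  by apply/measurable_EFinP; apply: measurable_funTS; exact: continuous_measurable_fun.
pose K := fine (\int[leb]_(t in `[1%R, +oo[) (psi t / t)%:E)%E.
have IK N : (0 < N)%N -> I h 1 N%:R <= K.
  move=> N0; have N1 : (1 : R) <= N%:R by rewrite ler1n.
  have L : ((I h 1 N%:R)%:E <= \int[leb]_(t in `[1%R, +oo[) (psi t / t)%:E)%E.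
    rewrite -I_EFin//; apply: (@le_trans _ _ (\int[leb]_(t in `[1%R, N%:R]) (psi t / t)%:E)%E).
      rewrite le_eqVlt; apply/orP; left; apply/eqP; apply: eq_integral => t.
      by rewrite inE/= in_itv/= => /andP[/hE ->].
    apply: ge0_subset_integral => //=.
    - by move=> t; rewrite in_itv/= andbT lee_fin; exact: h0.
    - by apply: subset_itvl; rewrite bnd_simp.
  have G : (0 <= \int[leb]_(t in `[1%R, +oo[) (psi t / t)%:E)%E.
    by apply: integral_ge0 => t; rewrite /= in_itv/= andbT lee_fin; exact: h0.
  rewrite /K; move: L fin G; by case: (\int[leb]_(t in _) _)%E.
have S N : (0 < N)%N -> \sum_(2 <= j < N.+1) psi j%:R / j%:R <= I h 1 N%:R.
  elim: N => // -[_ _|N ih _]; first by rewrite big_geq// /I subrr.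
  rewrite big_nat_recr//= -(Ichasles h 1 N.+1%:R); apply: lerD; first exact: ih.
  have N1 : (1 : R) <= N.+1%:R by rewrite ler1n.
  have NN : N.+1%:R <= N.+2%:R :> R by rewrite ler_nat.
  apply: (@le_trans _ _ (I (fun=> psi N.+2%:R / N.+2%:R) N.+1%:R N.+2%:R)).
    by rewrite Icst -[N.+2%:R in X in _ <= _ * X]natr1 addrAC subrr add0r mulr1.
  apply: I_le => //; first exact: cts_cst.
  move=> t /andP[Nt tN]; have t1 : 1 <= t by exact: le_trans Nt.
  have t0 : 0 < t by exact: lt_le_trans t1.
  rewrite hE// ler_pM// ?invr_ge0//.
  - by rewrite ltW// p0// (le_trans t1).
  - exact: class_M_nonincreasing.
  - by rewrite lef_pV2 ?posrE.
exists (omega 1 * (psi 1 + K)) => n N n0.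
have o1 : 0 <= omega 1 by exact: omega_ge0.
have q0 j : (0 < j)%N -> 0 <= psi j%:R / j%:R by move=> j0; apply: h0; rewrite ler1n.
apply: (@le_trans _ _ (omega 1 * \sum_(n <= j < N) psi j%:R / j%:R)).
  rewrite mulr_sumr big_nat_cond [leRHS]big_nat_cond; apply: ler_sum => j /andP[/andP[nj _] _].
  have j0 : (0 < j)%N by exact: leq_trans nj.
  have jR : (1 : R) <= j%:R by rewrite ler1n.
  have j0R : (0 : R) < j%:R by rewrite ltr0n.
  have jV : j%:R^-1 <= 1 :> R by rewrite invf_le1.
  have jV0 : 0 <= j%:R^-1 :> R by rewrite invr_ge0 ltW.
  rewrite /s mulrCA; apply: ler_wpM2r; first exact: q0.
  exact: omega_le.
apply: ler_wpM2l => //; have [Nn|nN] := leqP N n.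
  rewrite big_geq// addr_ge0 ?(le_trans _ (IK 1%N isT)) ?/I ?subrr//.
  by rewrite ltW// p0.
apply: (@le_trans _ _ (\sum_(1 <= j < N.+1) psi j%:R / j%:R)).
  rewrite [leRHS](big_cat_nat _ (n := n)) ?(leqW (ltnW nN))//= big_nat_recr ?(ltnW nN)//=.
  rewrite addrCA lerDl addr_ge0//; last by apply: q0; exact: leq_ltn_trans nN.
  by rewrite big_nat_cond sumr_ge0// => j /andP[/andP[j0 _] _]; exact: q0.
have N0 : (0 < N)%N by exact: leq_ltn_trans nN.
rewrite big_ltn// divr1; apply: lerD => //.
exact: le_trans (S N N0) (IK N N0).
Qed.

End MainIntegral.

(** * The two-sided estimate and the conclusion *)

Lemma class_best_approx_estimate (R : realType) (psi omega : R -> R) :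
  modulus_of_continuity omega -> class_M0 psi ->
  exists2 K : R, 0 <= K & forall (beta : R) (n : nat), class_M' beta psi -> (0 < n)%N ->
  exists2 E : R, class_best_approx n (class_CH psi beta omega) = E%:E &
    `|E - main_term psi beta omega n| <= K * (psi n%:R * omega n%:R^-1).
Proof.
move=> homega M0; have [cM _] := M0; have [_ _ _ lim0] := cM.
have [C [C0 p0 pdecr pconv pslope]] := class_M0_sequence M0.
(* Absorbs both 3 + 5709 (C+2) from above and 1 + 36 (C+2) from below; C comes from psi alone,
   before beta and n are introduced. *)
exists (5748 * (C + 2)).
  by apply: mulr_ge0; [exact: ler0n|exact: addr_ge0].
move=> beta n [_ fin] n0.
set b := beta * pi / 2 in fin *; pose s : R := `|sin b| / pi.
have pi0 : 0 < pi :> R := @pi_gt0 R.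
have s0 : 0 <= s by rewrite divr_ge0// ltW.
have s1 : s <= 1 by exact: sin_pi_le1.
pose d := psi n%:R * omega n%:R^-1.
have w0 : 0 <= omega n%:R^-1 by rewrite omega_ge0// invr_ge0.
have d0 : 0 <= d by rewrite mulr_ge0// ltW// p0.
pose T N := \sum_(n <= j < N) psi j%:R * (omega j%:R^-1 / j%:R).
pose T' N := \sum_(n.+1 <= j < N) psi j%:R * (omega j%:R^-1 / j%:R).
have TT' N : T N <= T' N + d.
  rewrite /T /T'; have [Nn|nN] := leqP N n.
    by rewrite !big_geq ?add0r// ltnW.
  rewrite big_ltn// addrC lerD2l /d ler_wpM2l ?(ltW (p0 _ n0))//.
  by rewrite ler_pdivrMr ?ltr0n// ler_peMr// ler1n.
set Mn := \int[lebesgue_measure]_(t in `]0, n%:R^-1]) (psi t^-1 * omega t / t).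
have mainE : main_term psi beta omega n = s * Mn by rewrite /main_term -/b -/Mn /s; ring.
(* For sin b = 0 nothing is known about the sums or the integral, but both only occur multiplied by
   s = 0. Otherwise the integrability of psi(t) / t makes them finite and equal up to d. *)
have case0 : s = 0 \/ [/\ 0 < s, forall N, T N <= Mn + d &
    forall c, (forall N, T' N <= c) -> Mn <= c + d].
  have [sb|sb] := eqVneq (sin b) 0.
    by left; rewrite /s sb normr0 mul0r.
  right; have [c Hc] := psi_sum_bounded homega cM (fin sb).
  have Hc' N : T N <= c by exact: Hc.
  split.
  - by rewrite divr_gt0// normr_gt0.
  - move=> N; apply: (le_trans (TT' N)); rewrite lerD2r.
    exact: (main_integral_ge homega cM n0 N Hc').
  - move=> c' Hc1; apply: (main_integral_le homega cM n0) => N.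
    by apply: (le_trans (TT' N)); rewrite lerD2r.
have upper N : s * T N <= s * Mn + d.
  case: case0 => [->|[_ h _]]; first by rewrite !mul0r add0r.
  apply: (le_trans (ler_wpM2l s0 (h N))); rewrite mulrDr lerD2l.
  by rewrite ler_piMl.
have [f [cf fa fD]] : exists f, [/\ continuous f,
    forall t, f (t + pi / n%:R) = - f t &
    is_psi_beta_derivative psi beta f (extremal omega n)].
  apply: (@extremal_integral_exists R psi omega n C beta (s * Mn + d)) => //.
  - apply/cvgrPdist_le => e e0; have /cvgrPdist_le/(_ _ e0)[M [_ MP]] := lim0.
    near=> k; apply: MP; near: k; exact: nbhs_infty_gtr.
  - by move=> N _; exact: upper.
have value J := extremal_value homega n0 p0 pdecr pconv pslope J cf fa fD.
have fCH : class_CH psi beta omega f.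
  split; first by split => //; exact: (@alternating_periodic R n n0).
  by exists (extremal omega n) => //; exact: extremal_class_H.
have f0_le : ((`|f 0|)%:E <= class_best_approx n (class_CH psi beta omega))%E.
  apply: (le_trans (best_approx_alternating n0 cf fa)).
  by apply: ereal_sup_ubound; exists f.
have f0_ge : s * Mn - (36 * (C + 2) + 1) * d <= `|f 0|.
  case: case0 => [->|[sp _ h]].
    rewrite mul0r sub0r (@le_trans _ _ 0)// oppr_le0 mulr_ge0//.
    by rewrite addr_ge0// mulr_ge0// addr_ge0.
  (* Every partial sum is bounded through |f(0)|, hence so is the integral, up to d. *)
  have : Mn <= (`|f 0| + 36 * (C + 2) * d) / s + d.
    by apply: h => N; rewrite ler_pdivlMr// mulrC -lerBlDr; exact: value.
  rewrite -lerBlDr ler_pdivlMr// => h1.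
  have : s * d <= d by rewrite ler_piMl.
  by lra.
have top : (class_best_approx n (class_CH psi beta omega)
    <= (s * Mn + d + (2 + 5709 * (C + 2)) * d)%:E)%E.
  apply: ge_ereal_sup => _ [g gCH <-].
  by apply: (best_approx_upper homega n0 gCH C0 p0 pdecr pconv pslope) => N _; exact: upper.
(* The supremum lies between two real numbers, so it is finite. *)
move: f0_le top; case: (class_best_approx _ _) => [E| |] //.
rewrite !lee_fin => E1 E2; exists E => //; rewrite mainE ler_norml.
have Cd : 0 <= C * d by rewrite mulr_ge0.
by rewrite -/d; apply/andP; split; lra.
Unshelve. all: by end_near. Qed.

Theorem theorem1 (R : realType) (psi omega : R -> R)
    (homega : modulus_of_continuity omega) :
  exists (theta : nat -> R) (O1 : R -> nat -> R) (K : R),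
    [/\ forall n : nat, (0 < n)%N -> 2 / 3 <= theta n <= 1,
        convex_upwards omega -> forall n : nat, (0 < n)%N -> theta n = 1,
        forall (beta : R) (n : nat), `|O1 beta n| <= K &
        forall beta : R, class_M0' beta psi -> forall n : nat, (0 < n)%N ->
          class_best_approx n (class_CH psi beta omega)
          = (theta n * main_term psi beta omega n
             + O1 beta n * (psi n%:R * omega n%:R^-1))%:E].
Proof.
have theta1 : forall n : nat, (0 < n)%N -> (2 / 3 : R) <= (1 : R) <= 1.
  by move=> n _; rewrite lexx andbT ler_pdivrMr// mul1r ler_nat.
have [M0|nM0] := pselect (class_M0 psi); last first.
  exists (fun=> 1), (fun _ _ => 0), 0; split=> // [beta n|beta [_ M0]//].
  by rewrite normr0.
have [K K0 H] := class_best_approx_estimate homega M0.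
pose d n := psi n%:R * omega n%:R^-1.
pose E beta n := fine (class_best_approx n (class_CH psi beta omega)).
(* If psi(n) omega(1/n) = 0 the quotient is 0 by convention; the estimate then forces the supremum
   to equal the main term. *)
pose O1 beta n := if `[< class_M' beta psi /\ (0 < n)%N >]
  then (E beta n - main_term psi beta omega n) / d n else 0.
exists (fun=> 1), O1, K; split=> // [beta n|beta [M' _] n n0].
  rewrite /O1; case: asboolP => [[M' n0]|_]; last by rewrite normr0.
  have [e eE He] := H beta n M' n0; rewrite /E eE /= normrM normfV.
  have [->|dn] := eqVneq (d n) 0; first by rewrite normr0 invr0 mulr0.
  rewrite ler_pdivrMr ?normr_gt0//; apply: (le_trans He).
  by rewrite ler_wpM2l// ler_norm.
have [e eE He] := H beta n M' n0.
rewrite eE /O1 asboolT// /E eE /= mul1r -/(d n); congr (_%:E).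
have [dn|dn] := eqVneq (d n) 0; last by rewrite divfK// addrC subrK.
rewrite dn mulr0 addr0; move: He; rewrite -/(d n) dn mulr0 normr_le0 subr_eq0.
by move/eqP.
Qed.
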